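(* Let $S$ be a regular local ring of dimension $d+1$ with $d\ge 1$, let $f\in S$ be a non-zero non-unit, and let $R=S/(f)$ be a hypersurface of finite CM representation type, with representation generator $M$. Let $R^\#=S[y]/(f+y^n)$ for some $n\ge 1$, and set $\Lambda=\operatorname{End}_{R^\#}(\Omega_{R^\#}(M))$. Then every finitely generated left (resp. right) $\Lambda$-module has a projective resolution which is eventually periodic of period at most $2$.
   Context: MCM means maximal Cohen-Macaulay (finitely generated with depth equal to the dimension of the ring, or zero). $R$ has finite CM representation type if it has only finitely many isomorphism classes of indecomposable MCM modules. A representation generator is a MCM $R$-module $M$ with $\operatorname{add}M=\operatorname{MCM}(R)$, where $\operatorname{add}M$ is the category of direct summands of finite direct sums of copies of $M$ and $\operatorname{MCM}(R)$ the category of MCM $R$-modules. $M$ is regarded as an $R^\#$-module via $R=R^\#/(y)$, and $\Omega_{R^\#}(M)$ is its first syzygy over the local ring $R^\#$ (the kernel of a minimal free cover). Endomorphisms are written on the right, so that $\Omega_{R^\#}(M)$ is a left $R^\#$-module and a right $\Lambda$-module. A projective resolution $\cdots\to P_1\to P_0$ is eventually periodic of period at most $2$ if from some point on its terms and differentials repeat with period dividing $2$ (up to isomorphism). *)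

(* Defs.v *)
From HB Require Import structures.
From mathcomp Require Import all_boot all_order all_algebra.
From mathcomp Require Import boolp.

Set Implicit Arguments.
Unset Strict Implicit.
Unset Printing Implicit Defensive.

Import GRing.Theory.
Local Open Scope ring_scope.
Local Open Scope quotient_scope.

Section Modules.
Variable A : pzRingType.

Definition surj (T U : Type) (g : T -> U) : Prop := forall y, exists x, g x = y.

Definition lmod_iso (U V : lmodType A) : Prop :=
  exists g : {linear U -> V}, bijective g.

Definition zero_module (U : lmodType A) : Prop := forall x : U, x = 0.

Definition fin_gen (U : lmodType A) : Prop :=
  exists (r : nat) (g : 'I_r -> U), forall x : U,
  exists c : 'I_r -> A, x = \sum_i c i *: g i.

Definition indecomposable (U : lmodType A) : Prop :=
  ~ zero_module U /\
  forall V W : lmodType A, lmod_iso U (V * W)%type ->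
    zero_module V \/ zero_module W.

Definition in_add (M U : lmodType A) : Prop :=
  exists (k : nat) (V : lmodType A), lmod_iso (U * V)%type {ffun 'I_k -> M}.

Definition projective (P : lmodType A) : Prop :=
  forall (U V : lmodType A) (g : {linear U -> V}) (h : {linear P -> V}),
    surj g -> exists h' : {linear P -> U}, forall x, g (h' x) = h x.

Record proj_resolution (X : lmodType A) := ProjResolution {
  res_term : nat -> lmodType A;
  res_diff : forall i, {linear res_term i.+1 -> res_term i};
  res_aug : {linear res_term 0 -> X};
  res_proj : forall i, projective (res_term i);
  res_surj : surj res_aug;
  res_exact0 : forall x, res_aug x = 0 <-> exists z, res_diff 0 z = x;
  res_exact : forall i x, res_diff i x = 0 <-> exists z, res_diff i.+1 z = x
}.

(* The terms from degree N on are isomorphic, compatibly with the differentials,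
   to the terms two steps further: the period divides 2. *)
Definition eventually_2periodic (X : lmodType A) (P : proj_resolution X) : Prop :=
  exists (N : nat) (e : forall i, {linear res_term P i.+2 -> res_term P i}),
  forall i, (N <= i)%N ->
    bijective (e i) /\
    forall x, e i (res_diff P i.+2 x) = res_diff P i (e i.+1 x).

End Modules.

(* The additive group of [M]; the unused [q] is what its [A]-module structure,
   declared below, is inferred from. *)
Definition restrict_scalars (A B : pzRingType) (q : {rmorphism A -> B})
  (M : lmodType B) : Type := M.
Arguments restrict_scalars {A B} q M.

Section RestrictionOfScalars.
Variables (A B : pzRingType) (q : {rmorphism A -> B}) (M : lmodType B).
Local Notation qM := (restrict_scalars q M).

HB.instance Definition _ := GRing.Zmodule.copy qM M.

Definition restrict_scale (a : A) (x : qM) : qM := q a *: (x : M).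
Local Notation scale := restrict_scale.

Fact restrict_scaleA a b x : scale a (scale b x) = scale (a * b) x.
Proof. by rewrite /restrict_scale rmorphM scalerA. Qed.
Fact restrict_scale1 : left_id 1 scale.
Proof. by move=> x; rewrite /restrict_scale rmorph1 scale1r. Qed.
Fact restrict_scaleDr : right_distributive scale +%R.
Proof. by move=> a x y; rewrite /restrict_scale scalerDr. Qed.
Fact restrict_scaleDl x : {morph scale^~ x : a b / a + b}.
Proof. by move=> a b; rewrite /restrict_scale rmorphD scalerDl. Qed.
HB.instance Definition _ := GRing.Zmodule_isLmodule.Build A qM
  restrict_scaleA restrict_scale1 restrict_scaleDr restrict_scaleDl.

End RestrictionOfScalars.

Section Kernel.
Variables (A : pzRingType) (U V : lmodType A) (p : {linear U -> V}).

Definition ker_pred : {pred U} := fun x => p x == 0.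

Fact ker_pred_submod : submod_closed ker_pred.
Proof.
split=> [|a x y]; rewrite !unfold_in ?linear0 // => /eqP hx /eqP hy.
by rewrite linearP hx hy scaler0 addr0.
Qed.
HB.instance Definition _ := GRing.isSubmodClosed.Build A U ker_pred ker_pred_submod.

Definition lin_ker : Type := {x : U | x \in ker_pred}.
HB.instance Definition _ := SubChoice.on lin_ker.
HB.instance Definition _ := [SubChoice_isSubLmodule of lin_ker by <:].

End Kernel.

Section EndomorphismRing.
Variables (A : comPzRingType) (N : lmodType A).

Definition end_ring : Type := {linear N -> N}.
HB.instance Definition _ := gen_eqMixin end_ring.
HB.instance Definition _ := gen_choiceMixin end_ring.
Implicit Types g h k : end_ring.
Local Notation fn g := (g : {linear N -> N}).

Fact end_ringP g h : fn g =1 fn h -> g = h.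
Proof.
case: g => f [[a] [b]]; case: h => f' [[a'] [b']] /= /funext e.
case: _ / e a' b' => a' b'.
by rewrite (Prop_irrelevance a a') (Prop_irrelevance b b').
Qed.

Definition end_zero : end_ring := \0 : {linear N -> N}.
Definition end_opp g : end_ring := (-%R \o fn g) : {linear N -> N}.
Definition end_add g h : end_ring := (fn g \+ fn h) : {linear N -> N}.
Definition end_one : end_ring := idfun : {linear N -> N}.
(* Endomorphisms are written on the right: g * h is g followed by h. *)
Definition end_mul g h : end_ring := (fn h \o fn g) : {linear N -> N}.

Fact end_addA : associative end_add.
Proof. by move=> g h k; apply: end_ringP => x /=; rewrite addrA. Qed.
Fact end_addC : commutative end_add.
Proof. by move=> g h; apply: end_ringP => x /=; rewrite addrC. Qed.
Fact end_add0 : left_id end_zero end_add.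
Proof. by move=> g; apply: end_ringP => x /=; rewrite add0r. Qed.
Fact end_addN : left_inverse end_zero end_opp end_add.
Proof. by move=> g; apply: end_ringP => x /=; rewrite addNr. Qed.
HB.instance Definition _ := GRing.isZmodule.Build end_ring
  end_addA end_addC end_add0 end_addN.

Fact end_mulA : associative end_mul.
Proof. by move=> g h k; apply: end_ringP. Qed.
Fact end_mul1l : left_id end_one end_mul.
Proof. by move=> g; apply: end_ringP. Qed.
Fact end_mul1r : right_id end_one end_mul.
Proof. by move=> g; apply: end_ringP. Qed.
Fact end_mulDl : left_distributive end_mul +%R.
Proof. by move=> g h k; apply: end_ringP => x /=; rewrite linearD. Qed.
Fact end_mulDr : right_distributive end_mul +%R.
Proof. by move=> g h k; apply: end_ringP. Qed.
HB.instance Definition _ := GRing.Zmodule_isPzRing.Build end_ring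
  end_mulA end_mul1l end_mul1r end_mulDl end_mulDr.

End EndomorphismRing.

Section CommutativeAlgebra.
Variable A : comNzRingType.
Implicit Types (m P I : {pred A}) (M : lmodType A).

Definition unit_elt (a : A) : Prop := exists b, b * a = 1.

(* [idealr_closed] and [prime_idealr_closed] only concern proper ideals;
   arbitrary ideals are the submodules of the regular module [A^o]. *)
Definition prime_ideal P : Prop := idealr_closed P /\ prime_idealr_closed P.

Definition maximal_ideal m : Prop :=
  idealr_closed m /\
  forall I, idealr_closed I -> {subset m <= I} -> {subset I <= m}.

Definition local_with m : Prop :=
  maximal_ideal m /\ forall m', maximal_ideal m' -> m' =i m.

Definition ideal_generated_by I (r : nat) (g : 'I_r -> A) : Prop :=
  forall x, x \in I <-> exists c : 'I_r -> A, x = \sum_i c i * g i.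

Definition noetherian : Prop :=
  forall I, submod_closed (I : {pred A^o}) ->
  exists (r : nat) (g : 'I_r -> A), ideal_generated_by I g.

Definition prime_chain (l : nat) : Prop :=
  exists P : nat -> {pred A},
    (forall i, (i <= l)%N -> prime_ideal (P i)) /\
    (forall i, (i < l)%N ->
      {subset P i <= P i.+1} /\ ~ {subset P i.+1 <= P i}).

Definition krull_dim (d : nat) : Prop :=
  prime_chain d /\ forall l, prime_chain l -> (l <= d)%N.

Definition regular_local (d : nat) : Prop :=
  noetherian /\ krull_dim d /\
  exists m, local_with m /\ exists g : 'I_d -> A, ideal_generated_by m g.

(* z lies in the submodule (x_0, ..., x_(k-1)) M. *)
Definition in_seq_mul M (t : nat) (x : 'I_t -> A) (k : nat) (z : M) : Prop :=
  exists w : 'I_t -> M, z = \sum_(j < t | (j < k)%N) x j *: w j.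

Definition regular_sequence m M (t : nat) (x : 'I_t -> A) : Prop :=
  [/\ forall i, x i \in m,
      forall (i : 'I_t) (z : M), in_seq_mul x i (x i *: z) -> in_seq_mul x i z
    & exists z : M, ~ in_seq_mul x t z].

Definition depth m M (t : nat) : Prop :=
  (exists x : 'I_t -> A, regular_sequence m M x) /\
  forall (s : nat) (x : 'I_s -> A), regular_sequence m M x -> (s <= t)%N.

Definition MCM M : Prop :=
  fin_gen M /\
  (zero_module M \/
   exists (m : {pred A}) (d : nat), [/\ local_with m, krull_dim d & depth m M d]).

Definition finite_CM_type : Prop :=
  exists (r : nat) (F : 'I_r -> lmodType A),
  forall M, MCM M -> indecomposable M -> exists i, lmod_iso M (F i).

Definition representation_generator M : Prop :=
  MCM M /\ forall N : lmodType A, in_add M N <-> MCM N.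

Definition minimal_free_cover M (r : nat) (p : {linear 'rV[A]_r -> M}) : Prop :=
  surj p /\ forall (s : nat) (p' : {linear 'rV[A]_s -> M}), surj p' -> (r <= s)%N.

End CommutativeAlgebra.

Section PrincipalQuotient.
Variables (A : comNzRingType) (a : A) (ha : ~ unit_elt a).

Definition principal_ideal of ~ unit_elt a : {pred A} :=
  fun x => `[< exists b, x = b * a >].

Fact principal_ideal_closed : idealr_closed (principal_ideal ha).
Proof.
split.
- by apply/asboolP; exists 0; rewrite mul0r.
- by apply/asboolP => -[b e]; apply: ha; exists b.
- move=> c u v /asboolP[b ->] /asboolP[b' ->]; apply/asboolP.
  by exists (c * b + b'); rewrite mulrDl mulrA.
Qed.
HB.instance Definition _ :=
  isIdealr.Build A (principal_ideal ha) principal_ideal_closed.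

Definition principal_quot : comNzRingType := {ideal_quot (principal_ideal ha)}.

End PrincipalQuotient.

Section BranchedCover.
Variables (S : comNzRingType) (f : S) (hf : ~ unit_elt f).
Variables (n : nat) (hn : (0 < n)%N).

Fact branched_cover_nonunit : ~ unit_elt (f%:P + 'X^n).
Proof.
case=> g /(congr1 (horner_eval 0)); rewrite /horner_eval hornerM hornerD hornerC.
rewrite hornerXn expr0n eqn0Ngt hn addr0 hornerC => e.
by apply: hf; exists g.[0].
Qed.

Definition branched_cover : comNzRingType := principal_quot branched_cover_nonunit.

(* The projection S[y]/(f + y^n) -> S/(f) modulo the class of y. *)
Definition cover_proj (x : branched_cover) : principal_quot hf :=
  \pi_{ideal_quot (principal_ideal hf)}
    (repr (x : {ideal_quot (principal_ideal branched_cover_nonunit)})).[0].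

Fact cover_projE (g : {poly S}) :
  cover_proj (\pi_{ideal_quot (principal_ideal branched_cover_nonunit)} g) =
  \pi_{ideal_quot (principal_ideal hf)} g.[0].
Proof.
rewrite /cover_proj; case: piP => h /eqP.
rewrite -Quotient.idealrBE => /asboolP[b e]; apply/eqP; rewrite eq_sym.
rewrite -Quotient.idealrBE; apply/asboolP; exists b.[0].
rewrite -hornerN -hornerD e hornerM hornerD hornerC hornerXn expr0n.
by rewrite eqn0Ngt hn addr0.
Qed.

Fact cover_proj_zmod : zmod_morphism cover_proj.
Proof.
move=> x y; rewrite -[x]reprK -[y]reprK -rmorphB !cover_projE.
by rewrite hornerD hornerN rmorphB.
Qed.
Fact cover_proj_monoid : monoid_morphism cover_proj.
Proof.
split; first by rewrite -(rmorph1 (\pi_{ideal_quot _})) cover_projE hornerC rmorph1.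
move=> x y; rewrite -[x]reprK -[y]reprK -rmorphM !cover_projE.
by rewrite hornerM rmorphM.
Qed.
HB.instance Definition _ := GRing.isZmodMorphism.Build
  branched_cover (principal_quot hf) cover_proj cover_proj_zmod.
HB.instance Definition _ := GRing.isMonoidMorphism.Build
  branched_cover (principal_quot hf) cover_proj cover_proj_monoid.

End BranchedCover.
Arguments cover_proj {S f} hf {n} hn x.

(* Main.v *)
(* Write A for S[y]/(f + y^n) and N for the syzygy of M. An A-module X that is free
   over S is a square matrix Z over S with Z^n = -f. For such an X let ev : A (x) X -> X
   be the S-free cover, with kernel W. Pulling 0 -> W -> A (x) X -> X -> 0 back along
   multiplication by y on X gives 0 -> W -> T -> X -> 0, and similarly there is a sequence
   0 -> X -> T' -> W -> 0. Multiplication by y on N factors through the free module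
   A^r, so both sequences stay exact under Hom(N, -); and T = ker(A (x) X -> X/yX), where
   X/yX is a maximal Cohen-Macaulay R-module, hence a summand of a power of M, so that T
   is a summand of a power of N. Splicing gives a 2-periodic projective resolution of
   Hom(N, X).

   The higher syzygies of a finitely generated End(N)-module are of the form Hom(N, V),
   where the V are successive syzygies over S, hence eventually S-free as S is regular.
   Once N is written as a matrix, all that is used about it is a set of matrix identities
   invariant under transposition, which settles right modules as well.

   That N is S-free, and that matrix factorizations of f have maximal Cohen-Macaulay
   cokernels, follows from the exchange property of regular sequences and from the fact
   that generators of the maximal ideal of a regular local ring form a regular sequence,
   itself a consequence of Krull's principal ideal theorem. *)

Require Import Defs.
From HB Require Import structures.
From mathcomp Require Import all_boot all_order all_algebra.
From mathcomp Require Import boolp ring zify.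

Set Implicit Arguments.
Unset Strict Implicit.
Unset Printing Implicit Defensive.

Import GRing.Theory.
Local Open Scope ring_scope.

(** * Submodules, Noetherian modules and Nakayama's lemma *)

(** The evaluation A (x) X -> X is in general not onto after Hom(N, -): a map N -> X meets an
    obstruction in Ext^1(N, W). Since y kills M, yA^r lies in N, so y on N is a composite N -> A^r
    -> N and annihilates the obstruction; this is why the sequence is pulled back along y. That T is
    a summand of a power of N needs a correction: a retraction of M^k onto X/yX lifts to free covers
    only up to an error A^l -> T, which is absorbed because A itself is a summand of a power of N.
    Quotients and localisations are never formed: V/W is represented by the submodule W of V, and
    ideals of A_P by P-saturated ideals. Likewise an S-free A-module is a matrix acting on row
    vectors, so that maps written on the right compose as matrices multiply, and End(N) becomes the
    centraliser of the matrix Y of y. *)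

Definition submod (A : comNzRingType) (V : lmodType A) (W : V -> Prop) : Prop :=
  W 0 /\ forall a u v, W u -> W v -> W (a *: u + v).

Section Submodules.
Variables (A : comNzRingType) (V : lmodType A).
Implicit Types (W : V -> Prop) (I P : A -> Prop) (s : seq V).

Lemma submod0 W : submod W -> W 0. Proof. by case. Qed.

Lemma submodD W u v : submod W -> W u -> W v -> W (u + v).
Proof. by move=> [_ h] wu wv; rewrite -[u]scale1r; apply: h. Qed.

Lemma submodZ W u a : submod W -> W u -> W (a *: u).
Proof. by move=> [w0 h] wu; rewrite -[a *: u]addr0; apply: h. Qed.

Lemma submodN W u : submod W -> W u -> W (- u).
Proof. by move=> sW wu; rewrite -scaleN1r; apply: submodZ. Qed.

Lemma submodB W u v : submod W -> W u -> W v -> W (u - v).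
Proof. by move=> sW wu wv; apply: submodD => //; apply: submodN. Qed.

Lemma submod_sum W (I0 : Type) (r : seq I0) (Q : pred I0) (F : I0 -> V) :
  submod W -> (forall i, Q i -> W (F i)) -> W (\sum_(i <- r | Q i) F i).
Proof.
by move=> sW; apply: big_ind => [|x y]; [exact: submod0 | exact: submodD].
Qed.

End Submodules.

Lemma submodT (A : comNzRingType) (V : lmodType A) : submod (fun _ : V => True).
Proof. by []. Qed.

Section Spans.
Variables (A : comNzRingType) (V : lmodType A).
Implicit Types (W : V -> Prop) (I P : A -> Prop) (s : seq V).

(** The coefficients are restricted to [I]: for [I] the maximal ideal and generators [s] of V this
    is the submodule mV of Nakayama's lemma, and for [I] everything it is the span. *)
Fixpoint span_in I s (v : V) : Prop :=
  if s is g :: s' then exists2 c, I c & span_in I s' (v - c *: g) else v = 0.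

Notation span := (span_in (fun=> True)).

Lemma span_in_submod I s : @submod A A^o I -> submod (span_in I s).
Proof.
move=> sI; elim: s => [|g s [h0 hs]]; first by split=> //= a u v -> ->; rewrite scaler0 addr0.
split=> [|a u v] /=.
  by exists 0; [exact: (submod0 sI) | rewrite scale0r subr0].
move=> [c Ic hc] [c' Ic' hc']; exists (a * c + c').
  exact: (sI.2 a c c').
rewrite scalerDl -scalerA opprD addrACA -scalerBr.
exact: hs.
Qed.

Lemma span_submod s : submod (span s).
Proof. exact: span_in_submod (@submodT A A^o). Qed.

Lemma span_inW I s v : span_in I s v -> span s v.
Proof. by elim: s v => //= g s IH v [c _ /IH h]; exists c. Qed.

Lemma span_in_sub I s W : submod W -> (forall g a, g \in s -> I a -> W (a *: g)) ->
  forall v, span_in I s v -> W v.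
Proof.
move=> sW; elim: s => [_ v ->|g s IH hs v]; first exact: submod0.
case=> c Ic hv; rewrite -[v](subrK (c *: g)); apply: submodD => //.
  by apply: IH => // g' a g's; apply: hs; rewrite inE g's orbT.
by apply: hs; rewrite ?mem_head.
Qed.

Lemma span_sub s W : submod W -> (forall g, g \in s -> W g) ->
  forall v, span s v -> W v.
Proof. by move=> sW h; apply: span_in_sub => // g a gs _; apply: submodZ (h g gs). Qed.

Lemma mem_span_in I s g a : @submod A A^o I -> I a -> g \in s -> span_in I s (a *: g).
Proof.
move=> sI Ia; elim: s => // h s IH; rewrite inE => /orP[/eqP->|gs] /=.
  by exists a => //; rewrite subrr; apply: submod0 (span_in_submod _ sI).
by exists 0; [exact: submod0 sI | rewrite scale0r subr0; exact: IH].
Qed.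

Lemma mem_span s g : g \in s -> span s g.
Proof. by rewrite -{2}[g]scale1r; apply: mem_span_in. Qed.

Lemma span_in_scale I s a v :
  @submod A A^o I -> I a -> span s v -> span_in I s (a *: v).
Proof.
move=> sI Ia; elim: s v => [|g s IH] v /=; first by move=> ->; rewrite scaler0.
case=> c _ hv; exists (a * c); first by rewrite mulrC; apply: (@submodZ A A^o _ _ _ sI Ia).
by rewrite -scalerA -scalerBr; apply: IH.
Qed.

Lemma span_sum (r : nat) (g : 'I_r -> V) v :
  span [seq g i | i <- enum 'I_r] v <-> exists c : 'I_r -> A, v = \sum_i c i *: g i.
Proof.
split; last first.
  case=> c ->; apply: (submod_sum _ (span_submod _)) => i _.
  apply: submodZ (span_submod _) _; apply: mem_span.
  by apply: map_f; rewrite mem_enum.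
apply: (span_sub (W := fun v => exists c : 'I_r -> A, v = \sum_i c i *: g i)) => [|x /mapP[i _ ->]].
  split=> [|a u w [c ->] [c' ->]].
    by exists (fun=> 0); rewrite big1 // => i _; rewrite scale0r.
  exists (fun i => a * c i + c' i); rewrite scaler_sumr -big_split /=.
  by apply: eq_bigr => i _; rewrite scalerDl scalerA.
exists (fun j => (j == i)%:R); rewrite (bigD1 i) //= eqxx scale1r big1 ?addr0 //.
by move=> j /negbTE->; rewrite scale0r.
Qed.

Lemma span_sumP s v : span s v -> exists c : nat -> A, v = \sum_(i < size s) c i *: s`_i.
Proof.
elim: s v => [|g s IH] v /= => [->|[a _ /IH[c e]]].
  by exists (fun=> 0); rewrite big_ord0.
exists (fun i => if i is j.+1 then c j else a).
by rewrite big_ord_recl /= -e addrC subrK.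
Qed.

Lemma span_nthP s v : span s v <-> exists c : 'I_(size s) -> A, v = \sum_i c i *: s`_i.
Proof.
split=> [/span_sumP[c ->]|[c ->]]; first by exists (fun i => c i).
apply: (submod_sum _ (span_submod _)) => i _.
by apply: (submodZ (W := span s)); [exact: span_submod | apply/mem_span/mem_nth].
Qed.

(** W + xV, which stands for the passage from V/W to its quotient by x inside the same module V. *)
Definition addx W (x : A) : V -> Prop := fun v => exists2 u, W (v - x *: u) & True.

Lemma addx_submod W x : submod W -> submod (addx W x).
Proof.
move=> sW; split=> [|a u v [u' h _] [v' h' _]].
  by exists 0 => //; rewrite scaler0 subr0; exact: submod0.
exists (a *: u' + v') => //.
rewrite scalerDr scalerA mulrC -scalerA opprD addrACA -scalerBr.
exact: sW.2.
Qed.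

Lemma addxW W x v : submod W -> W v -> addx W x v.
Proof. by move=> sW wv; exists 0 => //; rewrite scaler0 subr0. Qed.

Lemma addxx W x v : submod W -> addx W x (x *: v).
Proof. by move=> sW; exists v => //; rewrite subrr; exact: submod0. Qed.

Definition fg_sub W : Prop := exists s, forall v, W v <-> span s v.

Definition noeth : Prop := forall W, submod W -> fg_sub W.

(* A maximal principle: otherwise an infinite strictly ascending chain of submodules
   would have a union that is not finitely generated. *)
Lemma noeth_max (C : (V -> Prop) -> Prop) : noeth ->
  (forall W, C W -> submod W) -> (exists W, C W) ->
  exists2 W, C W & forall W', C W' -> (forall v, W v -> W' v) -> forall v, W' v -> W v.
Proof.
move=> nV Csub [W0 CW0]; apply: contrapT => hn.
have step (W : {W | C W}) : exists W' : {W | C W},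
    (forall v, sval W v -> sval W' v) /\ exists v, sval W' v /\ ~ sval W v.
  case: W => W CW /=; apply: contrapT => hW; apply: hn; exists W => // W' CW' sWW' v W'v.
  apply: contrapT => nWv; apply: hW; exists (exist _ W' CW'); split=> //=.
  by exists v.
have [F hF] := choice step.
pose ch i := iter i F (exist _ W0 CW0).
have mono i j : (i <= j)%N -> forall v, sval (ch i) v -> sval (ch j) v.
  move=> /subnK <-; elim: (j - i)%N => // k IH v /IH; rewrite addSn /=.
  exact: (hF _).1.
have chsub i : submod (sval (ch i)) by apply: Csub; case: (ch i).
pose U v := exists i, sval (ch i) v.
have sU : submod U.
  split=> [|a u v [i hi] [j hj]]; first by exists 0%N; apply: submod0.
  exists (maxn i j); apply: (chsub _).2; apply: mono; last by eauto.
  - exact: leq_maxl.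
  - by eauto.
  exact: leq_maxr.
have [s hs] := nV U sU.
have [N hN] : exists N, forall g, g \in s -> sval (ch N) g.
  have : forall g, g \in s -> U g by move=> g gs; apply/hs/mem_span.
  elim: s {hs} => [|g s IH] hU; first by exists 0%N.
  have [|N hN] := IH; first by move=> h hs; apply: hU; rewrite inE hs orbT.
  have [i hi] := hU g (mem_head _ _).
  exists (maxn i N) => h; rewrite inE => /orP[/eqP->|/hN].
    exact: mono (leq_maxl _ _) _ hi.
  exact/mono/leq_maxr.
have [v [h1 h2]] := (hF (ch N)).2.
apply: h2; apply: (span_sub (chsub N) hN); apply/hs.
by exists N.+1.
Qed.

End Spans.

Notation span := (span_in (fun=> True)).

Lemma span_fg (A : comNzRingType) (V : lmodType A) : fin_gen V ->
  exists s : seq V, forall v, span s v.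
Proof.
move=> [r [g hg]]; exists [seq g i | i <- enum 'I_r] => v; apply/span_sum.
exact: hg.
Qed.

Lemma fg_span (A : comNzRingType) (V : lmodType A) (s : seq V) :
  (forall v, span s v) -> fin_gen V.
Proof.
by move=> h; exists (size s), (fun i => s`_i) => v; apply/span_nthP/h.
Qed.

Lemma noetherian_noeth (A : comNzRingType) : noetherian A -> noeth A^o.
Proof.
move=> nA I sI.
have [|r [g hg]] := nA (fun x => `[< I x >]).
  split=> [|a u v]; rewrite !unfold_in; first exact/asboolP/(submod0 sI).
  by move=> /asboolP hu /asboolP hv; apply/asboolP; apply: sI.2.
exists [seq (g i : A^o) | i <- enum 'I_r] => v.
rewrite span_sum; split=> [Iv|/hg /asboolP //].
by apply/hg; apply/asboolP.
Qed.

(** As in Hilbert's argument: the coefficients of [g] that occur in [W] form an ideal, finitely many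
    elements of [W] realise its generators, and subtracting combinations of them leaves elements of
    [W] in the span of the remaining generators. *)
Lemma noeth_span (A : comNzRingType) (V : lmodType A) (s : seq V) (W : V -> Prop) :
  noeth A^o -> submod W -> (forall v, W v -> span s v) -> fg_sub W.
Proof.
move=> nA; elim: s W => [|g s IH] W sW hW.
  exists [::] => v; split=> [/hW //|/= ->]; exact: submod0.
pose I (c : A^o) := exists2 u, span s u & W (c *: g + u).
have sI : submod I.
  split=> [|a c c' [u hu hW1] [u' hu' hW2]].
    exists 0; first exact: submod0 (span_submod s).
    by rewrite scale0r add0r; exact: submod0.
  exists (a *: u + u'); first exact: (span_submod s).2.
  rewrite scalerDl -scalerA addrACA -scalerDr.
  exact: sW.2.
have [cs hcs] := nA I sI.
have [W' hW'] : exists ws : seq V, (forall w, w \in ws -> W w) /\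
    forall c, span cs c -> exists2 u, span s u & span ws (c *: g + u).
  have : forall c, c \in cs -> I c by move=> c /mem_span /hcs.
  elim: cs {hcs} => [|c cs IHc] hI.
    exists [::]; split=> // c /= ->; exists 0; first exact: submod0 (span_submod s).
    by rewrite scale0r addr0.
  have [|ws [h1 h2]] := IHc; first by move=> x xc; apply: hI; rewrite inE xc orbT.
  have [u hu hWu] := hI c (mem_head _ _).
  exists ((c *: g + u) :: ws); split=> [w|x].
    by rewrite inE => /orP[/eqP->|/h1].
  move=> [a _ /h2 [u' hu' hws]].
  exists (u' + a *: u).
    by apply: submodD (span_submod s) _ _ => //; apply: submodZ (span_submod s) _.
  exists a => //.
  suff -> : x *: g + (u' + a *: u) - a *: (c *: g + u) = (x - a *: c) *: g + u' by [].
  by rewrite scalerDr scalerA opprD addrACA addrK scalerBl.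
have [hw1 hw2] := hW'.
have [| |t ht] := IH (fun v => W v /\ span s v).
- split=> [|a u v [h1 h2] [h3 h4]]; first by split; [exact: submod0|exact: submod0 (span_submod s)].
  by split; [exact: sW.2|exact: (span_submod s).2].
- by move=> v [].
exists (W' ++ t) => v; split.
  move=> Wv; have [c _ hc] := hW v Wv.
  have Ic : I c by exists (v - c *: g) => //; rewrite addrC subrK.
  have [u hu huw] := hw2 c ((hcs c).1 Ic).
  have hd : span t (v - (c *: g + u)).
    apply/ht; split.
      apply: submodB => //; exact: (span_sub sW hw1).
    by rewrite opprD addrA; apply: submodB (span_submod s) _ _.
  rewrite -[v](subrK (c *: g + u)); apply: submodD (span_submod _) _ _.
    apply: (span_sub (span_submod _)) hd => h ht'; apply: mem_span.
    by rewrite mem_cat ht' orbT.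
  apply: (span_sub (span_submod _)) huw => h ht'; apply: mem_span.
  by rewrite mem_cat ht'.
apply: span_sub => // h; rewrite mem_cat => /orP[/hw1 //|hh].
exact: ((ht h).2 (mem_span hh)).1.
Qed.

Lemma noeth_fg (A : comNzRingType) (V : lmodType A) :
  noeth A^o -> fin_gen V -> noeth V.
Proof. by move=> nA /span_fg[s hs] W sW; apply: (noeth_span (s := s)). Qed.

Section PrimeIdeals.
Variable A : comNzRingType.
Implicit Types P I : A -> Prop.

Definition ideal I : Prop := @submod A A^o I.

Definition is_prime P : Prop :=
  [/\ ideal P, ~ P 1 & forall a b, P (a * b) -> P a \/ P b].

Lemma ideal0 I : ideal I -> I 0. Proof. exact: (@submod0 A A^o). Qed.
Lemma idealD I a b : ideal I -> I a -> I b -> I (a + b).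
Proof. exact: (@submodD A A^o). Qed.
Lemma idealB I a b : ideal I -> I a -> I b -> I (a - b).
Proof. exact: (@submodB A A^o). Qed.
Lemma idealN I a : ideal I -> I a -> I (- a).
Proof. exact: (@submodN A A^o). Qed.
Lemma idealMl I a b : ideal I -> I b -> I (a * b).
Proof. exact: (@submodZ A A^o). Qed.
Lemma idealMr I a b : ideal I -> I a -> I (a * b).
Proof. by rewrite mulrC; exact: idealMl. Qed.

Lemma prime_ideal_of P : is_prime P -> ideal P. Proof. by case. Qed.
Lemma prime1 P : is_prime P -> ~ P 1. Proof. by case. Qed.
Lemma primeM P a b : is_prime P -> ~ P a -> ~ P b -> ~ P (a * b).
Proof. by case=> _ _ h na nb /h []. Qed.
Lemma primeX P a n : is_prime P -> ~ P a -> ~ P (a ^+ n).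
Proof.
move=> pP na; elim: n => [|n IH]; first by rewrite expr0; exact: prime1.
by rewrite exprS; apply: primeM.
Qed.
Lemma prime_notD P a b : ideal P -> P a -> ~ P b -> ~ P (b + a).
Proof. by move=> iP Pa nPb h; apply: nPb; rewrite -[b](addrK a); apply: idealB. Qed.

(* Nakayama's lemma localised at P, by elimination of the generators. *)
Lemma nakayama_prime (V : lmodType A) (N : V -> Prop) P (s : seq V) :
  is_prime P -> submod N ->
  (forall g, g \in s -> exists2 t, ~ P t & exists2 w, N w & span_in P s (t *: g - w)) ->
  exists2 t, ~ P t & forall g, g \in s -> N (t *: g).
Proof.
move=> pP sN; have iP := prime_ideal_of pP.
elim: s => [|g s IH] hs; first by exists 1 => //; exact: prime1.
have [t0 nt0 [w0 Nw0 [c Pc hc]]] := hs g (mem_head _ _).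
(* Moving [c *: g] to the left leaves the coefficient [s0], still outside [P]; multiplying the other
   relations by [s0] then eliminates [g] from them. *)
pose s0 := t0 - c.
have ns0 : ~ P s0 by apply: prime_notD => //; apply: idealN.
have e0 : t0 *: g - w0 - c *: g = s0 *: g - w0.
  by rewrite /s0 scalerBl addrAC.
rewrite e0 in hc.
have [|t nt ht] := IH.
  move=> h hh; have [t1 nt1 [w1 Nw1 [d Pd hd]]] := hs h (mem_behead (s := g :: s) hh).
  exists (s0 * t1); first exact: primeM.
  exists (s0 *: w1 + d *: w0); first exact: sN.2 (submodZ d sN Nw0).
  have -> : (s0 * t1) *: h - (s0 *: w1 + d *: w0) =
    s0 *: (t1 *: h - w1 - d *: g) + d *: (s0 *: g - w0).
    rewrite -!scalerA !scalerBr [d *: (s0 *: g)]scalerA [s0 *: (d *: g)]scalerA.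
    by rewrite [d * s0]mulrC addrA subrK opprD addrA.
  apply: submodD (span_in_submod _ iP) _ _.
    exact: submodZ (span_in_submod _ iP) _.
  by apply: span_in_scale => //; apply: span_inW hc.
exists (t * s0); first exact: primeM.
move=> h; rewrite inE => /orP[/eqP->|hh]; last first.
  by rewrite mulrC -scalerA; apply: submodZ => //; apply: ht.
have : N (t *: (s0 *: g - w0)).
  apply: (span_in_sub (W := fun v => N (t *: v)) _ _ hc).
    split=> [|a u v Nu Nv]; first by rewrite scaler0; exact: submod0.
    by rewrite scalerDr scalerA mulrC -scalerA; apply: sN.2.
  by move=> x a xs _; rewrite scalerA mulrC -scalerA; apply: submodZ => //; apply: ht.
rewrite scalerBr scalerA => h1.
by rewrite -[_ *: g](subrK (t *: w0)); apply: submodD => //; apply: submodZ.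
Qed.

End PrimeIdeals.

(** * Prime avoidance and regular sequences *)

Section PrimeAvoidance.
Variables (A : comNzRingType) (V : lmodType A) (W : V -> Prop).
Hypotheses (nA : noeth A^o) (nV : noeth V) (sW : submod W).

Definition nzd (x : A) : Prop := forall v, W (x *: v) -> W v.

(** Classes in V/W with annihilator maximal among those of nonzero classes. These annihilators are
    prime and together contain every zero divisor on V/W. *)
Definition maxann (v : V) : Prop := ~ W v /\
  forall w, ~ W w -> (forall a : A, W (a *: v) -> W (a *: w)) ->
  forall a : A, W (a *: w) -> W (a *: v).

Lemma ann_ideal v : ideal (fun a : A => W (a *: v)).
Proof.
split=> [|a b c hb hc]; first by rewrite scale0r; exact: submod0.
by rewrite scalerDl -scalerA; apply: sW.2.
Qed.

Lemma maxann_prime v : maxann v -> is_prime (fun a : A => W (a *: v)).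
Proof.
move=> [nWv hmax]; split; [exact: ann_ideal|by rewrite scale1r|].
move=> a b Wab; have [h|h] := EM (W (b *: v)); [by right|left].
apply: (hmax (b *: v)) => //; last by rewrite scalerA.
by move=> c hc; rewrite scalerA mulrC -scalerA; apply: submodZ.
Qed.

Lemma zero_divisor_maxann x v : ~ W v -> W (x *: v) ->
  exists2 u, maxann u & W (x *: u).
Proof.
move=> nWv Wxv.
have [||I [u [nWu Wxu e]] hI] :=
  noeth_max (V := A^o) (C := fun I => exists u, [/\ ~ W u, W (x *: u)
    & I = fun a : A => W (a *: u)]) nA.
- by move=> I [u [_ _ ->]]; exact: ann_ideal.
- by exists (fun a : A => W (a *: v)); exists v.
subst I; exists u => //; split=> // w nWw hw a hwa.
apply: (hI (fun a : A => W (a *: w))) => //.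
by exists w; split=> //; apply: hw.
Qed.

Lemma prime_not_prod (P : A -> Prop) (T : eqType) (s : seq T) (Q : T -> A -> Prop) :
  is_prime P -> (forall u, u \in s -> ideal (Q u)) ->
  (forall u, u \in s -> exists2 p, Q u p & ~ P p) ->
  exists2 p, (forall u, u \in s -> Q u p) & ~ P p.
Proof.
move=> pP; elim: s => [|u s IH] hQ h; first by exists 1 => //; exact: prime1.
have [||p hp nPp] := IH.
- by move=> w ws; apply: hQ; rewrite inE ws orbT.
- by move=> w ws; apply: h; rewrite inE ws orbT.
have [q Qq nPq] := h u (mem_head _ _).
exists (q * p); last exact: primeM.
move=> w; rewrite inE => /orP[/eqP->|ws].
  by apply: idealMr => //; apply: hQ; rewrite mem_head.
by apply: idealMl; [apply: hQ; rewrite inE ws orbT|exact: hp].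
Qed.

(* Only finitely many maximal annihilators occur: each one contains the annihilator
   of a generator of the submodule spanned by the elements realising them. *)
Lemma finite_maxann : exists s : seq V, (forall u, u \in s -> maxann u) /\
  forall v, maxann v -> exists2 u, u \in s & forall a : A, W (a *: v) -> W (a *: u).
Proof.
have [||U [s [hs eU]] hU] := noeth_max (V := V)
  (C := fun U => exists s : seq V, (forall u, u \in s -> maxann u) /\ U = span s) nV.
- by move=> U [s [_ ->]]; exact: span_submod.
- by exists (span [::]); exists [::].
subst U; exists s; split=> // v mv.
have vs : span s v.
  apply: (hU (span (v :: s))); last by apply: mem_span; rewrite mem_head.
    exists (v :: s); split=> // u.
    by rewrite inE => /orP[/eqP->|/hs].
  apply: span_sub; first exact: span_submod.
  by move=> u us; apply: mem_span; rewrite inE us orbT.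
apply: contrapT => hn.
have [||p hp []] := prime_not_prod (s := s) (Q := fun u a => W (a *: u)) (maxann_prime mv).
- by move=> u _; exact: ann_ideal.
- move=> u us; apply: contrapT => hp; apply: hn; exists u => //.
  apply: (hs u us).2; first by case: mv.
  by move=> a hua; apply: contrapT => hva; apply: hp; exists a.
apply: (span_sub (W := fun v => W (p *: v))) vs => //.
split=> [|a x y hx hy]; first by rewrite scaler0; exact: submod0.
by rewrite scalerDr scalerA mulrC -scalerA; apply: sW.2.
Qed.

Variable m : A -> Prop.

Definition nosocle : Prop := forall v, (forall a, m a -> W (a *: v)) -> W v.

(** Prime avoidance inside the coset a + I, where I contains m^2. The coset form allows generators
    of m to be made regular without changing them modulo m^2. *)
Lemma avoid_coset (I : A -> Prop) (a : A) : ideal I ->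
  (forall b c, m b -> m c -> I (b * c)) -> nosocle ->
  exists2 t, I t & nzd (a + t).
Proof.
move=> iI hI ns; have [s [hs hfin]] := finite_maxann.
have [t It ht] : exists2 t, I t & forall u, u \in s -> ~ W ((a + t) *: u).
  elim: s hs {hfin} => [|u s IH] hs; first by exists 0 => //; exact: ideal0.
  have [|t It ht] := IH; first by move=> w ws; apply: hs; rewrite inE ws orbT.
  have [Wu|nWu] := EM (W ((a + t) *: u)); last first.
    by exists t => // w; rewrite inE => /orP[/eqP->|/ht].
  have mu := hs u (mem_head _ _); have pu := maxann_prime mu.
  have [||c hc nWc] :=
    prime_not_prod (s := s) (Q := fun w a => W (a *: w)) pu.
  - by move=> w _; exact: ann_ideal.
  - move=> w ws; apply: contrapT => hn; apply: (ht w ws).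
    apply: ((hs w _).2 u mu.1) Wu; first by rewrite inE ws orbT.
    by move=> b hb; apply: contrapT => nb; apply: hn; exists b.
  have [b mb nWb] : exists2 b, m b & ~ W (b *: u).
    apply: contrapT => hn; apply: mu.1; apply: ns => b mb.
    by apply: contrapT => nb; apply: hn; exists b.
  (* Modulo [W], [c] annihilates all the other elements but not [u], and [b] in [m] does not
     annihilate [u]; squaring [b] puts the correction into [I]. *)
  exists (t + b * b * c); first by apply: idealD => //; apply: idealMr => //; apply: hI.
  move=> w; rewrite inE => /orP[/eqP->|ws]; rewrite addrA.
    rewrite [a + t + _]addrC; apply: (prime_notD (prime_ideal_of pu) Wu).
    by apply: (primeM pu) => //; apply: (primeM pu).
  rewrite scalerDl => h; apply: (ht w ws).
  rewrite -[_ *: w](addrK ((b * b * c) *: w)).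
  by apply: submodB => //; rewrite -scalerA; apply: submodZ => //; apply: hc.
exists t => // v Wv; apply: contrapT => nWv.
have [u mu Wu] := zero_divisor_maxann nWv Wv.
by have [w ws hw] := hfin u mu; apply: (ht w ws); apply: hw.
Qed.

End PrimeAvoidance.

Lemma predext (T : Type) (P Q : T -> Prop) : (forall x, P x <-> Q x) -> P = Q.
Proof. by move=> h; apply/funext => x; apply/propext. Qed.

Section RegularSequences.
Variables (A : comNzRingType) (V : lmodType A).
Implicit Types (W : V -> Prop) (xs ys : seq A).

Fixpoint regseq W xs : Prop :=
  if xs is x :: xs' then nzd W x /\ regseq (addx W x) xs' else True.

Fixpoint addxs W xs : V -> Prop :=
  if xs is x :: xs' then addxs (addx W x) xs' else W.

Lemma addxs_submod W xs : submod W -> submod (addxs W xs).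
Proof. by elim: xs W => //= x xs IH W sW; apply/IH/addx_submod. Qed.

Lemma addxC W x y : addx (addx W x) y = addx (addx W y) x.
Proof.
apply/predext => v; split=> [[u [w h _] _]|[u [w h _] _]].
  by exists w => //; exists u => //; rewrite addrAC.
by exists w => //; exists u => //; rewrite addrAC.
Qed.

Lemma addxsW W xs v : submod W -> W v -> addxs W xs v.
Proof.
by elim: xs W => //= x xs IH W sW Wv; apply: IH; [exact: addx_submod|exact: addxW].
Qed.

Lemma addxs_mem W xs x v : submod W -> x \in xs -> addxs W xs (x *: v).
Proof.
elim: xs W => //= y xs IH W sW; rewrite inE => /orP[/eqP->|hx].
  by apply: addxsW; [exact: addx_submod|exact: addxx].
by apply: IH => //; apply: addx_submod.
Qed.

Lemma addxs_min W U xs : submod U -> (forall v, W v -> U v) ->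
  (forall x v, x \in xs -> U (x *: v)) -> forall v, addxs W xs v -> U v.
Proof.
move=> sU; elim: xs W => [|x xs IH] W hW hx v /=; first exact: hW.
apply: IH => [w [u hu _]|y w yxs]; last by apply: hx; rewrite inE yxs orbT.
rewrite -[w](subrK (x *: u)); apply: submodD => //; first exact: hW.
by apply: hx; rewrite mem_head.
Qed.

Lemma regseq_cat W xs ys :
  regseq W (xs ++ ys) <-> regseq W xs /\ regseq (addxs W xs) ys.
Proof. by elim: xs W => [|x xs IH] W /=; [tauto | rewrite IH; tauto]. Qed.

Lemma nzd_addx W x y : nzd (addx W y) x -> nzd W y -> submod W ->
  nzd W x -> nzd (addx W x) y.
Proof.
move=> hxy hy sW hx v [u h _].
have [|w hw _] := hxy u.
  exists v => //; rewrite -opprB; exact: submodN.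
exists w => //; apply: hy; rewrite scalerBr.
have e : y *: v - y *: (x *: w) = (y *: v - x *: u) + x *: (u - y *: w).
  by rewrite scalerBr addrA subrK !scalerA [y * x]mulrC.
by rewrite e; apply: submodD => //; apply: submodZ.
Qed.

End RegularSequences.

(** * The exchange property of regular sequences *)

Section Exchange.
Variables (A : comNzRingType) (m : A -> Prop).
Hypotheses (nA : noeth A^o) (pm : is_prime m) (um : forall a, ~ m a -> unit_elt a).
Implicit Types (V : lmodType A) (xs ys : seq A).

Let im : ideal m := prime_ideal_of pm.

Lemma nakayama V (U W : V -> Prop) : noeth V -> submod U -> submod W ->
  (forall v, U v -> exists2 w, W w & exists s, (forall g, g \in s -> U g)
     /\ span_in m s (v - w)) ->
  forall v, U v -> W v.
Proof.
move=> nV sU sW h v Uv; have [s hs] := nV U sU.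
have [|t nt ht] := @nakayama_prime A V W m s pm sW.
  move=> g /mem_span/hs/h[w Ww [s' [hs' hg]]].
  exists 1; first exact: prime1; exists w => //; rewrite scale1r.
  apply: (span_in_sub (span_in_submod _ im)) hg => u a us' ma.
  by apply: span_in_scale => //; apply/hs/hs'.
have [b hb] := um nt; apply: (span_sub sW _ ((hs v).1 Uv)) => g gs.
by rewrite -[g]scale1r -hb -scalerA; apply: submodZ => //; apply: ht.
Qed.

Lemma nakayama1 V (U W : V -> Prop) x : noeth V -> submod U -> submod W -> m x ->
  (forall v, U v -> exists2 u, U u & W (v - x *: u)) -> forall v, U v -> W v.
Proof.
move=> nV sU sW mx h; apply: nakayama => // v /h[u Uu Wu].
exists (v - x *: u) => //; exists [:: u]; split=> [g|]; first by rewrite inE => /eqP->.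
by rewrite opprB addrC subrK; apply: mem_span_in; rewrite ?mem_head.
Qed.

(** If zv = 0 in V/W, then v = xu there, and zu = 0 because x is regular. So the kernel K of z on
    V/W satisfies K = xK and vanishes by Nakayama. *)
Lemma nzd_swap V (W : V -> Prop) x z : noeth V -> submod W -> m x ->
  nzd W x -> nzd (addx W x) z -> nzd W z.
Proof.
move=> nV sW mx hx hz v Wv.
apply: (nakayama1 (x := x) nV (U := fun v => W (z *: v))) Wv => //.
  split=> [|a u w hu hw]; first by rewrite scaler0; exact: submod0.
  by rewrite scalerDr scalerA mulrC -scalerA; apply: sW.2.
move=> {}v Wv; have [|u hu _] := hz v; first exact: addxW.
exists u => //; apply: hx; rewrite scalerA mulrC -scalerA.
rewrite -[x *: u](subKr v) scalerBr; apply: submodB => //.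
exact: submodZ.
Qed.

Lemma nzd_nosocle V (W : V -> Prop) x : m x -> nzd W x -> nosocle W m.
Proof. by move=> mx hx v h; apply/hx/h. Qed.

(** Both socles are Ext^1(k, V/W) for the residue field k. Concretely, if m kills v modulo y, the
    relation xv = yu sends v to a class u that m kills modulo x. *)
Lemma nosocle_exchange V (W : V -> Prop) x y : submod W -> m x -> m y ->
  nzd W x -> nzd W y -> nosocle (addx W x) m -> nosocle (addx W y) m.
Proof.
move=> sW mx my hx hy hs v hv.
have [u hu _] := hv x mx.
have : addx W x u.
  apply: hs => a ma; have [w hw _] := hv a ma.
  exists w => //; apply: hy.
  have -> : y *: (a *: u - x *: w) = x *: (a *: v - y *: w) - a *: (x *: v - y *: u).
    rewrite !scalerBr opprB !scalerA [x * a]mulrC [a * y]mulrC [x * y]mulrC.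
    by rewrite [RHS]addrC addrA subrK.
  by apply: submodB => //; apply: submodZ.
case=> w hw _; exists w => //; apply: hx.
have -> : x *: (v - y *: w) = (x *: v - y *: u) + y *: (u - x *: w).
  by rewrite !scalerBr addrA subrK !scalerA [x * y]mulrC.
by apply: submodD => //; apply: submodZ.
Qed.

Lemma noeth_prod V V' : noeth V -> noeth V' -> noeth (V * V')%type.
Proof.
move=> nV nV' U sU.
have [|s hs] := nV (fun v => exists v', U (v, v')).
  split=> [|a u v [u' Uu] [v' Uv]]; first by exists 0; case: sU.
  by exists (a *: u' + v'); apply: (sU.2 a _ _ Uu Uv).
have [|s' hs'] := nV' (fun v' => U (0, v')).
  split=> [|a u v Uu Uv]; first by case: sU.
  have := sU.2 a _ _ Uu Uv.
  by rewrite (_ : a *: _ + _ = (0, a *: u + v)) //; congr pair; rewrite /= scaler0 addr0.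
have [L [hL hsL]] : exists L, (forall x, x \in L -> U x) /\
    forall g, g \in s -> exists g', span L (g, g').
  have : forall g, g \in s -> exists g', U (g, g') by move=> g /mem_span/hs.
  elim: s {hs} => [|g s IH] hU; first by exists [::].
  have [|L [h1 h2]] := IH; first by move=> h hh; apply: hU; rewrite inE hh orbT.
  have [g' Ug] := hU g (mem_head _ _).
  exists ((g, g') :: L); split=> h; rewrite inE => /orP[/eqP->|]; [by []|exact: h1| |].
    by exists g'; apply: mem_span; rewrite mem_head.
  move=> /h2[h' hh']; exists h'; apply: (span_sub (span_submod _)) hh' => x xL.
  by apply: mem_span; rewrite inE xL orbT.
exists (L ++ [seq (0, g) | g <- s']) => x; split; last first.
  apply: span_sub => // y; rewrite mem_cat => /orP[/hL //|/mapP[g gs ->]].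
  by apply/hs'; exact: mem_span.
case: x => v v' Uv.
have [w' hw] : exists w', span L (v, w').
  have : span s v by apply/hs; exists v'.
  apply: (span_sub (W := fun v => exists w', span L (v, w'))) => //.
  split=> [|a x y [x' hx] [y' hy]]; first by exists 0; case: (span_submod L).
  by exists (a *: x' + y'); apply: ((span_submod L).2 a _ _ hx hy).
have hU : U (0, v' - w').
  have := submodB sU Uv (span_sub sU hL hw).
  by rewrite (_ : _ - _ = (0, v' - w')) //; congr pair; rewrite /= subrr.
rewrite (_ : (v, v') = (v, w') + (0, v' - w')); last first.
  by congr pair; rewrite ?addr0 //= addrC subrK.
apply: submodD (span_submod _) _ _.
  by apply: (span_sub (span_submod _)) hw => y yL; apply: mem_span; rewrite mem_cat yL.
apply: (span_sub (W := fun w => span _ (0, w))) ((hs' _).1 hU).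
  split=> [|a x y hx hy]; first by case: (span_submod (L ++ [seq (0, g) | g <- s'])).
  have := (span_submod (L ++ [seq (0, g) | g <- s'])).2 a _ _ hx hy.
  by rewrite (_ : a *: _ + _ = (0, a *: x + y)) //; congr pair; rewrite /= scaler0 addr0.
by move=> g gs; apply: mem_span; rewrite mem_cat map_f ?orbT.
Qed.

(** Being regular on both quotients means being regular on their product, so avoidance on the
    product module makes the simultaneous choice. *)
Lemma common_nzd V V' (W : V -> Prop) (W' : V' -> Prop) (I : A -> Prop) a :
  noeth V -> noeth V' -> submod W -> submod W' -> nosocle W m -> nosocle W' m ->
  ideal I -> (forall b c, m b -> m c -> I (b * c)) ->
  exists2 t, I t & nzd W (a + t) /\ nzd W' (a + t).
Proof.
move=> nV nV' sW sW' hW hW' iI hI.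
have [||t It ht] := @avoid_coset A (V * V')%type (fun v => W v.1 /\ W' v.2)
  nA (noeth_prod nV nV') _ m I a iI hI _.
- split=> /=; first by split; exact: submod0.
  by move=> b u v [? ?] [? ?]; split; [apply: sW.2|apply: sW'.2].
- by move=> v h; split; [apply: hW => b /h[]|apply: hW' => b /h[]].
exists t => //; split=> v hv.
  have [] := ht (v, 0) => //; split=> //=.
  by rewrite scaler0; exact: submod0.
have [] := ht (0, v) => //; split=> //=.
by rewrite scaler0; exact: submod0.
Qed.

(* The Northcott--Rees theorem that the length of a maximal regular sequence does
   not depend on its first element. *)
Lemma exchange V (W : V -> Prop) t xs y : noeth V -> submod W ->
  size xs = t.+1 -> (forall x, x \in xs -> m x) -> regseq W xs -> m y -> nzd W y ->
  exists ys, [/\ size ys = t, forall x, x \in ys -> m x & regseq (addx W y) ys].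
Proof.
move=> nV; elim: t W xs y => [|t IH] W [//|x xs] y sW.
  by move=> _ _ _ _ _; exists [::].
move=> [sxs] mxs /= [hx hxs] my hy.
have mx : m x by apply: mxs; rewrite mem_head.
have mxs' z : z \in xs -> m z by move=> h; apply: mxs; rewrite inE h orbT.
have sx := addx_submod x sW; have sy := addx_submod y sW.
have nsx : nosocle (addx W x) m.
  case: xs sxs hxs mxs' {mxs} => // x' xs _ [hx' _] mxs.
  by apply: nzd_nosocle hx'; apply: mxs; rewrite mem_head.
have nsy := nosocle_exchange sW mx my hx hy nsx.
(* The pivot [z] is regular modulo [x] and modulo [y]. Induction modulo [x] gives a regular sequence
   [x, z, ys]; after swapping [x] and [z], induction modulo [z] exchanges [x] for [y], and a last
   swap puts [y] in front. *)
have [|z mz []] := common_nzd 0 nV nV sx sy nsx nsy im _.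
  by move=> b c mb mc; apply: idealMl.
rewrite add0r => hzx hzy.
have [ys [sys mys hys]] := IH _ _ z sx sxs mxs' hxs mz hzx.
have hz : nzd W z := nzd_swap nV sW mx hx hzx.
have hxz : nzd (addx W z) x := nzd_addx hzx hx sW hz.
have hyz : nzd (addx W z) y := nzd_addx hzy hy sW hz.
have sz := addx_submod z sW.
have [|||ys' [sys' mys' hys']] := IH _ (x :: ys) y sz _ _ _ my hyz.
- by rewrite /= sys.
- by move=> u; rewrite inE => /orP[/eqP->|/mys].
- by split=> //; rewrite addxC.
exists (z :: ys'); split; first by rewrite /= sys'.
  by move=> u; rewrite inE => /orP[/eqP->|/mys'].
by split=> //; rewrite addxC.
Qed.

End Exchange.

(** * Krull's principal ideal theorem and regular local rings *)

Section Krull.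
Variable A : comNzRingType.
Hypothesis nA : noeth A^o.
Implicit Types P Q I : A -> Prop.

Lemma prime_disjoint I (T : A -> Prop) : ideal I -> T 1 ->
  (forall a b, T a -> T b -> T (a * b)) -> (forall a, T a -> ~ I a) ->
  exists Q, [/\ is_prime Q, forall a, I a -> Q a & forall a, T a -> ~ Q a].
Proof.
move=> iI T1 TM dI.
have [||Q [iQ IQ dQ] hQ] := noeth_max (V := A^o)
  (C := fun Q => [/\ ideal Q, forall a, I a -> Q a & forall a, T a -> ~ Q a]) nA.
- by move=> W [].
- by exists I.
exists Q; split=> //; split=> //; first exact: dQ.
move=> a b Qab; apply: contrapT => /not_orP[na nb].
have meet c : ~ Q c -> exists2 t, T t & exists2 q, Q q & exists u, t = q + u * c.
  move=> nc; apply: contrapT => hn; apply: nc.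
  apply: (hQ (addx (Q : A^o -> Prop) c)).
  - split=> [|d Id|t Tt [u hu _]]; first exact: addx_submod.
      by apply: addxW => //; apply: IQ.
    by apply: hn; exists t => //; exists (t - c * u) => //; exists u; rewrite mulrC subrK.
  - by move=> d Qd; apply: addxW.
  by exists 1 => //; rewrite /GRing.scale /= mulr1 subrr; apply: ideal0.
have [t Tt [q Qq [u et]]] := meet a na; have [t' Tt' [q' Qq' [u' et']]] := meet b nb.
apply: (dQ (t * t')); first exact: TM.
rewrite et mulrDl; apply: idealD => //; first exact: idealMr.
rewrite et' mulrDr; apply: idealD => //; first exact: idealMl.
by rewrite mulrACA; apply: idealMl.
Qed.

(** Saturated ideals are the contractions of the ideals of the localisation at [P], and replace them
    throughout. *)
Definition saturated P I : Prop := forall s a, ~ P s -> I (s * a) -> I a.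

Definition minimal_over I P : Prop := forall Q, is_prime Q ->
  (forall a, I a -> Q a) -> (forall a, Q a -> P a) -> forall a, P a -> Q a.

Definition dcc_over P (W : A -> Prop) : Prop := forall C : nat -> A -> Prop,
  (forall n, [/\ ideal (C n), saturated P (C n) & forall a, W a -> C n a]) ->
  (forall n a, C n.+1 a -> C n a) ->
  exists N, forall n, (N <= n)%N -> forall a, C n a -> C n.+1 a.

(* The ring A_P / I is Artinian when P is a minimal prime over I: by Noetherian
   induction on W, since every proper saturated W has an element w killed by P
   modulo W, so that W + (w) is the next step of a composition series. *)
Lemma minimal_over_dcc I P W : is_prime P -> minimal_over I P ->
  ideal W -> saturated P W -> (forall a, I a -> W a) -> dcc_over P W.
Proof.
move=> pP minP iW satW IW; apply: contrapT => ndcc.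
have [||{iW satW IW ndcc}U [iU satU IU ndcc] hU] := noeth_max (V := A^o)
  (C := fun W => [/\ ideal W, saturated P W, forall a, I a -> W a & ~ dcc_over P W]) nA.
- by move=> U [].
- by exists W.
have [U1|nU1] := EM (U 1).
  apply: ndcc => C hC _; exists 0%N => n _ a _.
  by rewrite -[a]mulr1; case: (hC n.+1) => iC _ UC; apply: idealMl => //; apply: UC.
(* The scalar 0 kills everything, so this merely provides some maximal annihilator modulo [U]; by
   minimality of [P] that annihilator is [P]. *)
have [w mw _] : exists2 w : A^o, maxann (U : A^o -> Prop) w & U (0 *: w).
  apply: (zero_divisor_maxann (V := A^o) nA iU (v := 1)) => //.
  by rewrite scale0r; apply: ideal0.
have Pw a : P a -> U (a * w).
  move=> Pa; have := minP _ (maxann_prime iU mw); apply=> //.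
    by move=> b Ib; apply: (idealMr w iU); apply: IU.
  move=> b Ub; apply: contrapT => nPb; apply: mw.1.
  exact: satU Ub.
(* The saturation of U + (w). Localised at [P], U'/U is one-dimensional over the residue field. *)
pose U' a := exists2 s, ~ P s & exists u, U (s * a - u * w).
have iU' : ideal U'.
  split=> [|a b c [s ns [u hu]] [t nt [v hv]]].
    exists 1; first exact: prime1.
    by exists 0; rewrite mulr0 mul0r subrr; apply: ideal0.
  exists (s * t); first exact: primeM.
  exists (a * t * u + s * v).
  have -> : s * t * (a *: b + c) - (a * t * u + s * v) * w =
      (a * t) * (s * b - u * w) + s * (t * c - v * w) by rewrite /GRing.scale /=; ring.
  by apply: idealD => //; apply: idealMl.
have satU' : saturated P U'.
  move=> s a ns [t nt [u hu]]; exists (t * s); first exact: primeM.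
  by exists u; rewrite -mulrA.
have UU' a : U a -> U' a.
  move=> Ua; exists 1; first exact: prime1.
  by exists 0; rewrite mul0r subr0 mul1r.
have U'w : U' w.
  exists 1; first exact: prime1.
  by exists 1; rewrite subrr; apply: ideal0.
have dccU' : dcc_over P U'.
  apply: contrapT => h; apply: mw.1; apply: (hU U') => //.
  by split=> // a Ia; apply/UU'/IU.
apply: ndcc => C hC decC.
have decC' i j : (i <= j)%N -> forall a, C j a -> C i a.
  move=> /subnK <-; elim: (j - i)%N => // k IH a; rewrite addSn => /decC; exact: IH.
(* If [w] lies in the whole chain, the chain contains [U']. Otherwise it meets [U'] only in [U] from
   some index on, and by the modular law it is stationary once the saturations [D n] of C n + U'
   are. *)
have [hw|/existsNP[n0 nw]] := EM (forall n, C n w).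
  apply: dccU' => // n; have [iC satC UC] := hC n; split=> // a [s ns [u hu]].
  apply: (satC s) => //; rewrite -[s * a](subrK (u * w)); apply: idealD => //.
    exact: UC.
  by apply: idealMl.
have key n a : (n0 <= n)%N -> C n a -> U' a -> U a.
  move=> le Ca [s ns [u hu]]; have [iC satC UC] := hC n.
  have [Pu|nPu] := EM (P u).
    apply: (satU s) => //; rewrite -[s * a](subrK (u * w)); apply: idealD => //.
    exact: Pw.
  case: nw; apply: (decC' _ _ le); apply: (satC u) => //.
  have -> : u * w = s * a - (s * a - u * w) by rewrite subKr.
  by apply: idealB => //; [apply: idealMl | apply: UC].
pose D n a := exists2 s, ~ P s & exists2 c, C n c & U' (s * a - c).
have [||N hN] := dccU' D.
- move=> n; have [iC satC UC] := hC n; split.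
  + split=> [|a b c [s ns [u hu hb]] [t nt [v hv hc]]].
      exists 1; first exact: prime1.
      by exists 0; [|rewrite mulr0 subrr]; apply: ideal0.
    exists (s * t); first exact: primeM.
    exists (a * t * u + s * v).
      by apply: idealD => //; apply: idealMl.
    have -> : s * t * (a *: b + c) - (a * t * u + s * v) =
        (a * t) * (s * b - u) + s * (t * c - v) by rewrite /GRing.scale /=; ring.
    by apply: idealD => //; apply: idealMl.
  + move=> s a ns [t nt [u hu h]]; exists (t * s); first exact: primeM.
    by exists u; rewrite -?mulrA.
  move=> a U'a; exists 1; first exact: prime1.
  by exists 0; [exact: ideal0 | rewrite mul1r subr0].
- by move=> n a [s ns [c Cc h]]; exists s => //; exists c => //; apply: decC.
exists (maxn N n0) => n; rewrite geq_max => /andP[leN le0] a Ca.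
have [iC satC UC] := hC n.+1.
have [|s ns [c Cc hc]] := hN n leN a.
  exists 1; first exact: prime1.
  by exists a; rewrite // mul1r subrr; apply: ideal0.
apply: (satC s) => //; rewrite -[s * a](subrK c); apply: idealD => //.
apply/UC/(key n) => //; have [iCn _ _] := hC n.
by apply: idealB => //; [apply: idealMl | apply: decC].
Qed.

(* P2 is not minimal over P0 + (x) as soon as a prime P1 lies strictly between P0
   and P2: otherwise the ideals (b^n) + P0, localised at P1, become stationary. *)
Lemma principal_ideal_theorem P0 P1 P2 x : is_prime P0 -> is_prime P1 -> is_prime P2 ->
  (forall a, P0 a -> P1 a) -> ~ (forall a, P1 a -> P0 a) ->
  (forall a, P1 a -> P2 a) -> P2 x -> ~ P1 x ->
  ~ minimal_over (addx (P0 : A^o -> Prop) x) P2.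
Proof.
move=> pP0 pP1 pP2 s01 /existsNP[b /not_implyP[P1b nP0b]] s12 P2x nP1x minP2.
have iP0 := prime_ideal_of pP0; have iP1 := prime_ideal_of pP1.
pose I n a := exists2 s, ~ P1 s & exists t, P0 (s * a - t * b ^+ n).
have iI n : ideal (I n).
  split=> [|a c d [s ns [u hu]] [t nt [v hv]]].
    exists 1; first exact: prime1.
    by exists 0; rewrite mulr0 mul0r subrr; apply: ideal0.
  exists (s * t); first exact: primeM.
  exists (a * t * u + s * v).
  have -> : s * t * (a *: c + d) - (a * t * u + s * v) * b ^+ n =
      (a * t) * (s * c - u * b ^+ n) + s * (t * d - v * b ^+ n).
    by rewrite /GRing.scale /=; ring.
  by apply: idealD => //; apply: idealMl.
have satI n : saturated P1 (I n).
  move=> s a ns [t nt [u hu]]; exists (t * s); first exact: primeM.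
  by exists u; rewrite -mulrA.
have decI n a : I n.+1 a -> I n a.
  by move=> [s ns [t ht]]; exists s => //; exists (t * b); rewrite -mulrA -exprS.
(* The chain condition at [P2] only concerns ideals containing P0 + (x), so [x] is added to [I n]
   before saturating at [P2]. *)
pose C n a := exists2 s, ~ P2 s & exists2 c, I n c & exists t, s * a = c + t * x.
pose W a := exists2 s, ~ P2 s & exists2 c, P0 c & exists t, s * a = c + t * x.
have iCW (J : A -> Prop) : ideal J ->
    ideal (fun a => exists2 s, ~ P2 s & exists2 c, J c & exists t, s * a = c + t * x).
  move=> iJ; split=> [|a c d [s ns [u hu [e he]]] [t nt [v hv [e' he']]]].
    exists 1; first exact: prime1.
    by exists 0; [exact: ideal0|exists 0; rewrite mulr0 mul0r addr0].
  exists (s * t); first exact: primeM.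
  exists (a * t * u + s * v); first by apply: idealD => //; apply: idealMl.
  exists (a * t * e + s * e').
  have -> : s * t * (a *: c + d) = a * t * (s * c) + s * (t * d).
    by rewrite /GRing.scale /=; ring.
  by rewrite he he'; ring.
have satCW (J : A -> Prop) : saturated P2
    (fun a => exists2 s, ~ P2 s & exists2 c, J c & exists t, s * a = c + t * x).
  move=> s a ns [t nt h]; exists (t * s); first exact: primeM.
  by rewrite -mulrA.
have [|||N /(_ N (leqnn N)) hN] := minimal_over_dcc pP2 minP2 (iCW P0 iP0) (satCW P0) _ (C := C).
- move=> a [u hu _]; exists 1; first exact: prime1.
  by exists (a - x * u) => //; exists u; rewrite mul1r [u * x]mulrC subrK.
- move=> n; split; [exact/iCW/iI|exact: satCW|].
  move=> a [s ns [c P0c h]]; exists s => //; exists c => //.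
  exists 1; first exact: prime1.
  by exists 0; rewrite mul0r subr0 mul1r.
- by move=> n a [s ns [c Ic h]]; exists s => //; exists c => //; apply: decI.
have [gs hgs] := nA (iI N).
(* Stationarity writes a multiple of g in [I N] as c + tx with c in [I N.+1]. As [I N] is saturated
   at [P1] and [x] is outside [P1], the coefficient t lies in [I N]; thus I_N = I_(N+1) + x I_N at
   [P2]. *)
have [|t nt ht] := @nakayama_prime A A^o (I N.+1) P2 gs pP2 (iI N.+1).
  move=> g /mem_span gsg; have Ig := (hgs g).2 gsg.
  have [|s ns [c Ic [t e]]] := hN g.
    exists 1; first exact: prime1.
    by exists g => //; exists 0; rewrite mul1r mul0r addr0.
  exists s => //; exists c => //.
  have -> : s *: g - c = x *: (t : A^o).
    by rewrite /GRing.scale /= e addrC addKr mulrC.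
  apply: span_in_scale (prime_ideal_of pP2) P2x _; apply/hgs.
  apply: (satI N x) => //; have -> : x * t = s * g - c by rewrite e addrC addKr mulrC.
  by apply: idealB => //; [apply: idealMl|apply: decI].
have : I N.+1 (t * b ^+ N).
  have : I N (b ^+ N).
    exists 1; first exact: prime1.
    by exists 1; rewrite subrr; apply: ideal0.
  move=> /hgs; apply: (span_sub (V := A^o) (W := fun a => I N.+1 (t * a))) => //.
  split=> [|a u v hu hv]; first by rewrite mulr0; apply: ideal0.
  have -> : t * (a *: u + v) = a * (t * u) + t * v by rewrite /GRing.scale /=; ring.
  by apply: idealD => //; apply: idealMl.
case=> s ns [u hu].
(* Since no power of [b] lies in [P0], the second factor does; then [s * t] lies in [P1], although
   neither [s] nor [t] does. *)
have hM : P0 (b ^+ N * (s * t - u * b)).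
  by have -> : b ^+ N * (s * t - u * b) = s * (t * b ^+ N) - u * b ^+ N.+1
    by rewrite exprS; ring.
have [_ _ /(_ _ _ hM)[|h]] := pP0; first by apply: primeX.
have : P1 (s * t).
  by rewrite -[s * t](subrK (u * b)); apply: idealD; [|apply: s01|apply: idealMl].
by have [_ _ hP1] := pP1; case/hP1 => // /s12.
Qed.

(** If [P1] misses [x], the principal ideal theorem provides a prime over P0 + (x) strictly below
    [P2], which takes the place of [P1] in the chain. *)
Lemma prime_between P0 P1 P2 x : is_prime P0 -> is_prime P1 -> is_prime P2 ->
  (forall a, P0 a -> P1 a) -> ~ (forall a, P1 a -> P0 a) ->
  (forall a, P1 a -> P2 a) -> ~ (forall a, P2 a -> P1 a) -> P2 x ->
  exists Q, [/\ is_prime Q, forall a, P0 a -> Q a, ~ (forall a, Q a -> P0 a),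
    forall a, Q a -> P2 a & ~ (forall a, P2 a -> Q a) /\ Q x].
Proof.
move=> pP0 pP1 pP2 s01 n10 s12 n21 P2x.
have [P1x|nP1x] := EM (P1 x); first by exists P1.
apply: contrapT => hn.
apply: (principal_ideal_theorem pP0 pP1 pP2 s01 n10 s12 P2x nP1x) => Q pQ hQ sQ.
have iP0 := prime_ideal_of pP0.
have Qx : Q x by apply: hQ; exists 1 => //; rewrite /GRing.scale /= mulr1 subrr; apply: ideal0.
apply: contrapT => nQ; apply: hn; exists Q; split=> // [a P0a|h].
  exact/hQ/addxW.
exact/nP1x/s01/h.
Qed.

Fixpoint pchain (l : nat) P : Prop :=
  if l is l'.+1 then exists Q, [/\ is_prime Q, forall a, P a -> Q a,
    ~ (forall a, Q a -> P a) & pchain l' Q] else True.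

Variable m : A -> Prop.
Hypotheses (pm : is_prime m) (um : forall a, ~ m a -> unit_elt a).

Lemma prime_sub_max P a : is_prime P -> P a -> m a.
Proof.
move=> pP Pa; apply: contrapT => /um[b e]; apply: (prime1 pP).
by rewrite -e; apply: idealMl => //; apply: prime_ideal_of.
Qed.

(** The element [g] lies in the top prime, which may be taken to be [m], and is pushed down the
    chain one prime at a time until it lies in every prime but the bottom one. *)
Lemma pchain_through l P g : is_prime P -> pchain l.+1 P -> m g ->
  exists Q, [/\ is_prime Q, forall a, P a -> Q a, ~ (forall a, Q a -> P a), Q g & pchain l Q].
Proof.
move=> pP ch mg; elim: l P pP ch => [|l IH] P pP.
  move=> [Q [pQ sPQ nPQ _]]; exists m; split=> //.
    by move=> a Pa; apply: prime_sub_max pP Pa.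
  by move=> h; apply: nPQ => a Qa; apply/h/(prime_sub_max pQ).
case=> P1 [pP1 s01 n10 /(IH P1 pP1)[Q [pQ sQ nQ Qg chQ]]].
have [Q' [pQ' h1 h2 h3 [h4 h5]]] := prime_between pP pP1 pQ s01 n10 sQ nQ Qg.
by exists Q'; split=> //; exists Q.
Qed.

(** Each generator is pushed to the bottom of the chain and divided out at the cost of one prime;
    once [W] contains [m], no proper inclusion is left. *)
Lemma height_le (gs : seq A) (W : A^o -> Prop) P : submod W ->
  (forall g, g \in gs -> m g) -> (forall a, m a -> addxs W gs a) -> is_prime P -> (forall a, W a -> P a) ->
  ~ pchain (size gs).+1 P.
Proof.
elim: gs W P => [|g gs IH] W P sW mgs hm pP WP ch.
  case: ch => Q [pQ _ nQP _]; apply: nQP => a Qa.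
  exact/WP/hm/(prime_sub_max pQ).
have mg : m g by apply: mgs; rewrite mem_head.
have [Q [pQ sQ _ Qg chQ]] := pchain_through pP ch mg.
apply: (IH (addx W g) Q) => //; first exact: addx_submod.
  by move=> h hh; apply: mgs; rewrite inE hh orbT.
move=> a [u hu _]; rewrite -[a](subrK (g * u)).
by apply: idealD; [exact: prime_ideal_of|exact/sQ/WP|apply: idealMr => //; exact: prime_ideal_of].
Qed.

(** Primality descends from [m]: W + (g) is prime by induction and equals the next prime [Q] of the
    chain by the height bound, [g] is outside [P] for the same reason, and then the inclusion of P
    in W + gP forces P = W by Nakayama. *)
Lemma regular_system (gs : seq A) (W : A^o -> Prop) P : submod W ->
  (forall g, g \in gs -> m g) -> (forall a, m a <-> addxs W gs a) ->
  is_prime P -> (forall a, W a -> P a) ->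
  pchain (size gs) P -> is_prime W /\ regseq W gs.
Proof.
elim: gs W P => [|g gs IH] W P sW mgs hm pP WP /= ch.
  by rewrite (_ : (W : A -> Prop) = m) //; apply: predext => a; rewrite hm.
have mg : m g by apply: mgs; rewrite mem_head.
have sW' := addx_submod g sW.
have [Q [pQ sPQ nQP Qg chQ]] := pchain_through pP ch mg.
have W'sub (P' : A -> Prop) : is_prime P' -> (forall a, W a -> P' a) -> P' g ->
    forall a, addx W g a -> P' a.
  move=> pP' hWP' P'g a [u hu _]; rewrite -[a](subrK (g * u)).
  have iP' := prime_ideal_of pP'.
  by apply: idealD => //; [exact: hWP'|exact: idealMr].
have W'Q := W'sub Q pQ (fun a Wa => sPQ _ (WP a Wa)) Qg.
have mgs' h : h \in gs -> m h by move=> hh; apply: mgs; rewrite inE hh orbT.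
have [pW' rW'] := IH (addx W g) Q sW' mgs' hm pQ W'Q chQ.
have hm' a : m a -> addxs (addx W g) gs a by move=> /hm.
have nPg : ~ P g.
  move=> Pg; exact: (height_le sW' mgs' hm' pP (W'sub P pP WP Pg)) ch.
have QW' a : Q a -> addx W g a.
  move: a; apply: contrapT => h.
  by apply: (height_le sW' mgs' hm' pW') => //; exists Q.
have PW a : P a -> W a.
  move: a; apply: (nakayama1 pm um (V := A^o) (x := g) nA) => //.
    exact: prime_ideal_of.
  move=> a Pa; have [u hu _] := QW' a (sPQ a Pa).
  exists u => //; have [_ _ /(_ g u)] := pP; case=> //.
  rewrite -[g * u](subKr a); apply: idealB => //; first exact: prime_ideal_of.
  exact: WP.
have eWP : (W : A -> Prop) = P by apply: predext => a; split=> [/WP|/PW].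
split; first by rewrite eWP.
split=> // a Wga; have [_ _ /(_ g a)] := pP; case; [exact: WP|by []|exact: PW].
Qed.

End Krull.

(** * Short exact sequences and freeness *)

Section LinearFunctions.
Variables (A : pzRingType) (U V : lmodType A) (g : U -> V).

Definition lin : Prop := forall a u v, g (a *: u + v) = a *: g u + g v.

Hypothesis lg : lin.

Lemma linD u v : g (u + v) = g u + g v.
Proof. by have := lg 1 u v; rewrite !scale1r. Qed.
Lemma lin0 : g 0 = 0.
Proof. by apply: (addrI (g 0)); rewrite -linD !addr0. Qed.
Lemma linZ a u : g (a *: u) = a *: g u.
Proof. by rewrite -[a *: u]addr0 lg lin0 addr0. Qed.
Lemma linN u : g (- u) = - g u.
Proof. by rewrite -scaleN1r linZ scaleN1r. Qed.
Lemma linB u v : g (u - v) = g u - g v.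
Proof. by rewrite linD linN. Qed.
Lemma lin_sum (I : Type) (r : seq I) (P : pred I) (F : I -> U) :
  g (\sum_(i <- r | P i) F i) = \sum_(i <- r | P i) g (F i).
Proof. by apply: big_morph => [u v|]; [exact: linD | exact: lin0]. Qed.

Definition lin_pack : {linear U -> V} :=
  HB.pack g (GRing.isLinear.Build A U V *:%R g lg).

End LinearFunctions.

Lemma lin_bundled (A : pzRingType) (U V : lmodType A) (g : {linear U -> V}) : lin g.
Proof. by move=> a u v; rewrite linearP. Qed.

Lemma noeth_inj (A : comNzRingType) (K F : lmodType A) (j : K -> F) :
  lin j -> injective j -> noeth F -> noeth K.
Proof.
move=> lj ij nF W sW.
have [|s hs] := nF (fun v => exists2 k, W k & v = j k).
  split=> [|a u v [k Wk ->] [k' Wk' ->]].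
    by exists 0; rewrite ?(lin0 lj) //; apply: submod0.
  by exists (a *: k + k'); rewrite ?lj //; apply: sW.2.
have [t [ht hst]] : exists t, (forall k, k \in t -> W k) /\ s = [seq j k | k <- t].
  have : forall g, g \in s -> exists2 k, W k & g = j k by move=> g /mem_span/hs.
  elim: s {hs} => [|g s IH] h; first by exists [::].
  have [|t [h1 h2]] := IH; first by move=> g' gs; apply: h; rewrite inE gs orbT.
  have [k Wk e] := h g (mem_head _ _).
  exists (k :: t); rewrite /= e h2; split=> // k'.
  by rewrite inE => /orP[/eqP->|/h1].
exists t => k; split; last exact: span_sub.
move=> Wk; have : span s (j k) by apply/hs; exists k.
rewrite hst; move: (k); elim: (t) => [|x t' IH] {Wk}k' /=.
  by rewrite -(lin0 lj) => /ij.
by case=> c _; rewrite -(linZ lj) -(linB lj) => /IH; exists c.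
Qed.

Lemma rV_fin_gen (A : comNzRingType) (l : nat) : fin_gen 'rV[A]_l.
Proof.
by exists l, (delta_mx 0) => x; exists (fun i => x 0 i); rewrite -row_sum_delta.
Qed.

Lemma addxs_lin (A : comNzRingType) (U V : lmodType A) (g : U -> V)
  (WU : U -> Prop) (WV : V -> Prop) xs : lin g -> submod WV ->
  (forall u, WU u -> WV (g u)) -> forall u, addxs WU xs u -> addxs WV xs (g u).
Proof.
move=> lg sV h; apply: addxs_min => [|u /h|x u xx].
- have sV' := addxs_submod xs sV.
  split=> [|a u v hu hv]; first by rewrite (lin0 lg); case: sV'.
  by rewrite lg; apply: sV'.2.
- exact: addxsW.
by rewrite (linZ lg); apply: addxs_mem.
Qed.

Section ShortExact.
Variables (A : comNzRingType) (K F V : lmodType A) (io : K -> F) (ph : F -> V).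
Hypotheses (lio : lin io) (lph : lin ph) (sph : surj ph).
Implicit Types (WK : K -> Prop) (WF : F -> Prop) (WV : V -> Prop).

(* The induced sequence 0 -> K/WK -> F/WF -> V/WV -> 0 is exact. *)
Definition ses WK WF WV : Prop := [/\ submod WK, submod WF, submod WV,
  forall k, WF (io k) <-> WK k & forall v, WV (ph v) <-> exists k, WF (v - io k)].

(** By the snake lemma, only x-torsion of V/WV could destroy exactness on the left after reduction
    modulo x. *)
Lemma ses_step WK WF WV x : ses WK WF WV -> nzd WV x ->
  ses (addx WK x) (addx WF x) (addx WV x).
Proof.
move=> [sK sF sV e1 e2] hx; split; try exact: addx_submod.
- move=> k; split=> [[v hv _]|[u hu _]]; last first.
    by exists (io u) => //; rewrite -(linZ lio) -(linB lio); apply/e1.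
  have [|k' hk'] := (e2 v).1.
    apply: hx; rewrite -(linZ lph); apply/e2; exists k.
    by rewrite -opprB; apply: submodN.
  exists k' => //; apply/e1; rewrite (linB lio) (linZ lio).
  have -> : io k - x *: io k' = (io k - x *: v) + x *: (v - io k').
    by rewrite scalerBr addrA subrK.
  by apply: submodD => //; apply: submodZ.
move=> v; split=> [[u hu _]|[k [u hu _]]].
  have [u' eu] := sph u; subst u.
  have [|k hk] := (e2 (v - x *: u')).1; first by rewrite (linB lph) (linZ lph).
  by exists k, u' => //; rewrite addrAC.
exists (ph u) => //; rewrite -(linZ lph) -(linB lph); apply/e2; exists k.
by rewrite addrAC.
Qed.

Lemma ses_nzd WK WF WV x : ses WK WF WV -> nzd WF x -> nzd WK x.
Proof. by move=> [_ _ _ e1 _] hx k hk; apply/e1/hx; rewrite -(linZ lio); apply/e1. Qed.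

Lemma ses_addxs WK WF WV xs : ses WK WF WV -> regseq WV xs ->
  ses (addxs WK xs) (addxs WF xs) (addxs WV xs).
Proof.
elim: xs WK WF WV => //= x xs IH WK WF WV h [hx hxs].
by apply: IH => //; apply: ses_step.
Qed.

(** The depth lemma: modulo [xs] the module K still embeds in F, so the one further element regular
    on F is regular on K as well. *)
Lemma ses_regseq WK WF WV xs y : ses WK WF WV -> regseq WV xs ->
  regseq WF (rcons xs y) -> regseq WK (rcons xs y).
Proof.
elim: xs WK WF WV => [|x xs IH] WK WF WV h /=.
  by move=> _ [hy _]; split=> //; exact: ses_nzd h hy.
move=> [hx hxs] [hx' hxs']; split; first exact: ses_nzd h hx'.
exact: IH (ses_step h hx) hxs hxs'.
Qed.

End ShortExact.

(** K and V are syzygies of each other in F, so an element regular on F is regular on both, and both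
    sequences stay exact modulo it. This gives the depth of the two modules of a matrix
    factorization at once. *)
Lemma periodic_regseq (A : comNzRingType) (K F V : lmodType A) (io : K -> F) (ph : F -> V)
  (io' : V -> F) (ph' : F -> K) (WK : K -> Prop) (WF : F -> Prop) (WV : V -> Prop) xs :
  lin io -> lin ph -> surj ph -> lin io' -> lin ph' -> surj ph' ->
  ses io ph WK WF WV -> ses io' ph' WV WF WK ->
  regseq WF xs -> regseq WK xs.
Proof.
move=> lio lph sph lio' lph' sph'.
elim: xs WK WF WV => //= x xs IH WK WF WV h h' [hx hxs].
have hK := ses_nzd lio h hx; have hV := ses_nzd lio' h' hx.
split=> //; exact: IH (ses_step lio lph sph h hV) (ses_step lio' lph' sph' h' hK) hxs.
Qed.

Definition lincomb (A : comNzRingType) (V : lmodType A) (l : nat) (nu : 'I_l -> V)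
  (c : 'rV[A]_l) : V := \sum_i c 0 i *: nu i.

Lemma lincomb_lin (A : comNzRingType) (V : lmodType A) (l : nat) (nu : 'I_l -> V) :
  lin (lincomb nu).
Proof.
move=> a u v; rewrite /lincomb scaler_sumr -big_split; apply: eq_bigr => i _.
by rewrite !mxE scalerDl scalerA.
Qed.

Definition basis (A : comNzRingType) (V : lmodType A) (l : nat) (nu : 'I_l -> V) : Prop :=
  surj (lincomb nu) /\ injective (lincomb nu).

(** * Modules of full depth over a local ring are free when the maximal ideal is generated by the
    regular sequence *)

Section Freeness.
Variables (A : comNzRingType) (m : A -> Prop).
Hypotheses (nA : noeth A^o) (pm : is_prime m) (um : forall a, ~ m a -> unit_elt a).
Variable V : lmodType A.
Hypothesis fV : fin_gen V.

(** With the least number of generators, a relation with a unit coefficient would eliminate one of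
    them. *)
Lemma minimal_generators : exists (l : nat) (nu : 'I_l -> V), surj (lincomb nu) /\
  forall c, lincomb nu c = 0 -> forall i, m (c 0 i).
Proof.
have [r [g hg]] := fV.
pose G l := `[< exists nu : 'I_l -> V, surj (lincomb nu) >].
have exG : exists l, G l.
  exists r; apply/asboolP; exists g => x; have [c ->] := hg x.
  by exists (\row_i c i); rewrite /lincomb; apply: eq_bigr => i _; rewrite mxE.
case: (ex_minnP exG) => l /asboolP[nu hnu] hmin; exists l, nu; split=> // c hc i.
apply: contrapT => nm; have [b hb] := um nm.
case: l nu hnu hmin c hc i nm b hb => [|l] nu hnu hmin c hc i nm b hb; first by case: i nm hb.
suff /hmin : G l by rewrite ltnn.
apply/asboolP; exists (fun j => nu (lift i j)) => x; have [d <-] := hnu x.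
have ei : nu i = - \sum_j (b * c 0 (lift i j)) *: nu (lift i j).
  apply: (addIr (\sum_j (b * c 0 (lift i j)) *: nu (lift i j))); rewrite addNr.
  rewrite -[RHS](scaler0 _ b) -[in RHS]hc /lincomb (bigD1_ord i) //= scalerDr scalerA.
  rewrite hb scale1r scaler_sumr; congr (_ + _).
  by apply: eq_bigr => j _; rewrite scalerA.
exists (\row_j (d 0 (lift i j) - d 0 i * (b * c 0 (lift i j)))).
rewrite /lincomb [RHS](bigD1_ord i) //= ei scalerN scaler_sumr -sumrN -big_split /=.
by apply: eq_bigr => j _; rewrite mxE scalerBl scalerA addrC.
Qed.

(** A case of the Auslander-Buchsbaum formula: the kernel K of a minimal cover F lies in mF, while
    regularity on V keeps K/mK -> F/mF injective; so K = mK = 0. *)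
Lemma regseq_free hs : (forall a, m a <-> addxs (fun a : A^o => a = 0) hs a) ->
  regseq (fun v : V => v = 0) hs -> exists (l : nat) (nu : 'I_l -> V), basis nu.
Proof.
move=> hm hreg; have [l [nu [snu mnu]]] := minimal_generators.
exists l, nu; split=> //.
have ln := lincomb_lin nu.
pose K := lin_ker (lin_pack ln); pose io (k : K) : 'rV[A]_l := \val k.
have lio : lin io by move=> a u v.
have nF : noeth 'rV[A]_l by apply: noeth_fg => //; exact: rV_fin_gen.
have nK : noeth K by apply: noeth_inj lio _ nF; exact: val_inj.
have s0 (U : lmodType A) : submod (fun u : U => u = 0).
  by split=> // a u v -> ->; rewrite scaler0 addr0.
have hses : ses io (lincomb nu) (fun k => k = 0) (fun v => v = 0) (fun v => v = 0).
  split=> //.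
    by move=> k; split=> [h|->]; [exact: val_inj | rewrite (lin0 lio)].
  move=> v; split=> [hv|[k /eqP]].
    by exists (exist _ v (introT eqP hv)); rewrite subrr.
  by rewrite subr_eq0 => /eqP->; apply/eqP: (valP k).
have [_ _ _ e1 _] := ses_addxs lio ln snu hses hreg.
have hK (k : K) : k = 0.
  have [s hs'] := nK _ (submodT K).
  apply: (nakayama pm um (U := fun=> True) (W := fun k => k = 0)) => // {}k _.
  exists 0 => //; exists s; split=> //; rewrite subr0.
  have hk : addxs (fun k : K => k = 0) hs k.
    apply/e1; rewrite [io k]row_sum_delta.
    apply: (submod_sum _ (addxs_submod hs (s0 _))) => i _.
    have lg : lin (fun a : A^o => a *: delta_mx 0 i : 'rV[A]_l).
      by move=> a u v; rewrite scalerDl scalerA.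
    apply: (addxs_lin lg (s0 _) (WU := fun a => a = 0)) => [u ->|]; first by rewrite scale0r.
    by apply/hm/mnu/eqP; exact: (valP k).
  apply: (addxs_min _ _ _ hk) => [|u ->|x u xh].
  - exact/span_in_submod/prime_ideal_of.
  - exact: submod0 (span_in_submod s (prime_ideal_of pm)).
  apply: span_in_scale; [exact: prime_ideal_of| |exact/hs'].
  have := addxs_mem (1 : A^o) (s0 A^o) xh.
  by rewrite /GRing.scale /= mulr1 => /hm.
move=> c d e; apply/eqP; rewrite -subr_eq0; apply/eqP.
have h : (c - d) \in ker_pred (lin_pack ln).
  by apply/eqP; rewrite /= (linB ln) e subrr.
by have := congr1 val (hK (exist _ (c - d) h)).
Qed.

End Freeness.

(** * Depth over regular local rings and hypersurfaces *)

Lemma submod_zero (A : comNzRingType) (V : lmodType A) : submod (fun v : V => v = 0).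
Proof. by split=> // a u v -> ->; rewrite scaler0 addr0. Qed.

Notation zeroP := (eq^~ 0).

(* Each element of a V/W-regular sequence lengthens a chain of primes, because a
   localisation of V/W at a prime of its support is nonzero and x is injective on it. *)
Lemma regseq_pchain (A : comNzRingType) (V : lmodType A) (W : V -> Prop) xs :
  noeth A^o -> submod W -> regseq W xs -> (exists v, ~ addxs W xs v) ->
  exists P, [/\ is_prime P, forall a : A, (forall v, W (a *: v)) -> P a
    & pchain (size xs) P].
Proof.
move=> nA; elim: xs W => [|x xs IH] W sW /=.
  move=> _ [v nWv].
  have [||||P [pP hP _]] := @prime_disjoint A nA (fun a => forall v, W (a *: v)) (fun a => a = 1).
  - split=> [u|a b c hb hc u]; first by rewrite scale0r; apply: submod0.
    by rewrite scalerDl -scalerA; apply: sW.2.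
  - by [].
  - by move=> a b -> ->; rewrite mulr1.
  - by move=> a -> /(_ v); rewrite scale1r.
  by exists P.
move=> [hx hxs] hv; have [P1 [pP1 hP1 ch]] := IH _ (addx_submod x sW) hxs hv.
have nzX k u : W (x ^+ k *: u) -> W u.
  by elim: k => [|k IHk]; rewrite ?expr0 ?scale1r // exprS -scalerA => /hx.
have [||||P [pP hP dP]] := @prime_disjoint A nA (fun a => forall v, W (a *: v))
  (fun a => exists k, exists2 s, ~ P1 s & a = x ^+ k * s).
- split=> [u|a b c hb hc u]; first by rewrite scale0r; apply: submod0.
  by rewrite scalerDl -scalerA; apply: sW.2.
- by exists 0%N, 1; rewrite ?mulr1 ?expr0 //; exact: prime1.
- move=> a b [k [s ns ->]] [l [t nt ->]]; exists (k + l)%N, (s * t); first exact: primeM.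
  by rewrite exprD mulrACA.
- move=> a [k [s ns ->]] h; apply: ns; apply: hP1 => u; apply: addxW => //.
  by apply: (nzX k); rewrite scalerA.
exists P; split=> //; exists P1; split=> //.
  move=> a Pa; apply: contrapT => nP1a; apply: (dP a) => //.
  by exists 0%N, a; rewrite // expr0 mul1r.
move=> h; apply: (dP x).
  by exists 1%N, 1; rewrite ?mulr1 ?expr1 //; exact: prime1.
by apply/h/hP1 => u; exact: addxx.
Qed.

Lemma regseq_nth (A : comNzRingType) (V : lmodType A) (W : V -> Prop) xs :
  regseq W xs <-> forall i, (i < size xs)%N -> nzd (addxs W (take i xs)) xs`_i.
Proof.
elim: xs W => [|x xs IH] W /=; first by split.
rewrite IH; split=> [[h1 h2] [|i] //=|h]; first exact: h2.
by split=> [|i hi]; [exact: (h 0%N) | exact: (h i.+1)].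
Qed.

Lemma in_seq_mulE (A : comNzRingType) (V : lmodType A) (t : nat) (x : 'I_t -> A) k (z : V) :
  (k <= t)%N -> in_seq_mul x k z <-> addxs zeroP (take k [seq x i | i <- enum 'I_t]) z.
Proof.
move=> kt; set xs := map x _.
have sxs : size xs = t by rewrite size_map size_enum_ord.
split.
  case=> w ->; apply: submod_sum => [|j jk].
    exact/addxs_submod/submod_zero.
  apply: addxs_mem; first exact: submod_zero.
  have e : xs`_j = x j by rewrite (nth_map j) ?size_enum_ord // nth_ord_enum.
  by rewrite -e -(nth_take _ jk) mem_nth // size_take sxs; case: ifP.
move: z; apply: addxs_min.
- split=> [|a u v [w ->] [w' ->]].
    by exists (fun=> 0); rewrite big1 // => j _; rewrite scaler0.
  exists (fun j => a *: w j + w' j); rewrite scaler_sumr -big_split.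
  by apply: eq_bigr => j _; rewrite scalerDr !scalerA mulrC.
- by move=> v ->; exists (fun=> 0); rewrite big1 // => j _; rewrite scaler0.
move=> y v /(nthP 0)[i]; rewrite size_take sxs => hi.
have ik : (i < k)%N by move: hi; case: (ltnP k t) => h // hi; exact: leq_trans hi h.
have it := leq_trans ik kt.
rewrite nth_take // (nth_map (Ordinal it)) ?size_enum_ord // => <-.
have -> : nth (Ordinal it) (enum 'I_t) i = Ordinal it by apply: val_inj; rewrite /= nth_enum_ord.
exists (fun j => (j == Ordinal it)%:R *: v); rewrite (bigD1 (Ordinal it)) //= eqxx scale1r.
by rewrite big1 ?addr0 // => j /andP[_ /negbTE->]; rewrite scale0r scaler0.
Qed.

Lemma regular_sequenceE (A : comNzRingType) (m : {pred A}) (V : lmodType A) (t : nat)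
  (x : 'I_t -> A) (xs := [seq x i | i <- enum 'I_t]) :
  regular_sequence m V x <->
  [/\ forall y, y \in xs -> y \in m, regseq (fun v : V => v = 0) xs
    & exists v : V, ~ addxs zeroP xs v].
Proof.
have sxs : size xs = t by rewrite size_map size_enum_ord.
have exs (j : 'I_t) : xs`_j = x j by rewrite (nth_map j) ?size_enum_ord // nth_ord_enum.
have eT (z : V) : in_seq_mul x t z <-> addxs zeroP xs z.
  by rewrite in_seq_mulE // -/xs -{1}sxs take_size.
split=> [[h1 h2 [z hz]]|[h1 /regseq_nth h2 [z hz]]]; split.
- by move=> y /mapP[i _ ->].
- apply/regseq_nth => i; rewrite sxs => it; rewrite (exs (Ordinal it)) => v hv.
  by apply/in_seq_mulE => //=; [exact: ltnW | apply: (h2 (Ordinal it)); apply/in_seq_mulE => //; exact: ltnW].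
- by exists z => /eT.
- by move=> i; apply: h1; rewrite -exs mem_nth // sxs.
- move=> i v /in_seq_mulE h; apply/in_seq_mulE; first exact: ltnW.
  apply: (h2 i); first by rewrite sxs.
  by rewrite exs; apply: h; exact: ltnW.
by exists z => /eT.
Qed.

Lemma regseq_free_module (A : comNzRingType) (F : lmodType A) (l : nat) (nu : 'I_l -> F) xs :
  basis nu -> regseq (fun a : A^o => a = 0) xs -> regseq (fun v : F => v = 0) xs.
Proof.
move=> [snu inu]; have ln := lincomb_lin nu.
pose rel (W : A^o -> Prop) (WF : F -> Prop) :=
  forall c, WF (lincomb nu c) <-> forall i, W (c 0 i).
have : rel (fun a => a = 0) (fun v => v = 0).
  move=> c; split=> [h i|h]; last first.
    by rewrite (_ : c = 0) ?(lin0 ln) //; apply/rowP => i; rewrite mxE; exact: h.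
  by rewrite (inu c 0) ?mxE // (lin0 ln).
elim: xs (fun a => a = 0) (fun v => v = 0) => //= x xs IH WF W hr [hx hxs]; split.
  move=> v; have [c <-] := snu v; rewrite -(linZ ln) => /hr h; apply/hr => i.
  by apply: hx; have := h i; rewrite mxE.
apply: (IH (addx WF x) (addx W x)) => // c; split=> [[u]|hc].
  have [c' <-] := snu u; rewrite -(linZ ln) -(linB ln) => /hr h _ i.
  by exists (c' 0 i) => //; have := h i; rewrite !mxE.
have /choice[u hu] : forall i, exists u : A^o, W (c 0 i - x *: u).
  by move=> i; have [u hu _] := hc i; exists u.
exists (lincomb nu (\row_i u i)) => //; rewrite -(linZ ln) -(linB ln); apply/hr => i.
by rewrite !mxE; exact: hu.
Qed.

(** By the Noetherian maximal principle a non-unit lies in a maximal ideal, which is [m] by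
    uniqueness. *)
Lemma local_maximal (A : comNzRingType) (m : {pred A}) : noeth A^o -> local_with m ->
  is_prime (fun a => a \in m) /\ forall a, a \notin m -> unit_elt a.
Proof.
move=> nA [[im maxm] uniqm].
have um a : a \notin m -> unit_elt a.
  move=> nma; apply: contrapT => nu; move/negP: nma; apply.
  have [||I [iI I1 Ia] hI] := noeth_max (V := A^o)
    (C := fun I => [/\ ideal I, ~ I 1 & I a]) nA.
  - by move=> I [].
  - exists (addx (fun b : A^o => b = 0) a); split.
    + exact/addx_submod/submod_zero.
    + by case=> b /eqP; rewrite subr_eq0 => /eqP h _; apply: nu; exists b; rewrite mulrC; exact/esym/h.
    by exists 1 => //; rewrite /GRing.scale /= mulr1 subrr.
  suff h : maximal_ideal (fun b => `[< I b >]).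
    by rewrite -(uniqm _ h); apply/asboolP.
  split; first split.
  - by apply/asboolP; exact: ideal0 iI.
  - by apply/negP => /asboolP.
  - by move=> b u v /asboolP hu /asboolP hv; apply/asboolP; apply: iI.2.
  move=> J [J0 J1 hJ] IJ b Jb; apply/asboolP.
  apply: (hI (fun x => x \in J)) => //; last by move=> c Ic; apply/IJ/asboolP.
  split; [by split=> // c u v; exact: hJ|exact/negP|].
  by apply/IJ/asboolP.
split=> //; case: im => m0 m1 hm; split; [by split=> // c u v; exact: hm|exact/negP|].
move=> a b mab; apply: contrapT => /not_orP[/negP na /negP nb].
have [c hc] := um a na; move/negP: nb; apply.
rewrite -[b]mul1r -hc -mulrA -[c * _]addr0; exact: hm.
Qed.

Section RegularLocal.
Variables (A : comNzRingType) (m : A -> Prop) (d : nat) (gs : seq A) (y : A).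
Hypotheses (nA : noeth A^o) (pm : is_prime m) (um : forall a, ~ m a -> unit_elt a).
Hypotheses (sgs : size gs = d)
  (hgs : forall a, m a <-> addxs (fun a : A^o => a = 0) (rcons gs y) a).
Hypothesis hdim : exists2 P : A -> Prop, is_prime P & pchain d.+1 P.

Let im := prime_ideal_of pm.
Let s0 (V : lmodType A) := submod_zero V.

Lemma gens_mem hs : (forall a, m a <-> addxs (fun a : A^o => a = 0) hs a) ->
  forall h, h \in hs -> m h.
Proof.
move=> hm h hh; apply/hm; have := addxs_mem (1 : A^o) (s0 A^o) hh.
by rewrite /GRing.scale /= mulr1.
Qed.

Lemma regular_gens hs : size hs = d.+1 ->
  (forall a, m a <-> addxs (fun a : A^o => a = 0) hs a) ->
  is_prime (fun a : A => a = 0) /\ regseq (fun a : A^o => a = 0) hs.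
Proof.
move=> shs hm; have [P pP ch] := hdim.
apply: (regular_system nA pm um (s0 _) (gens_mem hm) hm pP); last by rewrite shs.
by move=> a ->; exact: ideal0 (prime_ideal_of pP).
Qed.

Let mgs := gens_mem hgs.
Let sgs' : size (rcons gs y) = d.+1. Proof. by rewrite size_rcons sgs. Qed.

(** The ring is a domain, so [f] is regular and can be exchanged into a regular system of
    parameters. *)
Lemma hypersurface_regseq f : m f -> f <> 0 ->
  exists xs, [/\ size xs = d, forall x, x \in xs -> m x
    & regseq (addx (fun a : A^o => a = 0) f) xs].
Proof.
move=> mf f0; have [pr0 rgs] := regular_gens sgs' hgs.
apply: (exchange nA pm um nA (s0 A^o) sgs' mgs rgs mf).
by move=> a fa; have [_ _ /(_ f a fa)[]] := pr0.
Qed.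

(** The generators are made regular one at a time by coset avoidance; after each choice the exchange
    property supplies a sequence, shorter by one, that is regular on the new quotient. *)
Lemma regseq_coset (V : lmodType A) (W : V -> Prop) (I : A -> Prop) gs' xs :
  noeth V -> submod W -> ideal I -> (forall b c, m b -> m c -> I (b * c)) ->
  (forall a, I a -> m a) -> (forall g, g \in gs' -> m g) ->
  size xs = size gs' -> (forall x, x \in xs -> m x) -> regseq W xs ->
  exists hs, [/\ size hs = size gs', regseq W hs
    & forall i, (i < size gs')%N -> I (hs`_i - gs'`_i)].
Proof.
move=> nV sW iI mI Im; elim: gs' W xs sW => [|g gs' IH] W xs sW mgs' sxs mxs hxs.
  by exists [::].
have ns : nosocle W m.
  case: xs sxs mxs hxs => // x xs _ mxs [hx _].
  by apply: nzd_nosocle hx; apply: mxs; rewrite mem_head.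
have [t It ht] := avoid_coset nA nV sW g iI mI ns.
have mgt : m (g + t).
  by apply: idealD => //; [apply: mgs'; rewrite mem_head|exact: Im].
have [ys [sys mys hys]] := exchange nA pm um nV sW sxs mxs hxs mgt ht.
have [|hs [shs hhs hI]] := IH _ ys (addx_submod _ sW) _ sys mys hys.
  by move=> h hh; apply: mgs'; rewrite inE hh orbT.
exists ((g + t) :: hs); split=> //=; first by rewrite shs.
by case=> [_|i hi] /=; [rewrite addrC addKr|exact: hI].
Qed.

(* If V has depth d, generators h of the maximal ideal can be chosen so that the
   first d of them form a V-regular sequence; then they are K-regular for any
   first syzygy K of V. *)
Lemma syzygy_free (K F V : lmodType A) (io : K -> F) (ph : F -> V) (l : nat)
  (nu : 'I_l -> F) xs : lin io -> lin ph -> surj ph -> injective io ->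
  (forall v, ph v = 0 <-> exists k, io k = v) -> basis nu -> fin_gen K -> fin_gen V ->
  size xs = d -> (forall x, x \in xs -> m x) -> regseq (fun v : V => v = 0) xs ->
  exists (r : nat) (mu : 'I_r -> K), basis mu.
Proof.
move=> lio lph sph iio hker bnu fK fV sxs mxs hxs.
(* This is m^2. By Nakayama, altering [gs] modulo m^2 still gives generators of [m]; [y] is kept as
   it is, because only [d] elements regular on V are available. *)
pose I (a : A) := span_in m (rcons gs y : seq A^o) a.
have iI : ideal I by exact: (span_in_submod (V := A^o) _ im).
have gen a : m a -> span (rcons gs y : seq A^o) a.
  move=> /hgs; apply: (addxs_min (span_submod _)) => [v ->|x v xx].
    exact: submod0 (span_submod _).
  by rewrite /GRing.scale /= mulrC; apply/(submodZ _ (span_submod _))/mem_span.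
have mI b c : m b -> m c -> I (b * c).
  by move=> mb /gen; apply: (span_in_scale (V := A^o)).
have Im a : I a -> m a.
  apply: (span_in_sub (V := A^o)) => // g b gg mb.
  exact: idealMr.
have [||hs [shs hhs hI]] := regseq_coset (noeth_fg nA fV) (s0 V) iI mI Im _ _ mxs hxs (gs' := gs).
- by move=> g gg; apply: mgs; rewrite mem_rcons inE gg orbT.
- by rewrite sxs sgs.
have hm a : m a <-> addxs (fun a : A^o => a = 0) (rcons hs y) a.
  have sA := addxs_submod (rcons hs y) (s0 A^o).
  split; last first.
    apply: (addxs_min (U := m : A^o -> Prop) im) => [v ->|x v]; first exact: ideal0.
    rewrite mem_rcons inE => hx; apply: (idealMr v im); case/orP: hx => [/eqP->|].
      by apply: mgs; rewrite mem_rcons mem_head.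
    move=> /(nthP 0)[i]; rewrite shs => hi <-; rewrite -[hs`_i](subrK gs`_i).
    apply: idealD => //; first exact/Im/hI.
    by apply: mgs; rewrite mem_rcons inE mem_nth ?orbT.
  move: a; apply: (nakayama pm um (V := A^o) (U := m) nA) => // v /hgs.
  pose U (v : A^o) := exists2 w, addxs (fun a : A^o => a = 0) (rcons hs y) w & I (v - w).
  have sU : submod U.
    split=> [|a u w [u' hu Iu] [w' hw Iw]].
      by exists 0; [exact: submod0 | rewrite subrr; exact: ideal0].
    exists (a *: u' + w'); first exact: sA.2.
    by rewrite opprD addrACA -scalerBr; apply: iI.2.
  have : forall v, addxs (fun a : A^o => a = 0) (rcons gs y) v -> U v.
    apply: addxs_min => [//|u ->|x u xx]; first exact: submod0.
    rewrite /GRing.scale /= mulrC; apply: (submodZ u sU).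
    move: xx; rewrite mem_rcons inE => /orP[/eqP->|/(nthP 0)[i hi <-]].
      exists y; last by rewrite subrr; exact: ideal0.
      have := @addxs_mem A A^o _ (rcons hs y) y 1 (s0 A^o).
      by rewrite mem_rcons mem_head /GRing.scale /= mulr1; apply.
    exists hs`_i; last by rewrite -opprB; apply: (idealN iI); apply: hI.
    have := @addxs_mem A A^o _ (rcons hs y) hs`_i 1 (s0 A^o).
    by rewrite mem_rcons inE mem_nth ?shs // orbT /GRing.scale /= mulr1; apply.
  move=> h /h[w hw Iw]; exists w => //; exists (rcons gs y); split=> // g; exact: mgs.
have shs' : size (rcons hs y) = d.+1 by rewrite size_rcons shs sgs.
have [_ rS] := regular_gens shs' hm.
apply: (regseq_free nA pm um fK hm).
apply: (ses_regseq lio lph sph _ hhs (regseq_free_module bnu rS)).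
split; try exact: submod_zero.
  by move=> k; rewrite -(lin0 lio); split=> [/iio|->].
move=> v; rewrite hker; split=> -[k h]; exists k; first by rewrite h subrr.
by apply/esym/eqP; rewrite -subr_eq0; apply/eqP.
Qed.

End RegularLocal.

(** * Eventually periodic resolutions *)

Section Resolutions.
Variable L : pzRingType.
Implicit Types X P K : lmodType L.

Definition has_res X : Prop := exists P : proj_resolution X, eventually_2periodic P.

Section Splice.
Variables (X P0 K : lmodType L) (pi0 : P0 -> X) (j : K -> P0).
Hypotheses (lpi : lin pi0) (spi : surj pi0) (prP : projective P0).
Hypotheses (lj : lin j) (ij : injective j) (hker : forall x, pi0 x = 0 <-> exists k, j k = x).
Variable R : proj_resolution K.

Definition splice_term i : lmodType L := if i is i'.+1 then res_term R i' else P0.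

Definition splice_diff i : {linear splice_term i.+1 -> splice_term i} :=
  match i with
  | 0 => (lin_pack lj \o res_aug R)%FUN : {linear res_term R 0 -> P0}
  | i'.+1 => res_diff R i'
  end.

Lemma splice_proj i : projective (splice_term i).
Proof. by case: i => [|i] //=; exact: res_proj. Qed.

Lemma splice_exact0 x : lin_pack lpi x = 0 <-> exists z, splice_diff 0 z = x.
Proof.
rewrite /= hker; split=> [[k <-]|[z <-]]; last by exists (res_aug R z).
by have [z <-] := res_surj R k; exists z.
Qed.

Lemma splice_exact i x : splice_diff i x = 0 <-> exists z, splice_diff i.+1 z = x.
Proof.
case: i x => [|i] x /=; last exact: res_exact.
by rewrite -(lin0 lj) -res_exact0; split=> [/ij|->].
Qed.

Definition splice_resolution : proj_resolution X :=
  ProjResolution (res_diff := splice_diff) splice_proj (spi : surj (lin_pack lpi))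
    splice_exact0 splice_exact.

Lemma splice_periodic : eventually_2periodic R -> eventually_2periodic splice_resolution.
Proof.
move=> [N [e he]].
exists N.+1, (fun i => match i return {linear splice_term i.+2 -> splice_term i} with
  | 0 => \0 | i'.+1 => e i' end).
by case=> // i /he.
Qed.

End Splice.

Lemma has_res_splice X P0 K (pi0 : P0 -> X) (j : K -> P0) :
  lin pi0 -> surj pi0 -> projective P0 -> lin j -> injective j ->
  (forall x, pi0 x = 0 <-> exists k, j k = x) -> has_res K -> has_res X.
Proof.
move=> lpi spi prP lj ij hker [R hR].
exists (splice_resolution lpi spi prP lj ij hker R); exact: splice_periodic.
Qed.

Lemma has_res_iso X X' (g : X' -> X) : lin g -> bijective g -> has_res X' -> has_res X.
Proof.
move=> lg bg [R [N [e he]]]; have ig := bij_inj bg.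
have [h gh hg] := bg.
have sg : surj (lin_pack lg \o res_aug R)%FUN.
  by move=> x; have [z hz] := res_surj R (h x); exists z; rewrite /= hz hg.
have ex0 x : (lin_pack lg \o res_aug R)%FUN x = 0 <-> exists z, res_diff R 0 z = x.
  by rewrite -res_exact0 /= -(lin0 lg); split=> [/ig|->].
by exists (ProjResolution (@res_proj _ _ R) sg ex0 (@res_exact _ _ R)), N, e.
Qed.

Section Periodic.
Variables (X P P' : lmodType L) (ep : P -> X) (a : P' -> P) (b : P -> P').
Hypotheses (lep : lin ep) (sep : surj ep) (la : lin a) (lb : lin b).
Hypotheses (pP : projective P) (pP' : projective P').
Hypotheses (ex0 : forall x, ep x = 0 <-> exists z, a z = x)
  (exa : forall x, a x = 0 <-> exists z, b z = x)
  (exb : forall x, b x = 0 <-> exists z, a z = x).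

Fixpoint per_term i : lmodType L :=
  match i with 0 => P | 1 => P' | i'.+2 => per_term i' end.

Fixpoint per_diff i : {linear per_term i.+1 -> per_term i} :=
  match i return {linear per_term i.+1 -> per_term i} with
  | 0 => lin_pack la | 1 => lin_pack lb | i'.+2 => per_diff i' end.

Lemma two_step_ind (Q : nat -> Prop) : Q 0%N -> Q 1%N -> (forall i, Q i -> Q i.+2) ->
  forall i, Q i.
Proof.
move=> h0 h1 h i; suff [] : Q i /\ Q i.+1 by [].
by elim: i => // i [h2 h3]; split=> //; apply: h.
Qed.

Lemma has_res_periodic : has_res X.
Proof.
have prt i : projective (per_term i) by elim/two_step_ind: i.
have exd i x : per_diff i x = 0 <-> exists z, per_diff i.+1 z = x.
  by move: x; elim/two_step_ind: i.
exists (ProjResolution (res_diff := per_diff) prt (sep : surj (lin_pack lep)) ex0 exd), 0%N.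
exists (fun i => idfun : {linear per_term i.+2 -> per_term i}) => i _.
by split=> //; exists idfun.
Qed.

End Periodic.

Definition freemod (b : nat) : lmodType L := {ffun 'I_b -> L^o}.

Definition freecomb X b (x : 'I_b -> X) (c : freemod b) : X := \sum_i (c i : L) *: x i.

Lemma freecomb_lin X b (x : 'I_b -> X) : lin (freecomb x).
Proof.
move=> a u v; rewrite /freecomb scaler_sumr -big_split; apply: eq_bigr => i _.
by rewrite !ffunE scalerDl scalerA.
Qed.

Lemma freemod_projective b : projective (freemod b).
Proof.
move=> U V g h sg.
have /choice[u hu] : forall i : 'I_b, exists u, g u = h [ffun j => (j == i)%:R].
  by move=> i; exact: sg.
exists (lin_pack (freecomb_lin u)) => c /=.
have ec : c = \sum_i (c i : L) *: ([ffun j => (j == i)%:R] : freemod b).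
  apply/ffunP => j; rewrite sum_ffunE (bigD1 j) //= ffunE ffunE eqxx.
  rewrite /GRing.scale /= mulr1 big1 ?addr0 // => i /negbTE ij.
  by rewrite !ffunE eq_sym ij /GRing.scale /= mulr0.
rewrite {2}ec !linear_sum; apply: eq_bigr => i _.
by rewrite !linearZ_LR /= hu.
Qed.

End Resolutions.

(** * Modules over the centraliser of a matrix *)

Section CentraliserModule.
Variables (S : comNzRingType) (k : nat) (L : pzRingType) (th : {rmorphism L -> 'M[S]_k}).

(* Only the L-module structure declared below depends on the unused morphism. *)
Definition lmx (l : nat) of {rmorphism L -> 'M[S]_k} : Type := 'M[S]_(k, l).

Variable l : nat.
Local Notation W := (lmx l th).

HB.instance Definition _ := GRing.Zmodule.copy W 'M[S]_(k, l).

Definition lmx_scale (a : L) (B : W) : W := th a *m (B : 'M[S]_(k, l)).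

Fact lmx_scaleA a b B : lmx_scale a (lmx_scale b B) = lmx_scale (a * b) B.
Proof. by rewrite /lmx_scale rmorphM mulmxA. Qed.
Fact lmx_scale1 : left_id 1 lmx_scale.
Proof. by move=> B; rewrite /lmx_scale rmorph1 mul1mx. Qed.
Fact lmx_scaleDr : right_distributive lmx_scale +%R.
Proof. by move=> a B C; rewrite /lmx_scale mulmxDr. Qed.
Fact lmx_scaleDl B : {morph lmx_scale^~ B : a b / a + b}.
Proof. by move=> a b; rewrite /lmx_scale rmorphD mulmxDl. Qed.
HB.instance Definition _ := GRing.Zmodule_isLmodule.Build L W
  lmx_scaleA lmx_scale1 lmx_scaleDr lmx_scaleDl.

Lemma lmx_scaleE (a : L) (B : W) : a *: B = th a *m (B : 'M[S]_(k, l)) :> 'M[S]_(k, l).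
Proof. by []. Qed.

End CentraliserModule.

(** S-linear maps S^k -> V, recorded by the images of the basis vectors; L acts by
    precomposition. *)
Definition cols (S : comNzRingType) (V : lmodType S) (k : nat) (L : pzRingType)
  of {rmorphism L -> 'M[S]_k} : Type := {ffun 'I_k -> V}.
Arguments cols {S} V {k L} th.

Section Columns.
Variables (S : comNzRingType) (V : lmodType S) (k : nat).
Variables (L : pzRingType) (th : {rmorphism L -> 'M[S]_k}).
Local Notation W := (cols V th).

HB.instance Definition _ := GRing.Zmodule.copy W {ffun 'I_k -> V}.

Definition act (B : 'M[S]_k) (v : W) : W := [ffun i => \sum_j B i j *: v j].

Lemma act_mul B C v : act (B *m C) v = act B (act C v).
Proof.
apply/ffunP => i; rewrite !ffunE.
under [RHS]eq_bigr => j _ do rewrite ffunE scaler_sumr.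
rewrite exchange_big; apply: eq_bigr => s _; rewrite mxE scaler_suml.
by apply: eq_bigr => j _; rewrite scalerA.
Qed.

Lemma act1 v : act 1%:M v = v.
Proof.
apply/ffunP => i; rewrite ffunE (bigD1 i) //= mxE eqxx scale1r big1 ?addr0 // => j ji.
by rewrite mxE eq_sym (negbTE ji) scale0r.
Qed.

Lemma act_add B v w : act B (v + w) = act B v + act B w.
Proof.
apply/ffunP => i; rewrite !ffunE -big_split; apply: eq_bigr => j _.
by rewrite ffunE scalerDr.
Qed.

Lemma act_addl B C v : act (B + C) v = act B v + act C v.
Proof.
apply/ffunP => i; rewrite !ffunE -big_split; apply: eq_bigr => j _.
by rewrite mxE scalerDl.
Qed.

Definition cols_scale (a : L) (v : W) : W := act (th a) v.

Fact cols_scaleA a b v : cols_scale a (cols_scale b v) = cols_scale (a * b) v.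
Proof. by rewrite /cols_scale rmorphM act_mul. Qed.
Fact cols_scale1 : left_id 1 cols_scale.
Proof. by move=> v; rewrite /cols_scale rmorph1 act1. Qed.
Fact cols_scaleDr : right_distributive cols_scale +%R.
Proof. by move=> a v w; rewrite /cols_scale act_add. Qed.
Fact cols_scaleDl v : {morph cols_scale^~ v : a b / a + b}.
Proof. by move=> a b; rewrite /cols_scale rmorphD act_addl. Qed.
HB.instance Definition _ := GRing.Zmodule_isLmodule.Build L W
  cols_scaleA cols_scale1 cols_scaleDr cols_scaleDl.

End Columns.

(** * Homomorphisms out of (S^k, Y) and their projective resolutions *)

Section MatrixFactorization.
Variables (S : comNzRingType) (f : S) (N : nat).
Hypothesis fS : forall a : S, f * a = 0 -> a = 0.

Definition cover_mx l (Z : 'M[S]_l) : Prop := Z ^+ N.+1 = (- f)%:M.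

(* With n = N + 1 and T(P) = {z in A (x) S^l | z_0 in the image of P}, where
   A = S[y]/(f + y^n), an A-linear map T(P) -> (S^k, Y) amounts to a pair (a, a') and
   an A-linear map (S^k, Y) -> T(P) to a pair (b, b'), as in the first four conditions;
   the last four say that the composites T(P) -> (S^k, Y) -> T(P) add up to the identity. *)
Definition factor_summand k (Y : 'M[S]_k) l (P Q : 'M[S]_l) : Prop :=
  exists (J : finType) (a a' : J -> 'M[S]_(l, k)) (b b' : J -> 'M[S]_(k, l)),
  ((forall j, [/\ P *m a' j = a j *m Y, Q *m a j = a' j *m Y ^+ N,
       b j *m P = Y ^+ N *m b' j & b' j *m Q = Y *m b j]) *
  [/\ \sum_j a j *m b j = 1%:M,
      forall i, (i < N)%N -> \sum_j a j *m Y ^+ i *m b' j = 0,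
      forall i, (i < N)%N -> \sum_j a' j *m Y ^+ i *m b j = 0
    & forall i, (i < N)%N -> \sum_j a' j *m Y ^+ i *m b' j = (i.+1 == N)%:R%:M])%type.

(** The left side averages the S-linear map [c] to an A-linear one. Such averages are the
    endomorphisms factoring through a free A-module, so the identity says that y is one of them. *)
Definition trace_identity k (Y c : 'M[S]_k) : Prop :=
  \sum_(i < N.+1) Y ^+ (N - i) *m c *m Y ^+ i = Y.

Lemma mx_cancel l (Z : 'M[S]_l) k (X : 'M[S]_(k, l)) : cover_mx Z -> X *m Z = 0 -> X = 0.
Proof.
move=> hZ XZ0; have : X *m Z ^+ N.+1 = 0 by rewrite exprS mulmxA XZ0 mul0mx.
rewrite hZ mul_mx_scalar => /matrixP h; apply/matrixP => i j; rewrite mxE.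
by apply: fS; apply: oppr_inj; have := h i j; rewrite !mxE mulNr oppr0.
Qed.

Lemma mx_cancelB l (Z : 'M[S]_l) k (X X' : 'M[S]_(k, l)) :
  cover_mx Z -> X *m Z = X' *m Z -> X = X'.
Proof.
move=> hZ e; apply/eqP; rewrite -subr_eq0; apply/eqP; apply: (mx_cancel hZ).
by rewrite mulmxBl e subrr.
Qed.

Variables (k : nat) (Y c : 'M[S]_k).
Hypotheses (hY : cover_mx Y) (hc : trace_identity Y c).
Variables (L : pzRingType) (th : {rmorphism L -> 'M[S]_k}) (tinv : 'M[S]_k -> L).
Hypotheses (thY : forall a, Y *m th a = th a *m Y) (thI : injective th)
  (tinvK : forall B, Y *m B = B *m Y -> th (tinv B) = B).

Lemma commX l (Z : 'M[S]_l) (X : 'M[S]_(k, l)) i : Y *m X = X *m Z -> Y ^+ i *m X = X *m Z ^+ i.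
Proof.
move=> h; elim: i => [|i IH]; first by rewrite !expr0 mulmx1 mul1mx.
by rewrite exprS -mulmxA IH mulmxA h -mulmxA exprS.
Qed.

Lemma YX l (Z : 'M[S]_l) i : Z *m Z ^+ i = Z ^+ i.+1. Proof. by rewrite exprS. Qed.
Lemma XY l (Z : 'M[S]_l) i : Z ^+ i *m Z = Z ^+ i.+1. Proof. by rewrite exprSr. Qed.

Lemma thX a i : Y ^+ i *m th a = th a *m Y ^+ i.
Proof. exact: commX. Qed.

Section Hom.
Variables (l : nat) (Z : 'M[S]_l).

Definition hom_map (B : lmx l th) : lmx l th := Y *m (B : 'M[S]_(k, l)) - (B : 'M[S]_(k, l)) *m Z.

Lemma hom_map_lin : lin hom_map.
Proof.
move=> a u v; rewrite /hom_map [a *: (_ - _)]scalerBr !lmx_scaleE.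
by rewrite mulmxDr mulmxDl !mulmxA thY opprD addrACA.
Qed.

(* Hom_A((S^k, Y), (S^l, Z)) *)
Definition homm : lmodType L := lin_ker (lin_pack hom_map_lin).

Lemma hommP (x : homm) : Y *m (val x : 'M[S]_(k, l)) = (val x : 'M[S]_(k, l)) *m Z.
Proof. by apply/eqP; rewrite -subr_eq0; exact: (valP x). Qed.

Lemma homm_mem (B : 'M[S]_(k, l)) : Y *m B = B *m Z -> B \in ker_pred (lin_pack hom_map_lin).
Proof. by move=> h; apply/eqP; rewrite /= /hom_map h subrr. Qed.

Definition mk_homm B (h : Y *m B = B *m Z) : homm := exist _ (B : lmx l th) (homm_mem h).

End Hom.

Section Factor.
Variables (l : nat) (P Q : 'M[S]_l).
Local Notation D := (lmx l th * lmx l th)%type.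
Local Notation M := 'M[S]_(k, l).

Definition factor_map (x : D) : D :=
  (Y ^+ N *m (x.2 : M) - (x.1 : M) *m P, Y *m (x.1 : M) - (x.2 : M) *m Q).

Lemma factor_map_lin : lin factor_map.
Proof.
move=> a [u u'] [v v']; rewrite /factor_map.
congr pair; rewrite /= [a *: (_ - _)]scalerBr !lmx_scaleE.
  by rewrite mulmxDr mulmxDl !mulmxA thX opprD addrACA.
by rewrite mulmxDr mulmxDl !mulmxA thY opprD addrACA.
Qed.

(* Hom_A((S^k, Y), T(P)), see factor_summand *)
Definition hfac : lmodType L := lin_ker (lin_pack factor_map_lin).

Definition fac1 (x : hfac) : M := (val x).1.
Definition fac2 (x : hfac) : M := (val x).2.

Lemma hfacP (x : hfac) : Y ^+ N *m fac2 x = fac1 x *m P /\ Y *m fac1 x = fac2 x *m Q.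
Proof.
have /eqP := valP x; case=> h1 h2.
by split; apply/eqP; rewrite -subr_eq0; apply/eqP.
Qed.

Lemma hfac_mem (b b' : M) : Y ^+ N *m b' = b *m P -> Y *m b = b' *m Q ->
  (b, b') \in ker_pred (lin_pack factor_map_lin).
Proof. by move=> h1 h2; apply/eqP; rewrite /= /factor_map /= h1 h2 !subrr. Qed.

Definition mk_hfac b b' (h1 : Y ^+ N *m b' = b *m P) (h2 : Y *m b = b' *m Q) : hfac :=
  exist _ ((b, b') : D) (hfac_mem h1 h2).

Lemma hfac_inj (x y : hfac) : fac1 x = fac1 y -> fac2 x = fac2 y -> x = y.
Proof.
move=> h1 h2; apply: val_inj; rewrite [val x]surjective_pairing [RHS]surjective_pairing.
by congr pair.
Qed.

Lemma fac1_lin a x y : fac1 (a *: x + y) = th a *m fac1 x + fac1 y. Proof. by []. Qed.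
Lemma fac2_lin a x y : fac2 (a *: x + y) = th a *m fac2 x + fac2 y. Proof. by []. Qed.

Lemma fac1_sum (I : Type) (s : seq I) (F : I -> hfac) : fac1 (\sum_(i <- s) F i) = \sum_(i <- s) fac1 (F i).
Proof. by apply: (big_morph fac1). Qed.
Lemma fac2_sum (I : Type) (s : seq I) (F : I -> hfac) : fac2 (\sum_(i <- s) F i) = \sum_(i <- s) fac2 (F i).
Proof. by apply: (big_morph fac2). Qed.

(* The composite (S^k, Y) -> T(P) -> (S^k, Y). *)
Definition fac_comp (a a' : 'M[S]_(l, k)) (x : hfac) : 'M[S]_k :=
  fac1 x *m a + \sum_(i < N) Y ^+ (N.-1 - i) *m fac2 x *m a' *m Y ^+ i.

Lemma fac_comp_lin a a' (t : L) x y :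
  fac_comp a a' (t *: x + y) = th t *m fac_comp a a' x + fac_comp a a' y.
Proof.
rewrite /fac_comp fac1_lin fac2_lin mulmxDr mulmxDl mulmx_sumr mulmxA.
rewrite [RHS]addrACA -big_split /=; congr (_ + _).
by apply: eq_bigr => i _; rewrite mulmxDr !mulmxDl !mulmxA thX.
Qed.

Lemma fac_comp_comm a a' x : P *m a' = a *m Y -> Q *m a = a' *m Y ^+ N ->
  Y *m fac_comp a a' x = fac_comp a a' x *m Y.
Proof.
move=> h1 h2; have [e1 e2] := hfacP x.
pose u i := Y ^+ (N - i) *m fac2 x *m a' *m Y ^+ i.
rewrite /fac_comp mulmxDl mulmxDr.
have -> : Y *m (fac1 x *m a) = u N by rewrite mulmxA e2 -mulmxA h2 /u subnn expr0 mul1mx mulmxA.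
have -> : fac1 x *m a *m Y = u 0%N by rewrite -mulmxA -h1 mulmxA -e1 /u subn0 expr0 mulmx1.
have -> : Y *m (\sum_(i < N) Y ^+ (N.-1 - i) *m fac2 x *m a' *m Y ^+ i) = \sum_(i < N) u i.
  rewrite mulmx_sumr; apply: eq_bigr => i _; rewrite /u !mulmxA YX.
  by congr (Y ^+ _ *m _ *m _ *m _); case: i => i /=; lia.
have -> : (\sum_(i < N) Y ^+ (N.-1 - i) *m fac2 x *m a' *m Y ^+ i) *m Y = \sum_(i < N) u i.+1.
  rewrite mulmx_suml; apply: eq_bigr => i _; rewrite /u -mulmxA XY.
  by congr (Y ^+ _ *m _ *m _ *m _); case: i => i /=; lia.
have e : \sum_(i < N) u i + u N = u 0%N + \sum_(i < N) u i.+1.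
  by transitivity (\sum_(i < N.+1) u i); [rewrite big_ord_recr|rewrite big_ord_recl].
by rewrite addrC e.
Qed.

(** The pairs [b j, b' j] are elements [B j] of the module, and composition with [a j, a' j] gives
    coordinates in L; the sum conditions of [factor_summand] say that the two form a dual basis. *)
Lemma hfac_projective : factor_summand Y P Q -> projective hfac.
Proof.
move=> [r [a [a' [b [b' [h [s1 s2 s3 s4]]]]]]] U V g h0 sg.
have hb j : Y ^+ N *m b' j = b j *m P by case: (h j).
have hb' j : Y *m b j = b' j *m Q by case: (h j).
pose B j : hfac := mk_hfac (hb j) (hb' j).
have /choice[u hu] : forall j, exists u, g u = h0 (B j) by move=> j; exact: sg.
have hcomm j x : Y *m fac_comp (a j) (a' j) x = fac_comp (a j) (a' j) x *m Y.
  by case: (h j) => *; apply: fac_comp_comm.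
pose h' (x : hfac) : U := \sum_j tinv (fac_comp (a j) (a' j) x) *: u j.
have lh' : lin h'.
  move=> t x y; rewrite /h' scaler_sumr -big_split; apply: eq_bigr => j _.
  rewrite /= scalerA -scalerDl; congr (_ *: _); apply: thI.
  by rewrite rmorphD rmorphM !tinvK; [exact: fac_comp_lin|exact: hcomm..].
exists (lin_pack lh') => x /=.
have ex : x = \sum_j tinv (fac_comp (a j) (a' j) x) *: B j.
  apply: hfac_inj; rewrite ?fac1_sum ?fac2_sum.
    transitivity (\sum_j fac_comp (a j) (a' j) x *m b j); last first.
      by apply: eq_bigr => j _; rewrite -[in LHS](tinvK (hcomm j x)).
    rewrite /fac_comp.
    under eq_bigr => j _ do rewrite mulmxDl mulmx_suml -mulmxA.
    rewrite big_split /= -mulmx_sumr s1 mulmx1 exchange_big big1 ?addr0 // => i _ /=.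
    under eq_bigr => j _ do rewrite -!mulmxA.
    rewrite -!mulmx_sumr; under eq_bigr => j _ do rewrite mulmxA.
    by rewrite s3 // !mulmx0.
  transitivity (\sum_j fac_comp (a j) (a' j) x *m b' j); last first.
    by apply: eq_bigr => j _; rewrite -[in LHS](tinvK (hcomm j x)).
  rewrite /fac_comp.
  under eq_bigr => j _ do rewrite mulmxDl mulmx_suml -mulmxA.
  rewrite big_split /= -mulmx_sumr exchange_big /=.
  have [e1 e2] := hfacP x.
  (* For N = 0 the conditions indexed by i < N are void, and b' = bP follows from the commutation
     relations instead. *)
  have [N0|N0] := posnP N.
    rewrite [X in _ + X]big1 ?addr0 => [|i]; last by case: i => i hi; exfalso; move: hi; rewrite N0.
    have -> : \sum_j a j *m b' j = P.
      rewrite -[RHS]mul1mx -s1 mulmx_suml; apply: eq_bigr => j _.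
      by rewrite -mulmxA -hb N0 expr0 mul1mx.
    by rewrite -e1 N0 expr0 mul1mx.
  have -> : \sum_j a j *m b' j = 0.
    by rewrite -[RHS](s2 0%N) //; apply: eq_bigr => j _; rewrite expr0 mulmx1.
  rewrite mulmx0 add0r.
  have hi (i : 'I_N) : \sum_j Y ^+ (N.-1 - i) *m fac2 x *m a' j *m Y ^+ i *m b' j =
      Y ^+ (N.-1 - i) *m fac2 x *m (i.+1 == N)%:R%:M.
    rewrite -s4 // mulmx_sumr; apply: eq_bigr => j _; by rewrite !mulmxA.
  have lt : (N.-1 < N)%N by rewrite prednK.
  under eq_bigr => i _ do rewrite hi.
  rewrite (bigD1 (Ordinal lt)) //= subnn expr0 mul1mx prednK // eqxx mulmx1.
  rewrite big1 ?addr0 // => i ne.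
  have /negbTE-> : i.+1 != N by apply: contraNN ne => /eqP e; apply/eqP/val_inj => /=; lia.
  by rewrite mulr0n raddf0 mulmx0.
rewrite {2}ex linear_sum /h' linear_sum; apply: eq_bigr => j _.
by rewrite !linearZ_LR /= hu.
Qed.

End Factor.

(** * The 2-periodic resolution of Hom(N, X) *)

Section PeriodicHom.
Variables (l : nat) (Z : 'M[S]_l).
Hypothesis hZ : cover_mx Z.

Local Notation HP := (hfac Z (Z ^+ N)).
Local Notation HP' := (hfac (Z ^+ N) Z).
Local Notation M := 'M[S]_(k, l).

(** For z in T(Z) with z_0 = bZ and z_N = b', this is the evaluation A (x) X -> X divided by y,
    since evaluation maps T(Z) into yX. The undivided evaluation is [norm_val]. *)
Definition aug_val (b b' : M) : M := b + \sum_(i < N) Y ^+ (N.-1 - i) *m b' *m Z ^+ i.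

Definition norm_val (b' : M) : M := \sum_(i < N.+1) Y ^+ (N - i) *m b' *m Z ^+ i.

Lemma aug_valZ b b' : Y ^+ N *m b' = b *m Z -> aug_val b b' *m Z = norm_val b'.
Proof.
move=> h; rewrite /aug_val /norm_val mulmxDl -h big_ord_recl subn0 expr0 mulmx1.
congr (_ + _); rewrite mulmx_suml; apply: eq_bigr => i _; rewrite -mulmxA XY.
by congr (Y ^+ _ *m _ *m _); rewrite /= /bump /=; lia.
Qed.

Lemma aug_val_comm b b' : Y ^+ N *m b' = b *m Z -> Y *m b = b' *m Z ^+ N ->
  Y *m aug_val b b' = aug_val b b' *m Z.
Proof.
move=> h1 h2; rewrite aug_valZ // /aug_val /norm_val mulmxDr h2 big_ord_recr /= addrC.
rewrite subnn expr0 mul1mx; congr (_ + _); rewrite mulmx_sumr; apply: eq_bigr => i _.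
by rewrite !mulmxA YX; congr (Y ^+ _ *m _ *m _); case: i => i /=; lia.
Qed.

Lemma aug_comm (x : HP) : Y *m aug_val (fac1 x) (fac2 x) = aug_val (fac1 x) (fac2 x) *m Z.
Proof. by have [h1 h2] := hfacP x; apply: aug_val_comm. Qed.

Definition aug (x : HP) : homm Z := mk_homm (aug_comm x).

Lemma aug_val_lin t b b' b1 b1' :
  aug_val (th t *m b + b1) (th t *m b' + b1') = th t *m aug_val b b' + aug_val b1 b1'.
Proof.
rewrite /aug_val mulmxDr mulmx_sumr [RHS]addrACA -big_split /=; congr (_ + _).
by apply: eq_bigr => i _; rewrite mulmxDr !mulmxDl !mulmxA thX.
Qed.

Lemma aug_lin : lin aug.
Proof.
by move=> t x y; apply: val_inj; exact: (aug_val_lin t (fac1 x) (fac2 x) (fac1 y) (fac2 y)).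
Qed.

Lemma aug_surj : surj aug.
Proof.
move=> ph; pose p : M := val ph.
have hp : Y *m p = p *m Z := hommP ph.
(* The top coefficient is chosen as [c *m p]: by the trace identity the lift then evaluates to
   [Y *m p], and dividing by y returns [p]. The value of [b] is forced by the formula for
   [aug_val]. *)
pose b := p - \sum_(i < N) Y ^+ (N.-1 - i) *m (c *m p) *m Z ^+ i.
have tr : \sum_(i < N.+1) Y ^+ (N - i) *m (c *m p) *m Z ^+ i = Y *m p.
  rewrite -[in RHS]hc mulmx_suml; apply: eq_bigr => i _.
  by rewrite -!mulmxA (commX i hp).
have h1 : Y ^+ N *m (c *m p) = b *m Z.
  rewrite /b mulmxBl -hp -tr big_ord_recl subn0 expr0 mulmx1 mulmx_suml.
  apply/esym/eqP; rewrite subr_eq; apply/eqP; congr (_ + _).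
  apply: eq_bigr => i _; rewrite -[RHS]mulmxA XY.
  by congr (Y ^+ _ *m _ *m _); rewrite /= /bump /=; lia.
have h2 : Y *m b = (c *m p) *m Z ^+ N.
  rewrite /b mulmxBr -tr big_ord_recr /= subnn expr0 mul1mx mulmx_sumr.
  apply/eqP; rewrite subr_eq addrC; apply/eqP; congr (_ + _).
  apply: eq_bigr => i _; rewrite !mulmxA YX.
  by congr (Y ^+ _ *m _ *m _ *m _); case: i => i /=; lia.
exists (mk_hfac h1 h2); apply: val_inj.
by rewrite /= /aug_val /fac1 /fac2 /= /b subrK.
Qed.

(** With b' - b as top coefficient, this is z |-> (y - Z)z / y from T(Z^N) to T(Z); the multiples of
    y - Z in A (x) X form the kernel of the evaluation. *)
Definition dif_val (b b' : M) : M := b *m Z ^+ N.-1 - Y ^+ N.-1 *m b'.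

Lemma dif_comm (x : HP') :
  Y ^+ N *m (fac2 x - fac1 x) = dif_val (fac1 x) (fac2 x) *m Z /\
  Y *m dif_val (fac1 x) (fac2 x) = (fac2 x - fac1 x) *m Z ^+ N.
Proof.
have [] := hfacP x; rewrite /dif_val; move: (fac1 x) (fac2 x) => b b' h1 h2.
have [N0|N0] := posnP N.
  have e : b' = b by move: h1; rewrite N0 !expr0 mul1mx mulmx1.
  by rewrite e N0 /= !expr0 !mulmx1 !mul1mx !subrr mulmx0 mul0mx.
have e : N.-1.+1 = N by rewrite prednK.
split.
  by rewrite mulmxBr mulmxBl -!mulmxA XY e // -h1 -h2 mulmxA XY e.
by rewrite mulmxBr mulmxBl !mulmxA YX e // h2 h1 -mulmxA YX e.
Qed.

Definition dif (x : HP') : HP := mk_hfac (dif_comm x).1 (dif_comm x).2.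

Lemma dif_lin : lin dif.
Proof.
move=> t x y; apply: hfac_inj; rewrite ?fac1_lin ?fac2_lin /fac1 /fac2 /= -/(fac1 _) -/(fac2 _).
  rewrite /dif_val !fac1_lin !fac2_lin -/(fac1 x) -/(fac1 y) -/(fac2 x) -/(fac2 y).
  by rewrite mulmxBr mulmxDl mulmxDr !mulmxA thX opprD addrACA.
by rewrite mulmxBr opprD addrACA.
Qed.

Lemma per_comm (p : M) : Y *m p = p *m Z -> Y ^+ N *m p = p *m Z ^+ N.
Proof. exact: commX. Qed.

(** X embeds in T(Z^N) by sending x to the sum of the y^(N-i) Z^i x, with z_N = x and z_0 = x Z^N;
    these elements are the ones killed by y - Z. *)
Definition per (x : HP) : HP' := mk_hfac (per_comm (aug_comm x)) (aug_comm x).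

Lemma per_lin : lin per.
Proof. by move=> t x y; have h := congr1 val (aug_lin t x y); apply: hfac_inj. Qed.

Lemma aug_dif x : aug (dif x) = 0.
Proof.
apply: val_inj; apply: (mx_cancel hZ).
have [d1 d2] := dif_comm x; have [h1 h2] := hfacP x.
rewrite /= /fac1 /fac2 /= -/(fac1 _) -/(fac2 _) aug_valZ //.
have -> : norm_val (fac2 x - fac1 x) = norm_val (fac2 x) - norm_val (fac1 x).
  by rewrite /norm_val -sumrB; apply: eq_bigr => i _; rewrite mulmxBr mulmxBl.
apply/eqP; rewrite subr_eq0 {1}/norm_val big_ord_recl subn0 expr0 mulmx1 h1 addrC.
rewrite /norm_val big_ord_recr /= subnn expr0 mul1mx; apply/eqP; congr (_ + _).
apply: eq_bigr => i _; rewrite /= /bump /= add1n exprS !mulmxA -[_ *m fac2 x *m Z]mulmxA.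
rewrite -h2 mulmxA XY; congr (Y ^+ _ *m _ *m _); case: i => i /=; lia.
Qed.

Lemma trace_rev : \sum_(i < N.+1) Y ^+ i *m c *m Y ^+ (N - i) = Y.
Proof.
rewrite -[RHS]hc [RHS](reindex_inj rev_ord_inj); apply: eq_bigr => i _.
by rewrite /= subSS subKn // -ltnS.
Qed.

(* The preimage of (b, b') under dif is (p' - b', p'): p' comes from lifting through
   the partial quotients of (y^i - Z^i) / (y - Z) and averaging with c. *)
Lemma aug_exact x : aug x = 0 -> exists z, dif z = x.
Proof.
move=> ax; have [h1 h2] := hfacP x.
set b := fac1 x in h1 h2; set b' := fac2 x in h1 h2.
have av : aug_val b b' = 0 by have := congr1 val ax.
have nv : norm_val b' = 0 by rewrite -(aug_valZ h1) av mul0mx.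
pose W (i : nat) := c *m Y ^+ (N.-1 - i) *m b'.
pose p' := \sum_(i < N) \sum_(0 <= t < i.+1) Y ^+ t *m W i *m Z ^+ (i - t).
have key : Y *m p' - p' *m Z = Y *m b'.
  have step (i : 'I_N) : Y *m (\sum_(0 <= t < i.+1) Y ^+ t *m W i *m Z ^+ (i - t)) -
      (\sum_(0 <= t < i.+1) Y ^+ t *m W i *m Z ^+ (i - t)) *m Z =
      Y ^+ i.+1 *m W i - W i *m Z ^+ i.+1.
    pose u t := Y ^+ t *m W i *m Z ^+ (i.+1 - t).
    have -> : Y ^+ i.+1 *m W i - W i *m Z ^+ i.+1 = u i.+1 - u 0%N.
      by rewrite /u subnn subn0 !expr0 mulmx1 mul1mx.
    rewrite -telescope_sumr // mulmx_sumr mulmx_suml -sumrB !big_mkord.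
    apply: eq_bigr => t _; rewrite /u subSS !mulmxA YX -[_ *m _ *m Z]mulmxA XY.
    by rewrite subSn // -ltnS.
  rewrite /p' mulmx_sumr mulmx_suml -sumrB; under eq_bigr => i _ do rewrite step.
  rewrite sumrB.
  have -> : \sum_(i < N) Y ^+ i.+1 *m W i = (Y - c *m Y ^+ N) *m b'.
    rewrite -[X in (X - _)]trace_rev big_ord_recl expr0 mul1mx subn0 addrC addKr mulmx_suml.
    apply: eq_bigr => i _; rewrite /W !mulmxA; congr (_ *m _ *m Y ^+ _ *m _).
    by rewrite /= /bump /=; lia.
  have -> : \sum_(i < N) W i *m Z ^+ i.+1 = - (c *m Y ^+ N *m b').
    have := congr1 (mulmx c) nv.
    rewrite mulmx0 /norm_val big_ord_recl subn0 expr0 mulmx1 mulmxDr mulmx_sumr mulmxA.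
    move=> /eqP; rewrite addrC addr_eq0 => /eqP <-; apply: eq_bigr => i _.
    by rewrite /W !mulmxA; congr (_ *m Y ^+ _ *m _ *m _); rewrite /= /bump /=; lia.
  by rewrite mulmxBl opprK subrK.
pose p := p' - b'.
have hp : Y *m p = p' *m Z by rewrite mulmxBr -key subKr.
have hp' : Y ^+ N *m p' = p *m Z ^+ N.
  apply: (mx_cancelB hZ); rewrite -mulmxA -hp mulmxA XY hY -mulmxA XY hZ.
  by rewrite mul_scalar_mx mul_mx_scalar.
exists (mk_hfac hp' hp); apply: hfac_inj; rewrite /fac1 /fac2 /= /fac1 /fac2 /=; last first.
  by rewrite subKr.
rewrite -/(fac1 x) -/b /dif_val.
have [N0|N0] := posnP N.
  have p0 : p' = 0.
    by rewrite /p' big1 // => i; case: i => i hi; exfalso; move: hi; rewrite N0.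
  have b0 : b = 0 by move: av; rewrite /aug_val big1 ?addr0 // => i; case: i => i hi; exfalso; move: hi; rewrite N0.
  have b0' : b' = 0 by move: h1; rewrite b0 N0 expr0 mul1mx mul0mx.
  by rewrite /p p0 b0 b0' subrr mul0mx mulmx0 subrr.
have e : N.-1.+1 = N by rewrite prednK.
apply: (mx_cancelB hZ); rewrite mulmxBl -!mulmxA XY e -hp -hp' mulmxA XY e -mulmxBr.
by rewrite /p subKr h1.
Qed.

Lemma dif_exact x : dif x = 0 -> exists z, per z = x.
Proof.
move=> dx; have [h1 h2] := hfacP x.
have e : fac1 x = fac2 x.
  by apply/esym/eqP; rewrite -subr_eq0; apply/eqP; exact: (congr1 (@fac2 _ _ _) dx).
rewrite e in h2; have [z hz] := aug_surj (mk_homm h2).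
have hz' : aug_val (fac1 z) (fac2 z) = fac2 x by exact: (congr1 val hz).
by exists z; apply: hfac_inj; rewrite ?e -hz'.
Qed.

Hypothesis hS : forall (P Q : 'M[S]_l), P *m Q = (- f)%:M -> Q *m P = (- f)%:M ->
  factor_summand Y P Q.

Lemma has_res_homm : has_res (homm Z).
Proof.
apply: (has_res_periodic aug_lin aug_surj dif_lin per_lin).
- by apply/hfac_projective/hS; [rewrite YX|rewrite XY]; exact: hZ.
- by apply/hfac_projective/hS; [rewrite XY|rewrite YX]; exact: hZ.
- by move=> x; split=> [|[z <-]]; [exact: aug_exact | exact: aug_dif].
- move=> x; split=> [|[z <-]]; first exact: dif_exact.
  apply: hfac_inj; last exact: subrr.
  rewrite /fac1 /= /fac1 /fac2 /= /dif_val (commX N.-1 (aug_comm z)); exact: subrr.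
move=> x; rewrite -[X in _ <-> X](_ : aug x = 0 <-> _).
  split=> h; first by apply: val_inj; exact: (congr1 (@fac2 _ _ _) h).
  by have h' := congr1 val h; apply: hfac_inj.
by split=> [|[z <-]]; [exact: aug_exact | exact: aug_dif].
Qed.

End PeriodicHom.

(* A pair (V, T) is an S-module with the action T of y. *)
Section HomToModule.
Variables (V : lmodType S) (T : V -> V).
Hypothesis lT : lin T.

Definition homV_map (v : cols V th) : cols V th := [ffun i => T (v i) - act Y v i].

Lemma homV_map_lin : lin homV_map.
Proof.
move=> a u v; apply/ffunP => i.
have colsD (x y : cols V th) : (a *: x + y) i = act (th a) x i + y i by rewrite ffunE.
rewrite colsD [LHS]ffunE colsD (linD lT) [homV_map v i]ffunE.
have -> : act Y (a *: u + v) i = act (th a) (act Y u) i + act Y v i.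
  by rewrite act_add ffunE -[a *: u]/(act (th a) u) -!act_mul thY.
rewrite opprD addrACA; congr (_ + _); rewrite 3!ffunE (lin_sum lT) -sumrB.
by apply: eq_bigr => j _; rewrite (linZ lT) [homV_map u j]ffunE scalerBr.
Qed.

(* Hom_A((S^k, Y), (V, T)) *)
Definition homV : lmodType L := lin_ker (lin_pack homV_map_lin).

Definition hval (x : homV) : cols V th := val x.

Lemma hval_lin : lin hval. Proof. by []. Qed.

Lemma homVP (x : homV) i : T (hval x i) = \sum_j Y i j *: hval x j.
Proof.
have /eqP/ffunP/(_ i) := valP x; rewrite ffunE [RHS]ffunE => /eqP.
by rewrite subr_eq0 => /eqP->; rewrite ffunE.
Qed.

Lemma homV_mem (v : cols V th) : (forall i, T (v i) = \sum_j Y i j *: v j) ->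
  v \in ker_pred (lin_pack homV_map_lin).
Proof. by move=> h; apply/eqP/ffunP => i; rewrite ffunE [RHS]ffunE ffunE h subrr. Qed.

Definition mk_homV (v : cols V th) (h : forall i, T (v i) = \sum_j Y i j *: v j) : homV :=
  exist _ v (homV_mem h).

Lemma hval_mk v h : hval (@mk_homV v h) = v. Proof. by []. Qed.

Lemma hval_linE a u v i :
  hval (a *: u + v) i = \sum_j th a i j *: hval u j + hval v i.
Proof. by rewrite hval_lin ffunE [in LHS]ffunE. Qed.

End HomToModule.

(** Scalar matrices give an action of S on X; since X embeds in a Noetherian S-module, it is
    finitely generated already over S. *)
Lemma finitely_generated (X : lmodType L) (F : lmodType S) (j : X -> F) :
  noeth F -> injective j -> (forall x y, j (x + y) = j x + j y) ->
  (forall a s x, th a = s%:M -> j (a *: x) = s *: j x) ->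
  exists b (z : 'I_b -> X), surj (freecomb z).
Proof.
move=> nF ij jD jZ.
have sc s : th (tinv s%:M) = s%:M by apply: tinvK; rewrite scalar_mxC.
have [|s hs] := nF (fun v => exists x, j x = v).
  split=> [|a u v [x <-] [y <-]].
    by exists 0; apply: (addrI (j 0)); rewrite -jD !addr0.
  by exists (tinv a%:M *: x + y); rewrite jD (jZ _ a).
have hz (i : 'I_(size s)) : exists x, j x = s`_i by apply/hs/mem_span/mem_nth.
have [z ez] := choice hz; exists (size s), z => x.
have /span_nthP[e he] : span s (j x) by apply/hs; exists x.
exists [ffun i => tinv (e i)%:M]; apply: ij; rewrite he /freecomb.
rewrite (big_morph j jD (id1 := 0)); last by apply: (addrI (j 0)); rewrite -jD !addr0.
by apply: eq_bigr => i _; rewrite ffunE (jZ _ (e i)) // ez.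
Qed.

(** * Syzygies of the form Hom(N, V) *)

Section SyzygyModule.
Variables (X : lmodType L) (b : nat) (z : 'I_b -> X).
Variables (V0 : lmodType S) (psi : 'M[S]_(b, k) -> V0).
Hypotheses (lpsi : lin psi) (psiY : forall B, psi B = 0 -> psi (B *m Y) = 0).

Definition syz : lmodType S := lin_ker (lin_pack lpsi).

Definition sval_mx (x : syz) : 'M[S]_(b, k) := val x.

Lemma sval_mx_lin : lin sval_mx. Proof. by []. Qed.

Lemma sval_mxP x : psi (sval_mx x) = 0. Proof. exact/eqP/(valP x). Qed.

Lemma syz_mem B : psi B = 0 -> B \in ker_pred (lin_pack lpsi).
Proof. by move=> h; apply/eqP. Qed.

Definition mk_syz B (h : psi B = 0) : syz := exist _ B (syz_mem h).

Definition syz_mul (x : syz) : syz := mk_syz (psiY (sval_mxP x)).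

Lemma syz_mulE x : sval_mx (syz_mul x) = sval_mx x *m Y. Proof. by []. Qed.

Lemma sval_mx_inj : injective sval_mx. Proof. exact: val_inj. Qed.

Lemma syz_mul_lin : lin syz_mul.
Proof. by move=> a u v; apply: val_inj; rewrite /= mulmxDl -scalemxAl. Qed.

Hypotheses (sz : surj (freecomb z))
  (hz : forall e : freemod L b, freecomb z e = 0 <->
    forall i, psi (\matrix_(j, i') th (e j) i i') = 0).

Local Notation H := (homV syz_mul_lin).

(** A map from N to the kernel, viewed in N^b, has b components; each commutes with y and so comes
    from L. *)
Definition syz_end (v : H) j : 'M[S]_k := \matrix_(i, i') sval_mx (hval v i) j i'.

Lemma sval_mx_comb (I : finType) (a : I -> S) (x : I -> syz) j i' :
  sval_mx (\sum_t a t *: x t) j i' = \sum_t a t * sval_mx (x t) j i'.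
Proof.
rewrite (lin_sum sval_mx_lin) summxE; apply: eq_bigr => t _.
by rewrite (linZ sval_mx_lin) mxE.
Qed.

Lemma syz_end_comm v j : Y *m syz_end v j = syz_end v j *m Y.
Proof.
apply/matrixP => i i'; have := congr1 (fun x => sval_mx x j i') (homVP v i).
rewrite syz_mulE sval_mx_comb !mxE => e; under [RHS]eq_bigr => s _ do rewrite mxE.
by rewrite e; apply: eq_bigr => t _; rewrite mxE.
Qed.

Definition syz_incl (v : H) : freemod L b := [ffun j => tinv (syz_end v j)].

Lemma syz_incl_lin : lin syz_incl.
Proof.
move=> a u v; apply/ffunP => j; rewrite !ffunE; apply: thI.
rewrite /GRing.scale /= rmorphD rmorphM !tinvK; [|exact: syz_end_comm..].
apply/matrixP => i i'; rewrite !mxE hval_linE (linD sval_mx_lin) mxE sval_mx_comb.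
by congr (_ + _); apply: eq_bigr => t _; rewrite !mxE.
Qed.

Lemma syz_incl_inj : injective syz_incl.
Proof.
move=> u v /ffunP e; apply/val_inj/ffunP => i; apply/sval_mx_inj/matrixP => j i'.
have := congr1 th (e j); rewrite !ffunE !tinvK; [|exact: syz_end_comm..].
by move=> /matrixP/(_ i i'); rewrite !mxE.
Qed.

Lemma has_res_syzygy : has_res H -> has_res X.
Proof.
apply: (has_res_splice (freecomb_lin z) sz (freemod_projective (b := b))
  syz_incl_lin syz_incl_inj).
move=> e; rewrite hz; split=> [h|[v <-] i]; last first.
  rewrite -[RHS](sval_mxP (hval v i)); congr psi; apply/matrixP => j i'.
  by rewrite mxE ffunE tinvK ?mxE //; exact: syz_end_comm.
pose v : cols syz th := [ffun i => mk_syz (h i)].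
have hv i : syz_mul (v i) = \sum_j Y i j *: v j.
  apply/sval_mx_inj/matrixP => j i'; rewrite sval_mx_comb syz_mulE mxE.
  have /matrixP/(_ i i') := thY (e j); rewrite !mxE => ei.
  have vE t s : sval_mx (v t) j s = th (e j) t s by rewrite ffunE mxE.
  under eq_bigr => s _ do rewrite vE.
  by rewrite -ei; apply: eq_bigr => t _; rewrite vE.
exists (mk_homV syz_mul_lin hv); apply/ffunP => j; apply: thI.
rewrite ffunE tinvK; last exact: syz_end_comm.
by apply/matrixP => i i'; rewrite mxE hval_mk ffunE mxE.
Qed.

End SyzygyModule.

Lemma mx_fin_gen_list q l : exists s : seq 'M[S]_(q, l), forall v, span s v.
Proof.
exists [seq delta_mx i j | i <- enum 'I_q, j <- enum 'I_l] => v.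
rewrite [v]matrix_sum_delta; apply: (submod_sum _ (span_submod _)) => i _.
apply: (submod_sum _ (span_submod _)) => j _; apply: submodZ; first exact: span_submod.
by apply: mem_span; apply: allpairs_f; rewrite mem_enum.
Qed.

Hypothesis nS : noeth S^o.

Lemma noeth_mx q l : noeth 'M[S]_(q, l).
Proof. by have [s /fg_span h] := mx_fin_gen_list q l; apply: noeth_fg. Qed.

Lemma noeth_ffun q (V : lmodType S) : fin_gen V -> noeth {ffun 'I_q -> V}.
Proof.
move=> /span_fg[s hs] W sW.
pose g (i : 'I_q) (u : V) : {ffun 'I_q -> V} := [ffun t => if t == i then u else 0].
have lg i : lin (g i).
  by move=> a u v; apply/ffunP => t; rewrite !ffunE; case: eqP; rewrite // scaler0 addr0.
apply: (noeth_span (s := [seq g i u | i <- enum 'I_q, u <- s]) nS sW) => v _.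
set s' := [seq _ | _ <- _, _ <- _]; have sp := span_submod s'.
have -> : v = \sum_i g i (v i).
  apply/ffunP => t; rewrite sum_ffunE (bigD1 t) //= ffunE eqxx big1 ?addr0 // => i ti.
  by rewrite ffunE eq_sym (negbTE ti).
apply: (submod_sum _ sp) => i _.
apply: (span_sub (W := fun u => span s' (g i u))) (hs (v i)) => [|u us].
  by split=> [|a u w hu hw]; [rewrite (lin0 (lg i)); case: sp | rewrite lg; apply: sp.2].
by apply: mem_span; apply: allpairs_f; rewrite ?mem_enum.
Qed.

Hypothesis hS : forall l (P Q : 'M[S]_l), P *m Q = (- f)%:M -> Q *m P = (- f)%:M ->
  factor_summand Y P Q.

Definition cover_action (V : lmodType S) (T : V -> V) : Prop :=
  forall v, iter N.+1 T v = - f *: v.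

Section Generation.
Variables (V : lmodType S) (T : V -> V).
Hypotheses (lT : lin T) (hT : cover_action T).

(* The free A-module A is a summand of a power of (S^k, Y), so V is covered by
   images of homomorphisms from (S^k, Y). *)
Lemma hom_cover (W : V -> Prop) : submod W ->
  (forall (x : homV lT) i, W (hval x i)) -> forall v, W v.
Proof.
move=> sW hW v.
(* For P = 1 and Q = -f the condition on z_0 is empty, so T(P) is A itself. *)
have [||r [a [a' [b [b' [h [s1 s2 _ _]]]]]]] := @hS 1 1%:M (- f)%:M.
- by rewrite mul1mx.
- by rewrite mulmx1.
have hb j : b j = Y ^+ N *m b' j by have [_ _ <- _] := h j; rewrite mulmx1.
(* The composite of the j-th map N -> A with A -> V, y^i |-> T^i v. *)
pose g j : cols V th := [ffun s => \sum_(i < N.+1) (Y ^+ (N - i) *m b' j) s 0 *: iter i T v].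
have hg j s : T (g j s) = \sum_t Y s t *: g j t.
  pose u i := (Y ^+ (N.+1 - i) *m b' j) s 0 *: iter i T v.
  have -> : T (g j s) = \sum_(i < N.+1) u i.+1.
    rewrite ffunE (lin_sum lT); apply: eq_bigr => i _.
    by rewrite (linZ lT) /u subSS.
  have -> : \sum_t Y s t *: g j t = \sum_(i < N.+1) u i.
    under eq_bigr => t _ do rewrite ffunE scaler_sumr.
    rewrite exchange_big; apply: eq_bigr => i _ /=.
    have -> : u i = (Y *m (Y ^+ (N - i) *m b' j)) s 0 *: iter i T v.
      by rewrite /u subSn ?exprS ?mulmxA // -ltnS.
    by rewrite mxE scaler_suml; apply: eq_bigr => t _; rewrite scalerA.
  have e : u 0%N = u N.+1.
    rewrite /u subnn subn0 expr0 mul1mx hY mul_scalar_mx hT !mxE /= scalerA.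
    by rewrite mulrC.
  rewrite big_ord_recr [RHS]big_ord_recl /= e addrC; congr (_ + _).
have hv : v = \sum_j \sum_s a j 0 s *: g j s.
  have -> : \sum_j \sum_s a j 0 s *: g j s =
      \sum_(i < N.+1) (\sum_j a j *m Y ^+ (N - i) *m b' j) 0 0 *: iter i T v.
    under eq_bigr => j _ do under eq_bigr => s _ do rewrite ffunE scaler_sumr.
    under eq_bigr => j _ do rewrite exchange_big.
    rewrite exchange_big; apply: eq_bigr => i _ /=; rewrite summxE scaler_suml.
    apply: eq_bigr => j _; rewrite -mulmxA mxE scaler_suml; apply: eq_bigr => s _.
    by rewrite scalerA.
  rewrite big_ord_recl [X in _ + X]big1 ?addr0 => [|i _].
    under eq_bigr => j _ do rewrite /= subn0 -mulmxA -hb.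
    by rewrite s1 mxE scale1r.
  rewrite s2 ?mxE ?scale0r //= /bump /=.
  have := ltn_ord i; lia.
rewrite hv; apply: (submod_sum _ sW) => j _; apply: (submod_sum _ sW) => s _.
by apply: submodZ => //; apply: (hW (mk_homV lT (hg j))).
Qed.

End Generation.

Lemma homV_free (V : lmodType S) (T : V -> V) (lT : lin T) l (nu : 'I_l -> V) :
  cover_action T -> basis nu -> has_res (homV lT).
Proof.
move=> hT [snu inu]; have ln := lincomb_lin nu.
have /choice[zr hzr] : forall i, exists c, lincomb nu c = T (nu i) by move=> i; exact: snu.
pose Z : 'M[S]_l := \matrix_(i, j) zr i 0 j.
have hZ d : lincomb nu (d *m Z) = T (lincomb nu d).
  rewrite [in RHS]/lincomb (lin_sum lT) mulmx_sum_row (lin_sum ln); apply: eq_bigr => i _.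
  rewrite (linZ ln) (linZ lT) -hzr; congr (_ *: lincomb nu _).
  by apply/rowP => j; rewrite !mxE.
have cZ : cover_mx Z.
  have it i d : lincomb nu (d *m Z ^+ i) = iter i T (lincomb nu d).
    by elim: i => [|i IH]; rewrite ?expr0 ?mulmx1 // exprSr mulmxA hZ IH.
  apply/row_matrixP => i; rewrite !rowE; apply: inu.
  by rewrite it hT -(linZ ln) mul_mx_scalar.
pose g0 (x : homm Z) : cols V th := [ffun i => lincomb nu (row i (val x : 'M[S]_(k, l)))].
have hg x i : T (g0 x i) = \sum_j Y i j *: g0 x j.
  rewrite ffunE -hZ -row_mul -hommP row_mul mulmx_sum_row (lin_sum ln).
  by apply: eq_bigr => j _; rewrite (linZ ln) mxE ffunE.
apply: (has_res_iso (X' := homm Z) (g := fun x => mk_homV lT (hg x))).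
- move=> a u v; apply/val_inj/ffunP => i.
  rewrite -/(hval _ i) -/(hval _ i) hval_linE !hval_mk [LHS]ffunE [in RHS]ffunE.
  have -> : row i (val (a *: u + v) : 'M[S]_(k, l)) =
      row i (th a *m (val u : 'M[S]_(k, l))) + row i (val v : 'M[S]_(k, l)).
    by apply/rowP => j; rewrite !mxE.
  rewrite (linD ln) row_mul mulmx_sum_row (lin_sum ln); congr (_ + _).
  by apply: eq_bigr => j _; rewrite (linZ ln) mxE ffunE.
- have inj : injective (fun x => mk_homV lT (hg x)).
    move=> x y e; apply: val_inj; apply/row_matrixP => i; apply: inu.
    by have /ffunP/(_ i) := congr1 (@hval _ _ _) e; rewrite !hval_mk !ffunE.
  have sur : surj (fun x => mk_homV lT (hg x)).
    move=> y; have /choice[d hd] : forall i, exists d, lincomb nu d = hval y i.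
      by move=> i; exact: snu.
    have hB : Y *m (\matrix_i d i) = (\matrix_i d i) *m Z.
      apply/row_matrixP => i; apply: inu; rewrite !row_mul rowK hZ hd homVP.
      rewrite mulmx_sum_row (lin_sum ln); apply: eq_bigr => j _.
      by rewrite (linZ ln) mxE rowK hd.
    exists (mk_homm hB); apply/val_inj/ffunP => i.
    by transitivity (g0 (mk_homm hB) i); rewrite // ffunE /= rowK hd.
  have [h hh] := choice sur; exists h => // x; apply: inj; exact: hh.
exact: has_res_homm cZ (@hS l).
Qed.

Lemma mx_basis q l : exists nu : 'I_(q * l) -> 'M[S]_(q, l), basis nu.
Proof.
exists (fun i => vec_mx (delta_mx 0 i)).
have e d : lincomb (fun i => vec_mx (delta_mx 0 i)) d = vec_mx d :> 'M[S]_(q, l).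
  rewrite [in RHS](row_sum_delta d) linear_sum; apply: eq_bigr => i _.
  by rewrite linearZ.
split=> [B|u v]; first by exists (mxvec B); rewrite e mxvecK.
by rewrite !e => /(can_inj vec_mxK).
Qed.

Variable gs : seq S.
Hypotheses (rgs : regseq (fun a : S^o => a = 0) gs)
  (free_gs : forall V : lmodType S, fin_gen V -> regseq (fun v : V => v = 0) gs ->
    exists l (nu : 'I_l -> V), basis nu).

(** Generators of Hom(N, V) give N^b -> V, onto by [hom_cover]; its kernel K gives the syzygy Hom(N,
    K), and by the depth lemma the next element of [gs] is regular on K. When [gs] is exhausted, V
    is free over S. *)
Lemma has_res_homV ys xs (V : lmodType S) (T : V -> V) (lT : lin T) :
  xs ++ ys = gs -> fin_gen V -> cover_action T -> regseq (fun v : V => v = 0) xs ->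
  has_res (homV lT).
Proof.
elim: ys xs V T lT => [|y ys IH] xs V T lT e fV hT hxs.
  have [|l [nu bnu]] := free_gs fV; first by rewrite -e cats0.
  exact: homV_free hT bnu.
have [|b [z sz]] := @finitely_generated (homV lT) {ffun 'I_k -> V} (fun x => hval x)
  (@noeth_ffun k V fV) val_inj (fun x y => erefl).
  move=> a s x ha; apply/ffunP => i; rewrite (linZ (@hval_lin _ _ lT)) !ffunE ha.
  rewrite (bigD1 i) //= mxE eqxx big1 ?addr0 // => j /negbTE ji.
  by rewrite mxE eq_sym ji scale0r.
pose psi (B : 'M[S]_(b, k)) : V := \sum_j \sum_s B j s *: hval (z j) s.
have lpsi : lin psi.
  move=> a u v; rewrite /psi scaler_sumr -big_split; apply: eq_bigr => j _.
  rewrite scaler_sumr -big_split; apply: eq_bigr => s _.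
  by rewrite !mxE scalerDl scalerA.
have psiYE B : psi (B *m Y) = T (psi B).
  rewrite /psi (lin_sum lT); apply: eq_bigr => j _; rewrite (lin_sum lT).
  under [RHS]eq_bigr => s _ do rewrite (linZ lT) homVP scaler_sumr.
  rewrite exchange_big; apply: eq_bigr => s _; rewrite mxE scaler_suml.
  by apply: eq_bigr => t _; rewrite scalerA.
have psiY B : psi B = 0 -> psi (B *m Y) = 0 by move=> h; rewrite psiYE h (lin0 lT).
have comb (d : freemod L b) i : hval (freecomb z d) i = psi (\matrix_(j, i') th (d j) i i').
  rewrite /freecomb (lin_sum (@hval_lin _ _ lT)) sum_ffunE; apply: eq_bigr => j _.
  rewrite (linZ (@hval_lin _ _ lT)) ffunE; apply: eq_bigr => s _; by rewrite mxE.
apply: (has_res_syzygy (lpsi := lpsi) (psiY := psiY) sz).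
  move=> d; split=> [h i|h]; first by rewrite -comb h ffunE.
  by apply/val_inj/ffunP => i; rewrite -/(hval _ i) comb h ffunE.
have spsi : surj psi.
  move=> v; apply: (hom_cover (lT := lT) hT (W := fun v => exists B, psi B = v)).
    split=> [|a u w [B <-] [C <-]]; first by exists 0; rewrite (lin0 lpsi).
    by exists (a *: B + C).
  move=> x i; have [d <-] := sz x.
  by exists (\matrix_(j, i') th (d j) i i'); rewrite comb.
have nM := @noeth_mx b k.
have nK : noeth (syz lpsi) := noeth_inj (@sval_mx_lin _ _ _ lpsi) (@sval_mx_inj _ _ _ lpsi) nM.
apply: (IH (rcons xs y)).
- by rewrite cat_rcons.
- by have [s hs] := nK _ (@submodT S _); apply: (fg_span (s := s)) => v; apply/hs.
- move=> v; apply: sval_mx_inj; rewrite (linZ (@sval_mx_lin _ _ _ lpsi)).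
  have it i : sval_mx (iter i (syz_mul (lpsi := lpsi) psiY) v) = sval_mx v *m Y ^+ i.
    by elim: i => [|i IHi]; rewrite ?expr0 ?mulmx1 //= syz_mulE IHi -mulmxA XY.
  by rewrite it hY mul_mx_scalar.
have [nu bnu] := mx_basis b k.
have rM : regseq (fun v : 'M[S]_(b, k) => v = 0) (rcons xs y).
  apply: (regseq_free_module bnu); move: rgs; rewrite -e -cat_rcons.
  by case/regseq_cat.
apply: (ses_regseq (@sval_mx_lin _ _ _ lpsi) lpsi spsi _ hxs rM).
split; try exact: submod_zero.
  by move=> x; split=> [h|->]; [exact: sval_mx_inj | exact: lin0 (@sval_mx_lin _ _ _ lpsi)].
move=> B; split=> [h|[x /eqP]].
  by exists (mk_syz lpsi h); rewrite subrr.
by rewrite subr_eq0 => /eqP->; exact: sval_mxP.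
Qed.

(** The first syzygy lies in a free module L^b0. The kernel of L^b -> L^b0 is Hom(N, V) for V the
    kernel of N^b -> N^b0, so from the second syzygy on only modules of this form occur. *)
Theorem centraliser_has_res (X : lmodType L) : fin_gen X -> has_res X.
Proof.
move=> [b0 [z0 hz0]].
have sz0 : surj (freecomb z0).
  by move=> x; have [d ->] := hz0 x; exists [ffun i => d i]; apply: eq_bigr => i _; rewrite ffunE.
pose K0 := lin_ker (lin_pack (freecomb_lin z0)).
pose kv (x : K0) : freemod L b0 := val x.
have lkv : lin kv by [].
apply: (has_res_splice (K := K0) (j := kv) (freecomb_lin z0) sz0 (freemod_projective (b := b0)) lkv val_inj).
  move=> x; split=> [h|[y <-]]; last by apply/eqP: (valP y).
  by exists (exist _ x (introT eqP h)).
have [] := @finitely_generated K0 {ffun 'I_b0 -> 'M[S]_k} (fun x => [ffun j => th (kv x j)]).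
- by apply: noeth_ffun; have [s /fg_span] := mx_fin_gen_list k k.
- move=> x y /ffunP h; apply/val_inj/ffunP => j; apply: thI.
  by have := h j; rewrite !ffunE.
- by move=> x y; apply/ffunP => j; rewrite !ffunE rmorphD.
- move=> a s x ha; apply/ffunP => j; rewrite !ffunE rmorphM ha.
  exact: mul_scalar_mx.
move=> b [z sz].
pose psi (B : 'M[S]_(b, k)) : 'M[S]_(b0, k) := \matrix_j0 \sum_j row j B *m th (kv (z j) j0).
have rowlin q l (i : 'I_q) : lin (fun B : 'M[S]_(q, l) => row i B).
  by move=> a u v; apply/rowP => j; rewrite !mxE.
have lpsi : lin psi.
  move=> a u v; apply/row_matrixP => j0; rewrite rowlin !rowK scaler_sumr -big_split.
  by apply: eq_bigr => j _; rewrite rowlin mulmxDl scalemxAl.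
have psiY B : psi B = 0 -> psi (B *m Y) = 0.
  move=> h; suff -> : psi (B *m Y) = psi B *m Y by rewrite h mul0mx.
  apply/row_matrixP => j0; rewrite row_mul !rowK mulmx_suml; apply: eq_bigr => j _.
  by rewrite row_mul -!mulmxA thY.
apply: (has_res_syzygy (lpsi := lpsi) (psiY := psiY) sz).
  have comb (d : freemod L b) j0 : th (kv (freecomb z d) j0) =
      \matrix_i row j0 (psi (\matrix_(j, i') th (d j) i i')).
    apply/row_matrixP => i; rewrite !rowK /freecomb (lin_sum lkv) sum_ffunE rmorph_sum.
    rewrite (lin_sum (rowlin _ _ i)).
    apply: eq_bigr => j _; rewrite (linZ lkv) ffunE rmorphM row_mul; congr (_ *m _).
    by apply/rowP => s; rewrite !mxE.
  move=> d; split=> h.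
    move=> i; apply/row_matrixP => j0; rewrite (lin0 (rowlin _ _ _)).
    have /(congr1 (row i)) := comb d j0; rewrite rowK => <-.
    by rewrite h ffunE rmorph0 (lin0 (rowlin _ _ _)).
  apply/val_inj/ffunP => j0; apply: thI; rewrite -/(kv _) comb ffunE rmorph0.
  by apply/row_matrixP => i; rewrite rowK h !(lin0 (rowlin _ _ _)).
apply: (has_res_homV (xs := [::])) => //.
- have nK : noeth (syz lpsi) := noeth_inj (@sval_mx_lin _ _ _ lpsi) (@sval_mx_inj _ _ _ lpsi) (@noeth_mx b k).
  by have [s hs] := nK _ (@submodT S _); apply: (fg_span (s := s)) => v; apply/hs.
move=> v; apply: sval_mx_inj; rewrite (linZ (@sval_mx_lin _ _ _ lpsi)).
have it i : sval_mx (iter i (syz_mul (lpsi := lpsi) psiY) v) = sval_mx v *m Y ^+ i.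
  by elim: i => [|i IHi]; rewrite ?expr0 ?mulmx1 //= syz_mulE IHi -mulmxA XY.
by rewrite it hY mul_mx_scalar.
Qed.

End MatrixFactorization.

(** * The branched cover as a free module *)

Section PrincipalQuotientMap.
Variables (A : comNzRingType) (a : A) (ha : ~ unit_elt a).
Local Notation Q := (principal_quot ha).

Definition quot_pi (x : A) : Q := \pi_{ideal_quot (principal_ideal ha)}%qT x.

Lemma quot_piE x y : quot_pi x = quot_pi y <-> exists b, x - y = b * a.
Proof.
rewrite /quot_pi; split=> [/eqP|[b e]].
  by rewrite -Quotient.idealrBE => /asboolP.
by apply/eqP; rewrite -Quotient.idealrBE; apply/asboolP; exists b.
Qed.

Lemma quot_pi_surj : surj quot_pi.
Proof. by move=> x; exists (repr x); rewrite /quot_pi reprK. Qed.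

Fact quot_pi_zmod : zmod_morphism quot_pi.
Proof. by move=> x y; rewrite /quot_pi rmorphB. Qed.
Fact quot_pi_monoid : monoid_morphism quot_pi.
Proof. by split=> [|x y]; rewrite /quot_pi ?rmorph1 ?rmorphM. Qed.
HB.instance Definition _ := GRing.isZmodMorphism.Build A Q quot_pi quot_pi_zmod.
HB.instance Definition _ := GRing.isMonoidMorphism.Build A Q quot_pi quot_pi_monoid.

Lemma quot_pi_eq0 x : quot_pi x = 0 <-> exists b, x = b * a.
Proof.
by rewrite -(rmorph0 quot_pi) quot_piE; split=> -[b e]; exists b; rewrite -e subr0.
Qed.

End PrincipalQuotientMap.

Section Cover.
Variables (S : comNzRingType) (f : S) (hf : ~ unit_elt f) (N : nat) (hn : (0 < N.+1)%N).
Local Notation A := (branched_cover hf hn).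
Local Notation R := (principal_quot hf).

Definition cover_pi (g : {poly S}) : A := quot_pi (branched_cover_nonunit hf hn) g.

HB.instance Definition _ := GRing.RMorphism.copy cover_pi
  (quot_pi (branched_cover_nonunit hf hn)).

Definition iota (s : S) : A := cover_pi s%:P.

Fact iota_zmod : zmod_morphism iota.
Proof. by move=> s t; rewrite /iota polyCB rmorphB. Qed.
Fact iota_monoid : monoid_morphism iota.
Proof. by split=> [|s t]; rewrite /iota ?rmorph1 // polyCM rmorphM. Qed.
HB.instance Definition _ := GRing.isZmodMorphism.Build S A iota iota_zmod.
HB.instance Definition _ := GRing.isMonoidMorphism.Build S A iota iota_monoid.

Definition yv : A := cover_pi 'X.

Lemma yvX : yv ^+ N.+1 = - iota f.
Proof.
apply/eqP; rewrite -addr_eq0 /yv -rmorphXn -rmorphD; apply/eqP.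
by apply/quot_pi_eq0; exists 1; rewrite mul1r addrC.
Qed.

Lemma cover_proj_iota s : cover_proj hf hn (iota s) = quot_pi hf s.
Proof. by rewrite cover_projE hornerC. Qed.

Lemma cover_proj_yv : cover_proj hf hn yv = 0.
Proof. by rewrite cover_projE hornerX; exact: (rmorph0 (quot_pi hf)). Qed.

Local Notation w := (f%:P + 'X^(N.+1) : {poly S}).

Lemma size_cover_poly : size w = N.+2.
Proof. by rewrite addrC size_polyDl size_polyXn // (leq_ltn_trans (size_polyC_leq1 _)). Qed.

Lemma cover_poly_monic : w \is monic.
Proof.
rewrite addrC monicE lead_coefDl ?lead_coefXn // size_polyXn.
exact: leq_ltn_trans (size_polyC_leq1 _) _.
Qed.

Lemma cover_basis (a : A) :
  exists c : 'rV[S]_N.+1, a = \sum_i iota (c 0 i) * yv ^+ i.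
Proof.
have [g <-] := quot_pi_surj a.
have mw := cover_poly_monic; have w0 := monic_neq0 mw.
pose h := Pdiv.Ring.rmodp g w.
have sh : (size h <= N.+1)%N by rewrite -ltnS -size_cover_poly; exact: Pdiv.Ring.ltn_rmodpN0.
have e : quot_pi (branched_cover_nonunit hf hn) g = cover_pi h.
  apply/quot_piE; exists (Pdiv.Ring.rdivp g w).
  by rewrite {1}(Pdiv.RingMonic.rdivp_eq mw g) addrK.
exists (\row_i h`_i); rewrite e.
have {1}-> : h = \sum_(i < N.+1) (h`_i)%:P * 'X^i.
  rewrite -[LHS]coefK; apply: etrans (poly_def _ _) _.
  rewrite (big_ord_widen _ (fun i => h`_i *: 'X^i) sh) big_mkcond.
  apply: eq_bigr => i _; rewrite mul_polyC; case: ltnP => // hi.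
  by rewrite (nth_default _ hi) scale0r.
rewrite rmorph_sum; apply: eq_bigr => i _ /=.
by rewrite mxE rmorphM rmorphXn.
Qed.

Lemma cover_free (c : 'rV[S]_N.+1) : \sum_i iota (c 0 i) * yv ^+ i = 0 -> c = 0.
Proof.
pose h : {poly S} := \poly_(i < N.+1) c 0 (inord i).
have sh : (size h <= N.+1)%N by exact: size_poly.
have -> : \sum_i iota (c 0 i) * yv ^+ i = cover_pi h.
  rewrite /h poly_def rmorph_sum; apply: eq_bigr => i _ /=.
  by rewrite inord_val -mul_polyC rmorphM rmorphXn.
move=> /quot_pi_eq0[b e]; have [b0|b0] := eqVneq b 0.
  apply/rowP => i; have := congr1 (fun q : {poly S} => q`_i) e.
  by rewrite b0 mul0r coef0 coef_poly ltn_ord inord_val mxE.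
have : size (b * w) = (size b + size w).-1 by by apply: size_Mmonic => //; exact: cover_poly_monic.
rewrite -e size_cover_poly; move: sh; have := size_poly_gt0 b; rewrite b0; lia.
Qed.

Definition coefs_ex (a : A) := cid (cover_basis a).
Definition coefs (a : A) : 'rV[S]_N.+1 := sval (coefs_ex a).

Lemma coefsK a : \sum_i iota (coefs a 0 i) * yv ^+ i = a.
Proof. by rewrite /coefs; case: (coefs_ex a). Qed.

Lemma coefs_unique (a : A) (c : 'rV[S]_N.+1) : a = \sum_i iota (c 0 i) * yv ^+ i -> coefs a = c.
Proof.
move=> e; apply/eqP; rewrite -subr_eq0; apply/eqP/cover_free.
transitivity (\sum_i iota (coefs a 0 i) * yv ^+ i - \sum_i iota (c 0 i) * yv ^+ i).
  by rewrite -sumrB; apply: eq_bigr => i _; rewrite !mxE rmorphB mulrBl.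
by rewrite coefsK -e subrr.
Qed.

Lemma coefs_lin s a b : coefs (iota s * a + b) = s *: coefs a + coefs b.
Proof.
apply: coefs_unique; rewrite -{1}[a]coefsK -{1}[b]coefsK mulr_sumr -big_split.
by apply: eq_bigr => i _; rewrite !mxE rmorphD rmorphM mulrDl mulrA.
Qed.

Lemma coefs_yX i (hi : (i < N.+1)%N) : coefs (yv ^+ i) = delta_mx 0 (Ordinal hi).
Proof.
apply: coefs_unique; rewrite (bigD1 (Ordinal hi)) //= mxE !eqxx rmorph1 mul1r big1 ?addr0 //.
by move=> j /negbTE ji; rewrite mxE ji andbF rmorph0 mul0r.
Qed.

Lemma coefs_mul_y a : coefs (yv * a) =
  \row_(i < N.+1) (if i : nat is j.+1 then coefs a 0 (inord j) else - f * coefs a 0 ord_max).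
Proof.
apply: coefs_unique; rewrite -{1}[a]coefsK mulr_sumr big_ord_recr [RHS]big_ord_recl /= addrC.
congr (_ + _).
  by rewrite mxE expr0 mulr1 mulrCA -exprS yvX rmorphM rmorphN mulrC.
apply: eq_bigr => i _; rewrite mxE /= mulrCA -exprS; congr (iota (coefs a 0 _) * _).
by apply: val_inj; rewrite /= inordK //; have := ltn_ord i; rewrite /bump /=; lia.
Qed.

Lemma cover_proj_coefs a : cover_proj hf hn a = quot_pi hf (coefs a 0 0).
Proof.
rewrite -{1}[a]coefsK rmorph_sum big_ord_recl big1 ?addr0 => [|i _].
  by rewrite expr0 mulr1; exact: cover_proj_iota.
by rewrite /= exprS rmorphM rmorphM /= cover_proj_yv mul0r mulr0.
Qed.

Lemma cover_proj_eq0 a : cover_proj hf hn a = 0 <-> exists b, a = yv * b.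
Proof.
split=> [|[b ->]]; last by rewrite rmorphM /= cover_proj_yv mul0r.
rewrite cover_proj_coefs => /quot_pi_eq0[s e].
(* As f = -y^(N+1), the constant coefficient sf is y times -y^N s. *)
exists (- yv ^+ N * iota s + \sum_(i < N) iota (coefs a 0 (lift ord0 i)) * yv ^+ i).
rewrite -{1}[a]coefsK big_ord_recl e expr0 mulr1 mulrDr; congr (_ + _).
  by rewrite mulrA mulrN -exprS yvX opprK rmorphM mulrC.
by rewrite mulr_sumr; apply: eq_bigr => i _; rewrite mulrCA -exprS.
Qed.

End Cover.

(** * The syzygy as a module over the branched cover *)

Lemma in_add_retract (B : comNzRingType) (M U : lmodType B) : in_add M U ->
  exists k (i : 'I_k -> U -> M) (j : 'I_k -> M -> U),
  [/\ forall t, lin (i t), forall t, lin (j t) & forall x, \sum_t j t (i t x) = x].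
Proof.
move=> [k [V [g [h gK hK]]]].
have lh : lin h.
  by move=> a u v; apply: (can_inj gK); rewrite linearP !hK.
exists k, (fun t x => g (x, 0) t), (fun t x => (h [ffun s => if s == t then x else 0]).1).
split=> [t a u v|t a u v|x].
- have -> : (a *: u + v, 0) = a *: (u, 0) + (v, 0) :> (U * V)%type.
    by congr pair; rewrite /= ?scaler0 ?addr0.
  by rewrite linearP !ffunE.
- have -> : [ffun s => if s == t then a *: u + v else 0] =
      a *: [ffun s => if s == t then u else 0] + [ffun s => if s == t then v else 0] :> {ffun 'I_k -> M}.
    by apply/ffunP => s; rewrite !ffunE; case: eqP; rewrite ?scaler0 ?addr0.
  by rewrite lh.
have lfst : lin (fst : (U * V)%type -> U) by [].
rewrite -(lin_sum lfst) -(lin_sum lh).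
have -> : \sum_t [ffun s => if s == t then g (x, 0) t else 0] = g (x, 0).
  apply/ffunP => s; rewrite sum_ffunE (bigD1 s) //= ffunE eqxx big1 ?addr0 // => t ts.
  by rewrite ffunE eq_sym (negbTE ts).
by rewrite gK.
Qed.

Section CoverCoefficients.
Variables (S : comNzRingType) (f : S) (hf : ~ unit_elt f) (N : nat) (hn : (0 < N.+1)%N).
Local Notation A := (branched_cover hf hn).
Local Notation R := (principal_quot hf).
Local Notation io := (iota hf hn).
Local Notation y := (yv hf hn).
Local Notation proj := (cover_proj hf hn).

Definition co (i : nat) (a : A) : S := coefs a 0 (inord i).

Lemma co_lin i s a b : co i (io s * a + b) = s * co i a + co i b.
Proof. by rewrite /co coefs_lin !mxE. Qed.

Lemma co0 i : co i 0 = 0.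
Proof.
have := co_lin i 1 0 0; rewrite rmorph1 !mul1r addr0 => e.
by apply: (addrI (co i 0)); rewrite -e addr0.
Qed.

Lemma coZ i s a : co i (io s * a) = s * co i a.
Proof. by have := co_lin i s a 0; rewrite co0 !addr0. Qed.

Lemma co_yX i j : (i <= N)%N -> (j <= N)%N -> co i (y ^+ j) = (i == j)%:R.
Proof.
move=> iN jN; rewrite /co (coefs_yX hf hn (jN : (j < N.+1)%N)) mxE eqxx andTb.
by rewrite -val_eqE /= inordK.
Qed.

Lemma co_y0 a : co 0 (y * a) = - f * co N a.
Proof.
rewrite /co coefs_mul_y mxE inordK //; congr (_ * coefs a 0 _).
by apply: val_inj; rewrite /= inordK.
Qed.

Lemma co_yS i a : (i < N)%N -> co i.+1 (y * a) = co i a.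
Proof. by move=> iN; rewrite /co coefs_mul_y mxE inordK. Qed.

Lemma co_shift j i a : (i + j <= N)%N -> co (i + j) (y ^+ j * a) = co i a.
Proof.
elim: j => [|j IH] h; first by rewrite addn0 expr0 mul1r.
by rewrite addnS exprS -mulrA co_yS ?IH //; lia.
Qed.

Lemma coE a : a = \sum_(i < N.+1) io (co i a) * y ^+ i.
Proof.
rewrite -{1}[a]coefsK; apply: eq_bigr => i _; congr (io (coefs a 0 _) * _).
by apply: val_inj; rewrite /= inordK.
Qed.

Lemma proj_co a : proj a = quot_pi hf (co 0 a).
Proof.
rewrite cover_proj_coefs /co; congr (quot_pi hf (coefs a 0 _)).
by apply: val_inj; rewrite /= inordK.
Qed.

Definition vco l i (z : 'rV[A]_l) : 'rV[S]_l := map_mx (co i) z.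
Definition emb l (x : 'rV[S]_l) : 'rV[A]_l := map_mx io x.

Lemma vco_lin l i s (z w : 'rV[A]_l) : vco i (io s *: z + w) = s *: vco i z + vco i w.
Proof. by apply/rowP => j; rewrite !mxE co_lin. Qed.

Lemma emb_lin l s (x w : 'rV[S]_l) : emb (s *: x + w) = io s *: emb x + emb w.
Proof. by apply/rowP => j; rewrite !mxE rmorphD rmorphM. Qed.

Lemma vco_y_emb l i j (x : 'rV[S]_l) : (i <= N)%N -> (j <= N)%N ->
  vco i (y ^+ j *: emb x) = (i == j)%:R *: x.
Proof.
by move=> iN jN; apply/rowP => t; rewrite !mxE mulrC coZ co_yX // mulrC.
Qed.

Lemma vco_emb l (x : 'rV[S]_l) : vco 0 (emb x) = x.
Proof. by have := vco_y_emb x (leq0n N) (leq0n N); rewrite expr0 !scale1r. Qed.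

Lemma vco_y0 l (z : 'rV[A]_l) : vco 0 (y *: z) = - f *: vco N z.
Proof. by apply/rowP => t; rewrite !mxE co_y0. Qed.

Lemma vco_shift l j i (z : 'rV[A]_l) : (i + j <= N)%N -> vco (i + j) (y ^+ j *: z) = vco i z.
Proof. by move=> h; apply/rowP => t; rewrite !mxE co_shift. Qed.

Lemma vcoE l (z : 'rV[A]_l) : z = \sum_(i < N.+1) y ^+ i *: emb (vco i z).
Proof.
apply/rowP => t; rewrite [LHS]coE summxE; apply: eq_bigr => i _.
by rewrite !mxE mulrC.
Qed.

Hypothesis fS : forall a : S, f * a = 0 -> a = 0.

Lemma y_inj a : y * a = 0 -> a = 0.
Proof.
move=> h; rewrite [a]coE big1 // => i _; suff -> : co i a = 0 by rewrite rmorph0 mul0r.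
have := ltn_ord i; rewrite ltnS leq_eqVlt => /orP[/eqP->|iN].
  by apply: fS; apply: oppr_inj; rewrite -mulNr -co_y0 h co0 oppr0.
by rewrite -co_yS // h co0.
Qed.

End CoverCoefficients.

Section EndomorphismRingFacts.
Variables (B : comPzRingType) (U : lmodType B).
Implicit Types g h : end_ring U.

Definition fun_of_end g : U -> U := (g : {linear U -> U}).

Lemma end_lin g : lin (fun_of_end g). Proof. exact: lin_bundled. Qed.
Lemma fun_of_endZ g a v : fun_of_end g (a *: v) = a *: fun_of_end g v.
Proof. exact: linZ (end_lin g) _ _. Qed.
Lemma fun_of_endB g h v : fun_of_end (g - h) v = fun_of_end g v - fun_of_end h v.
Proof. by []. Qed.
Lemma fun_of_end1 v : fun_of_end 1 v = v. Proof. by []. Qed.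
Lemma fun_of_endM g h v : fun_of_end (g * h) v = fun_of_end h (fun_of_end g v).
Proof. by []. Qed.

Lemma fun_of_end_inj g h : (forall v, fun_of_end g v = fun_of_end h v) -> g = h.
Proof. by move=> e; apply: end_ringP => v; exact: e. Qed.

End EndomorphismRingFacts.

Section Syzygy.
Variables (S : comNzRingType) (f : S) (hf : ~ unit_elt f) (N : nat) (hn : (0 < N.+1)%N).
Local Notation A := (branched_cover hf hn).
Local Notation R := (principal_quot hf).
Local Notation io := (iota hf hn).
Local Notation y := (yv hf hn).
Local Notation proj := (cover_proj hf hn).
Local Notation pi := (quot_pi hf).
Hypothesis fS : forall a : S, f * a = 0 -> a = 0.
Variables (m : S -> Prop).
Hypotheses (nS : noeth S^o) (pm : is_prime m) (um : forall a, ~ m a -> unit_elt a) (mf : m f).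

Lemma cover_noeth : noeth (restrict_scalars (io : {rmorphism S -> A}) A^o).
Proof.
apply: noeth_fg => //; exists N.+1, (fun i => y ^+ i) => a.
by exists (coefs a 0); rewrite -[LHS]coefsK.
Qed.

(** Nakayama for A as a finite S-module: 1 + fb generates the unit ideal modulo m. *)
Lemma cover_unit (b : A) : exists c, c * (1 + io f * b) = 1.
Proof.
pose V := restrict_scalars (io : {rmorphism S -> A}) A^o.
pose W (a : V) := exists c : A, c * (1 + io f * b) = a.
have sW : submod W.
  split=> [|a u v [c <-] [d <-]]; first by exists 0; rewrite mul0r.
  exists (io a * c + d); rewrite mulrDl; congr (_ + _); exact: esym (mulrA _ _ _).
have [s hs] := cover_noeth (submodT V).
apply: (nakayama pm um cover_noeth (submodT V) sW) (1 : A) I => v _.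
exists (v * (1 + io f * b)); first by exists v.
exists s; split=> //.
have -> : v - v * (1 + io f * b) = f *: (- (v * b) : V).
  rewrite mulrDr mulr1 opprD addrA subrr add0r.
  by rewrite [RHS](_ : _ = io f * (- (v * b))) // mulrN mulrCA.
by apply: span_in_scale => //; [exact: prime_ideal_of|exact/hs].
Qed.

(** A geometric series reduces the claim to 1 - (yc)^(N+1) = 1 + f c^(N+1). *)
Lemma cover_unit_y (c : A) : exists u, u * (1 - y * c) = 1.
Proof.
have e : 1 - (y * c) ^+ N.+1 = 1 + io f * (c ^+ N.+1).
  by rewrite exprMn yvX mulNr opprK.
have [u' hu'] := cover_unit (c ^+ N.+1).
exists (u' * \sum_(i < N.+1) (y * c) ^+ i).
rewrite -mulrA [_ * (1 - _)]mulrC -[X in X - _]/(1) -opprB mulNr -subrX1.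
by rewrite -[RHS]hu' -e -[in RHS]opprB.
Qed.

Variables (M : lmodType R) (r : nat).
Variable p : {linear 'rV[A]_r -> restrict_scalars proj M}.
Hypothesis sp : surj p.

Definition semilin l (E : lmodType R) (q : 'rV[A]_l -> E) : Prop :=
  forall a z w, q (a *: z + w) = proj a *: q z + q w.

Definition pM (v : 'rV[A]_r) : M := p v.

Lemma pM_semilin : semilin pM.
Proof. by move=> a z w; rewrite /pM linearP. Qed.

Lemma semilin_sum l (E : lmodType R) (q : 'rV[A]_l -> E) I (s : seq I) (a : I -> A) z :
  semilin q -> q (\sum_(i <- s) a i *: z i) = \sum_(i <- s) proj (a i) *: q (z i).
Proof.
move=> hq; elim: s => [|i s IH]; last by rewrite !big_cons hq IH.
rewrite !big_nil; have := hq 1 0 0; rewrite rmorph1 !scale1r addr0 => e.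
by apply: (addrI (q 0)); rewrite -e addr0.
Qed.

Lemma semilin_lift l l' (E : lmodType R) (q : 'rV[A]_l -> E) (h : 'rV[A]_l' -> E) :
  semilin q -> surj q -> semilin h ->
  exists2 L : 'rV[A]_l' -> 'rV[A]_l, lin L & forall z, q (L z) = h z.
Proof.
move=> hq sq hh.
have /choice[u hu] : forall i : 'I_l', exists u, q u = h (delta_mx 0 i) by move=> i; exact: sq.
exists (lincomb u) => [|z]; first exact: lincomb_lin.
rewrite /lincomb semilin_sum // [z in RHS]row_sum_delta semilin_sum //.
by apply: eq_bigr => i _; rewrite hu.
Qed.

Section FactorModule.
Variables (l : nat) (P Q : 'M[S]_l).
Hypotheses (PQ : P *m Q = (- f)%:M) (QP : Q *m P = (- f)%:M).

Definition factor_bar (x : 'rV[R]_l) : 'rV[R]_l := x *m map_mx pi P.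

Lemma factor_bar_lin : lin factor_bar.
Proof. by move=> a u v; rewrite /factor_bar mulmxDl -scalemxAl. Qed.

(* The R-module coker Q, embedded in R^l as the kernel of P = image of Q. *)
Definition factor_mod : lmodType R := lin_ker (lin_pack factor_bar_lin).

Definition inT (z : 'rV[A]_l) : Prop := exists w, vco 0 z = w *m P.

Definition pi_row l' (x : 'rV[S]_l') : 'rV[R]_l' := map_mx pi x.

Lemma pi_row_mul l' (x : 'rV[S]_l) (B : 'M[S]_(l, l')) : pi_row (x *m B) = pi_row x *m map_mx pi B.
Proof. by rewrite /pi_row map_mxM. Qed.

Lemma pi_row_eq0 l' (x : 'rV[S]_l') : pi_row x = 0 <-> exists w, x = f *: w.
Proof.
split=> [/rowP h|[w ->]]; last first.
  apply/rowP => i; rewrite !mxE; apply/quot_pi_eq0; exists (w 0 i); exact: mulrC.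
have /choice[w hw] : forall i, exists b, x 0 i = b * f.
  by move=> i; apply/(quot_pi_eq0 hf); have := h i; rewrite !mxE.
by exists (\row_i w i); apply/rowP => i; rewrite !mxE hw mulrC.
Qed.

Lemma pi_row_surj l' (x : 'rV[R]_l') : exists u : 'rV[S]_l', pi_row u = x.
Proof.
have /choice[u hu] : forall i, exists b, pi b = x 0 i by move=> i; exact: quot_pi_surj.
by exists (\row_i u i); apply/rowP => i; rewrite !mxE.
Qed.

Lemma mulP_inj l' (X : 'M[S]_(l', l)) : X *m P = 0 -> X = 0.
Proof.
move=> XP; have : X *m P *m Q = 0 by rewrite XP mul0mx.
rewrite -mulmxA PQ mul_mx_scalar => /matrixP h; apply/matrixP => i j.
by rewrite mxE; apply: fS; apply: oppr_inj; have := h i j; rewrite !mxE mulNr oppr0.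
Qed.

Lemma mulQ_sub_f (u : 'rV[S]_l) : (exists w, u *m Q = f *: w) <-> exists w, u = w *m P.
Proof.
split=> [[w e]|[w ->]]; last by exists (- w); rewrite -mulmxA PQ mul_mx_scalar scaleNr scalerN.
exists (- w); apply/eqP; rewrite mulNmx -addr_eq0; apply/eqP.
have h : (u + w *m P) *m Q = 0.
  by rewrite mulmxDl e -mulmxA PQ mul_mx_scalar scaleNr subrr.
have : (u + w *m P) *m Q *m P = 0 by rewrite h mul0mx.
rewrite -mulmxA QP mul_mx_scalar => /rowP h'; apply/rowP => i.
by rewrite [RHS]mxE; apply: fS; apply: oppr_inj; have := h' i; rewrite !mxE mulNr oppr0.
Qed.

Lemma factor_q_mem (z : 'rV[A]_l) :
  pi_row (vco 0 z *m Q) \in ker_pred (lin_pack factor_bar_lin).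
Proof.
apply/eqP; rewrite /= /factor_bar -pi_row_mul -mulmxA QP; apply/pi_row_eq0.
by exists (- vco 0 z); rewrite mul_mx_scalar scaleNr scalerN.
Qed.

(** Multiplication by [Q] identifies S^l modulo the image of [P] with [factor_mod], so the kernel of
    this map on A^l is T(P). *)
Definition factor_q (z : 'rV[A]_l) : factor_mod :=
  exist _ (pi_row (vco 0 z *m Q)) (factor_q_mem z).

Lemma factor_q_semilin : semilin factor_q.
Proof.
move=> a z w; apply: val_inj; rewrite /=.
have -> : pi_row (vco 0 (a *: z + w) *m Q) =
    proj a *: pi_row (vco 0 z *m Q) + pi_row (vco 0 w *m Q); last by [].
have e : pi_row (vco 0 (a *: z + w)) = proj a *: pi_row (vco 0 z) + pi_row (vco 0 w).
  by apply/rowP => i; rewrite !mxE -!proj_co rmorphD rmorphM.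
by rewrite !pi_row_mul e mulmxDl scalemxAl.
Qed.

Lemma factor_q_surj : surj factor_q.
Proof.
move=> x; have [u hu] := pi_row_surj (val x).
have /eqP := valP x; rewrite /= /factor_bar -hu -pi_row_mul => /pi_row_eq0[w e].
exists (emb hf hn (- w)); apply: val_inj; rewrite /= vco_emb -hu.
congr pi_row; apply/eqP; rewrite -subr_eq0; apply/eqP/mulP_inj.
by rewrite mulmxBl e mulNmx mulNmx -mulmxA QP mul_mx_scalar scaleNr opprK subrr.
Qed.

Lemma factor_q_eq0 z : factor_q z = 0 <-> inT z.
Proof.
rewrite /inT -mulQ_sub_f -pi_row_eq0; split=> [h|h]; first exact: (congr1 val h).
exact: val_inj.
Qed.

(** A retraction of M^k onto [factor_mod] lifts through the free covers. The lifts exchange T(P) and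
    the syzygy, but their composite on A^l is the identity only modulo T(P). *)
Lemma factor_lift : in_add M factor_mod ->
  exists k (al : 'I_k -> 'rV[A]_l -> 'rV[A]_r) (be : 'I_k -> 'rV[A]_r -> 'rV[A]_l),
  [/\ forall t, lin (al t), forall t, lin (be t),
      forall t z, inT z -> p (al t z) = 0, forall t v, p v = 0 -> inT (be t v)
    & forall z, inT (z - \sum_t be t (al t z))].
Proof.
move=> /in_add_retract[k [i [j [li lj ij]]]]; have spM : surj pM := sp.
have hal t : exists al, lin al /\ forall z, pM (al z) = i t (factor_q z).
  have [|L lL hL] := semilin_lift (h := fun z => i t (factor_q z)) pM_semilin spM.
    by move=> a z w; rewrite factor_q_semilin li.
  by exists L.
have hbe t : exists be, lin be /\ forall v, factor_q (be v) = j t (pM v).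
  have [|L lL hL] := semilin_lift (h := fun v => j t (pM v)) factor_q_semilin factor_q_surj.
    by move=> a z w; rewrite pM_semilin lj.
  by exists L.
have [al hal'] := choice hal; have [be hbe'] := choice hbe.
exists k, al, be; split=> [t|t|t z|t v|z].
- by case: (hal' t).
- by case: (hbe' t).
- by move=> /factor_q_eq0 h; have [_ e] := hal' t; rewrite -[p _]/(pM _) e h (lin0 (li t)).
- by move=> h; apply/factor_q_eq0; have [_ ->] := hbe' t; rewrite /pM h (lin0 (lj t)).
have -> : z - \sum_t be t (al t z) = z + \sum_t (-1) *: be t (al t z).
  by rewrite -sumrN; congr (_ + _); apply: eq_bigr => t _; rewrite scaleN1r.
apply/factor_q_eq0; have := factor_q_semilin 1 z (\sum_t (-1) *: be t (al t z)).
rewrite scale1r rmorph1 scale1r => ->; rewrite (semilin_sum _ _ _ factor_q_semilin).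
rewrite -[X in X + _]ij -big_split big1 // => t _ /=.
by have [_ ->] := hbe' t; have [_ ->] := hal' t; rewrite rmorphN1 scaleN1r subrr.
Qed.

End FactorModule.

Hypothesis hadd : forall l (P Q : 'M[S]_l), P *m Q = (- f)%:M -> Q *m P = (- f)%:M ->
  in_add M (factor_mod P).

Variables (N0 : lmodType A) (nval : N0 -> 'rV[A]_r) (tn : 'rV[A]_r -> N0).
Hypotheses (nval_lin : lin nval) (nval_inj : injective nval)
  (nvalP : forall v, p (nval v) = 0) (tnK : forall v, p v = 0 -> nval (tn v) = v).

Lemma p_y v : p (y *: v) = 0.
Proof. by rewrite -[p _]/(pM _) -[y *: v]addr0 pM_semilin cover_proj_yv scale0r add0r /pM linear0. Qed.

(* A is a direct summand of a power of N0: R is a summand of a power of M, and the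
   composite A -> A^r -> A of lifts is 1 modulo y, hence a unit; it restricts to
   yA -> N0 -> yA. *)
Lemma cover_ring_summand : exists K (ga : 'I_K -> N0 -> A) (de : 'I_K -> A -> N0),
  [/\ forall t a v w, ga t (a *: v + w) = a * ga t v + ga t w,
      forall t a b c, de t (a * b + c) = a *: de t b + de t c
    & forall a, \sum_t ga t (de t a) = a].
Proof.
(* With P = -f and Q = 1, [factor_mod] is R and T(P) is yA. *)
have PQ : (- f)%:M *m 1%:M = (- f)%:M :> 'M[S]_1 by rewrite mulmx1.
have QP : 1%:M *m (- f)%:M = (- f)%:M :> 'M[S]_1 by rewrite mul1mx.
have [K [al [be [lal lbe hal hbe hT]]]] := factor_lift PQ QP (hadd PQ QP).
have inTy (z : 'rV[A]_1) : inT (- f)%:M z -> exists c, z 0 0 = y * c.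
  move=> [w e]; apply/cover_proj_eq0; rewrite proj_co; apply/quot_pi_eq0.
  exists (- w 0 0); have /rowP/(_ 0) := e; rewrite mul_mx_scalar !mxE => ->.
  by rewrite mulNr mulrC mulNr.
pose e1 : 'rV[A]_1 := const_mx 1.
have [c hc] := inTy _ (hT e1).
pose u := (\sum_t be t (al t e1)) 0 0.
have eu : u = 1 - y * c by rewrite -hc !mxE subKr.
have [u' hu'] := cover_unit_y c; rewrite -eu in hu'.
have hga t (v : N0) : exists a, (be t (nval v)) 0 0 = y * a.
  by apply/inTy/hbe/nvalP.
have yI a b : y * a = y * b -> a = b.
  move=> h; apply/eqP; rewrite -subr_eq0; apply/eqP/(y_inj fS (hf := hf) (hn := hn)).
  by rewrite mulrBr h subrr.
have [ga hga'] : exists ga : 'I_K -> N0 -> A, forall t v, (be t (nval v)) 0 0 = y * ga t v.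
  by exists (fun t v => sval (cid (hga t v))) => t v; exact: svalP (cid (hga t v)).
have hp b t : p ((y * b) *: al t e1) = 0 by rewrite -scalerA p_y.
(* The factor [u'] cancels the unit [u] by which the composite multiplies; the factor [y] brings the
   values into the syzygy. *)
have [de hde] : exists de : 'I_K -> A -> N0, forall t a, nval (de t a) = (y * (a * u')) *: al t e1.
  by exists (fun t a => tn ((y * (a * u')) *: al t e1)) => t a; exact: tnK.
exists K, ga, de; split=> [t a v w|t a b d|a].
- by apply: yI; rewrite -hga' nval_lin lbe !mxE !hga' mulrDr mulrCA.
- have e : y * ((a * b + d) * u') = a * (y * (b * u')) + y * (d * u') by ring.
  apply: nval_inj; apply: etrans (hde _ _) _; rewrite e scalerDl -scalerA -!hde.
  exact/esym/nval_lin.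
apply: yI; rewrite mulr_sumr.
transitivity (\sum_t (y * (a * u')) * be t (al t e1) 0 0).
  by apply: eq_bigr => t _; rewrite -hga' hde (linZ (lbe t)) mxE.
have -> : \sum_t (y * (a * u')) * be t (al t e1) 0 0 = (y * (a * u')) * u.
  by rewrite /u summxE mulr_sumr.
by rewrite -!mulrA hu' mulr1.
Qed.

Section Family.
Variables (l : nat) (P Q : 'M[S]_l).
Hypotheses (PQ : P *m Q = (- f)%:M) (QP : Q *m P = (- f)%:M).

(** The error [H] left by [factor_lift] maps all of A^l into T(P). On T(P) it is a composite T(P) ->
    A^l -> T(P), and A^l is a summand of a power of N; the resulting maps complete the lifts to a
    splitting. *)
Lemma factor_family : exists (J : finType) (ph : J -> 'rV[A]_l -> 'rV[A]_r)
    (ps : J -> N0 -> 'rV[A]_l),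
  [/\ forall j, lin (ph j), forall j, lin (ps j), forall j z, inT P z -> p (ph j z) = 0,
      forall j v, inT P (ps j v) & forall z, inT P z -> \sum_j ps j (tn (ph j z)) = z].
Proof.
have [k [al [be [lal lbe hal hbe hT]]]] := factor_lift PQ QP (hadd PQ QP).
have [K [ga [de [lga lde hgd]]]] := cover_ring_summand.
pose H z := z - \sum_t be t (al t z).
have lH : lin H.
  move=> a u v; rewrite /H scalerBr scaler_sumr addrACA -opprD -big_split; congr (_ - _).
  by apply: eq_bigr => t _; rewrite lal lbe.
exists ('I_k + 'I_l * 'I_K)%type,
  (fun j z => match j with inl t => al t z | inr st => nval (de st.2 (z 0 st.1)) end),
  (fun j v => match j with inl t => be t (nval v)
     | inr st => H (ga st.2 v *: delta_mx 0 st.1) end); split.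
- move=> [t|[s t]] a u v; first exact: lal.
  by rewrite !mxE lde.
- move=> [t|[s t]] a u v; first by rewrite nval_lin lbe.
  by rewrite lga scalerDl -scalerA lH.
- by move=> [t|[s t]] z hz; [exact: hal|exact: nvalP].
- by move=> [t|[s t]] v; [exact/hbe/nvalP|exact: hT].
move=> z hz; rewrite big_sumType /=.
have -> : \sum_(st : 'I_l * 'I_K) H (ga st.2 (tn (nval (de st.2 (z 0 st.1)))) *: delta_mx 0 st.1) = H z.
  rewrite -(pair_big xpredT xpredT (fun s t => H (ga t (tn (nval (de t (z 0 s)))) *: delta_mx 0 s))) /=.
  rewrite [z in RHS]row_sum_delta (lin_sum lH); apply: eq_bigr => s _.
  rewrite -(lin_sum lH) -scaler_suml; congr (H (_ *: _)); rewrite -[RHS]hgd.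
  apply: eq_bigr => t _; congr (ga t _); apply: nval_inj; rewrite tnK //; exact: nvalP.
rewrite /H; under eq_bigr => t _ do rewrite tnK ?hal //.
by rewrite addrC subrK.
Qed.

End Family.

Local Notation NS := (restrict_scalars (io : {rmorphism S -> A}) N0).

Variables (k : nat) (mu : 'I_k -> NS).
Hypothesis bmu : basis mu.

Local Notation cb := (lincomb mu).

Lemma mx_ext q (B C : 'M[S]_(q, k)) : (forall d, cb (d *m B) = cb (d *m C)) -> B = C.
Proof. by move=> h; apply/row_matrixP => i; rewrite !rowE; exact/bmu.2/h. Qed.

Lemma mx_ext_row q l (B C : 'M[S]_(q, l)) : (forall d : 'rV_q, d *m B = d *m C) -> B = C.
Proof. by move=> h; apply/row_matrixP => i; rewrite !rowE. Qed.

Lemma lin_matrix (U : lmodType S) q (nu : 'I_q -> U) (g : U -> NS) : lin g ->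
  exists B : 'M[S]_(q, k), forall d, cb (d *m B) = g (lincomb nu d).
Proof.
move=> lg; have /choice[b hb] : forall i, exists d, cb d = g (nu i) by move=> i; exact: bmu.1.
exists (\matrix_i b i) => d.
rewrite [in RHS]/lincomb mulmx_sum_row (lin_sum (lincomb_lin mu)) (lin_sum lg); apply: eq_bigr => i _.
by rewrite (linZ (lincomb_lin mu)) (linZ lg) rowK hb.
Qed.

Lemma lincomb_rV q (d : 'rV[S]_q) : lincomb (delta_mx 0 : 'I_q -> 'rV[S]_q) d = d.
Proof. by rewrite [RHS]row_sum_delta. Qed.

Lemma row_matrix q (g : 'rV[S]_q -> NS) : lin g ->
  exists B : 'M[S]_(q, k), forall d, cb (d *m B) = g d.
Proof.
by move=> /(lin_matrix (delta_mx 0))[B hB]; exists B => d; rewrite hB lincomb_rV.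
Qed.

Lemma lin_matrix_row l (g : NS -> 'rV[S]_l) : lin g ->
  exists B : 'M[S]_(k, l), forall d, d *m B = g (cb d).
Proof.
move=> lg; exists (\matrix_i g (mu i)) => d.
rewrite mulmx_sum_row /lincomb (lin_sum lg); apply: eq_bigr => i _.
by rewrite (linZ lg) rowK.
Qed.

Lemma nvalS a (u v : NS) : nval (a *: u + v) = io a *: nval u + nval v.
Proof. exact: (nval_lin (io a) u v). Qed.

Definition ymul (v : NS) : NS := y *: (v : N0).

Lemma ymul_lin : lin ymul.
Proof.
move=> a u v; rewrite /ymul -[a *: u]/(io a *: (u : N0)) scalerDr scalerA mulrC -scalerA.
by [].
Qed.

Variable Y : 'M[S]_k.
Hypothesis hYm : forall d, cb (d *m Y) = ymul (cb d).

Lemma cbX i d : cb (d *m Y ^+ i) = (y ^+ i *: (cb d : N0) : N0).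
Proof.
elim: i => [|i IH]; first by rewrite !expr0 mulmx1 scale1r.
by rewrite exprSr mulmxA hYm IH /ymul scalerA -exprS.
Qed.

Lemma syz_cover : cover_mx f N Y.
Proof.
apply: mx_ext => d; rewrite cbX yvX mul_mx_scalar (linZ (lincomb_lin mu)).
by rewrite -rmorphN.
Qed.

(** The map c takes the coefficient of y^N in A^r and multiplies it by y, which lands in the syzygy.
    The coefficient of y^N in y^(N-i) v is the i-th one of v, so the sum of the y^i c(y^(N-i) v) is
    yv. *)
Lemma syz_trace : exists c, trace_identity N Y c.
Proof.
have [g ng] : exists g : NS -> NS, forall v, nval (g v) = y *: emb hf hn (vco N (nval v)).
  by exists (fun v => tn (y *: emb hf hn (vco N (nval v)))) => v; rewrite tnK ?p_y.
have lg : lin g.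
  move=> a u v; apply: nval_inj; apply: etrans (ng _) _; apply: etrans _ (esym (nvalS _ _ _)).
  rewrite (ng u) (ng v) (nvalS a u v) vco_lin emb_lin.
  by rewrite scalerDr !scalerA mulrC.
have [c hc] := lin_matrix mu lg; exists c.
apply: mx_ext => d; rewrite hYm mulmx_sumr (lin_sum (lincomb_lin mu)); apply: nval_inj.
have nval_sum (I : Type) (s : seq I) (F : I -> NS) : nval (\sum_(i <- s) F i) = \sum_(i <- s) nval (F i).
  exact: (lin_sum nval_lin).
rewrite nval_sum [RHS](linZ nval_lin) [in RHS](vcoE (nval (cb d))) scaler_sumr.
apply: eq_bigr => i _; rewrite !mulmxA cbX (linZ nval_lin) hc ng cbX (linZ nval_lin).
rewrite scalerA -exprSr scalerA -exprS; congr (_ *: emb hf hn _).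
have iN : (i <= N)%N by rewrite -ltnS.
by have := vco_shift (i := i) (j := N - i) (nval (cb d)); rewrite subnKC //; apply.
Qed.

(** T(P) is generated over A by the elements xP and yx with x in S^l: a and a' record the maps on
    these, b and b' record z_0 divided by P and z_N. The sum conditions compare coefficients 0 and N
    in powers of y times a generator. *)
Lemma syz_factor_summand l (P Q : 'M[S]_l) : P *m Q = (- f)%:M -> Q *m P = (- f)%:M ->
  factor_summand N Y P Q.
Proof.
move=> PQ QP; have [J [ph [ps [lph lps hph hps hid]]]] := factor_family PQ QP.
have PI (u v : 'rV[S]_l) : u *m P = v *m P -> u = v.
  move=> e; apply/eqP; rewrite -subr_eq0; apply/eqP/(mulP_inj PQ).
  by rewrite mulmxBl e subrr.
pose E (x : 'rV[S]_l) : 'rV[A]_l := emb hf hn x.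
have EP x : inT P (E (x *m P)) by exists x; rewrite vco_emb.
have Ey x : inT P (y *: E x).
  by exists (vco N (E x) *m Q); rewrite vco_y0 -mulmxA QP mul_mx_scalar.
have [al hal] : exists al : J -> 'rV[S]_l -> NS, forall j x, nval (al j x) = ph j (E (x *m P)).
  by exists (fun j x => tn (ph j (E (x *m P)))) => j x; rewrite tnK ?hph.
have [al' hal'] : exists al : J -> 'rV[S]_l -> NS, forall j x, nval (al j x) = ph j (y *: E x).
  by exists (fun j x => tn (ph j (y *: E x))) => j x; rewrite tnK ?hph.
have [be hbe] : exists be : J -> NS -> 'rV[S]_l, forall j v, vco 0 (ps j v) = be j v *m P.
  by exists (fun j v => sval (cid (hps j v))) => j v; exact: svalP (cid (hps j v)).
have lal j : lin (al j).
  move=> a u v; apply: nval_inj; apply: etrans (hal _ _) _; apply: etrans _ (esym (nvalS _ _ _)).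
  by rewrite (hal j u) (hal j v) mulmxDl -scalemxAl /E emb_lin lph.
have lal' j : lin (al' j).
  move=> a u v; apply: nval_inj; apply: etrans (hal' _ _) _; apply: etrans _ (esym (nvalS _ _ _)).
  by rewrite (hal' j u) (hal' j v) /E emb_lin scalerDr !scalerA mulrC -scalerA lph.
have psS j a (u v : NS) : ps j (a *: u + v : NS) = io a *: ps j u + ps j v by exact: lps.
have lbe j : lin (be j).
  by move=> a u v; apply: PI; rewrite -hbe psS vco_lin !hbe mulmxDl -scalemxAl.
have lbe' j : lin (fun v : NS => vco N (ps j v)).
  by move=> a u v; rewrite psS vco_lin.
have [a ha] := choice (fun j => row_matrix (lal j)).
have [a' ha'] := choice (fun j => row_matrix (lal' j)).
have [b hb] := choice (fun j => lin_matrix_row (lbe j)).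
have [b' hb'] := choice (fun j => lin_matrix_row (lbe' j)).
have yS i (v : NS) : nval (y ^+ i *: (v : N0)) = y ^+ i *: nval v by exact: (linZ nval_lin).
have psy j i (v : NS) : ps j (y ^+ i *: (v : N0)) = y ^+ i *: ps j v by exact: (linZ (lps j)).
have ymulE v : nval (ymul v) = y *: nval v by exact: (linZ nval_lin).
have ida x : \sum_j ps j (al j x) = E (x *m P).
  rewrite -[RHS]hid //; apply: eq_bigr => j _; congr (ps j _); apply: nval_inj.
  by rewrite hal tnK ?hph.
have ida' x : \sum_j ps j (al' j x) = y *: E x.
  rewrite -[RHS]hid //; apply: eq_bigr => j _; congr (ps j _); apply: nval_inj.
  by rewrite hal' tnK ?hph.
have vsum i (F : J -> 'rV[A]_l) : vco i (\sum_j F j) = \sum_j vco i (F j).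
  apply: (big_morph (vco i)) => [u v|].
    by have := vco_lin i 1 u v; rewrite rmorph1 !scale1r.
  by apply/rowP => t; rewrite !mxE co0.
exists J, a, a', b, b'; split=> [j|]; split.
- apply: mx_ext => d; rewrite !mulmxA ha' hYm ha; apply: nval_inj.
  by rewrite hal' ymulE hal (linZ (lph j)).
- apply: mx_ext => d; rewrite !mulmxA ha cbX ha'; apply: nval_inj.
  rewrite hal yS hal' -(linZ (lph j)) scalerA -exprSr yvX -mulmxA QP mul_mx_scalar.
  congr (ph j _); apply/rowP => t; by rewrite !mxE rmorphM rmorphN.
- apply: mx_ext_row => d; rewrite !mulmxA hb -hbe hb' cbX psy.
  by have := vco_shift (i := 0) (j := N) (ps j (cb d)) (leqnn N).
- apply: mx_ext_row => d; apply: PI; rewrite !mulmxA hb hb' -hbe hYm.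
  rewrite -[ymul _]/(y *: (cb d : N0)) -[y]expr1 psy expr1 vco_y0 -mulmxA QP.
  by rewrite mul_mx_scalar.
- apply: mx_ext_row => d; apply: PI; rewrite mulmx1 mulmx_sumr mulmx_suml.
  rewrite -[RHS](vco_emb hf hn) -/(E _) -ida vsum; apply: eq_bigr => j _.
  by rewrite !mulmxA hb ha hbe.
- move=> i iN; apply: mx_ext_row => d; rewrite mulmx0 mulmx_sumr.
  transitivity (vco N (y ^+ i *: E (d *m P))).
    rewrite -ida scaler_sumr vsum; apply: eq_bigr => j _.
    by rewrite !mulmxA hb' cbX ha psy.
  by rewrite vco_y_emb ?(ltnW iN) // gtn_eqF // scale0r.
- move=> i iN; apply: mx_ext_row => d; apply: PI; rewrite mulmx0 mul0mx mulmx_sumr mulmx_suml.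
  transitivity (vco 0 (y ^+ i.+1 *: E d)).
    rewrite exprSr -scalerA -ida' scaler_sumr vsum; apply: eq_bigr => j _.
    by rewrite !mulmxA hb cbX ha' -hbe psy.
  by rewrite vco_y_emb // scale0r.
move=> i iN; apply: mx_ext_row => d; rewrite mul_mx_scalar mulmx_sumr.
transitivity (vco N (y ^+ i.+1 *: E d)).
  rewrite exprSr -scalerA -ida' scaler_sumr vsum; apply: eq_bigr => j _.
  by rewrite !mulmxA hb' cbX ha' psy.
by rewrite vco_y_emb // eq_sym.
Qed.

(** * Endomorphisms of the syzygy as the centraliser of Y *)

Definition endS (g : end_ring N0) : NS -> NS := fun_of_end g.

Lemma endS_lin g : lin (endS g).
Proof. by move=> a u v; exact: (end_lin g (io a) u v). Qed.
Lemma endS_y g v : endS g (ymul v) = ymul (endS g v).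
Proof. exact: (fun_of_endZ g y v). Qed.
Lemma endS_inj g h : (forall v, endS g v = endS h v) -> g = h.
Proof. by move=> e; apply: fun_of_end_inj => v; exact: e. Qed.
Lemma endSB g h v : endS (g - h) v = endS g v - endS h v.
Proof. exact: (fun_of_endB g h v). Qed.
Lemma endS1 v : endS 1 v = v.
Proof. exact: (@fun_of_end1 A N0 v). Qed.
Lemma endSM g h v : endS (g * h) v = endS h (endS g v).
Proof. exact: (fun_of_endM g h v). Qed.

Lemma end_matrix (g : end_ring N0) :
  exists B : 'M[S]_k, forall d, cb (d *m B) = endS g (cb d).
Proof. by apply: lin_matrix; exact: endS_lin. Qed.

Definition end_mx (g : end_ring N0) : 'M[S]_k := sval (cid (end_matrix g)).

Lemma end_mxE g d : cb (d *m end_mx g) = endS g (cb d).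
Proof. by move: d; exact: svalP (cid (end_matrix g)). Qed.

Lemma end_mx_comm g : Y *m end_mx g = end_mx g *m Y.
Proof. by apply: mx_ext => d; rewrite !mulmxA end_mxE !hYm end_mxE endS_y. Qed.

Lemma end_mx_inj : injective end_mx.
Proof.
move=> g h e; apply: endS_inj => x; have [d <-] := bmu.1 x.
by rewrite -!end_mxE e.
Qed.

Lemma end_mxB g h : end_mx (g - h) = end_mx g - end_mx h.
Proof.
by apply: mx_ext => d; rewrite mulmxBr (linB (lincomb_lin mu)) !end_mxE endSB.
Qed.

Lemma end_mx1 : end_mx 1 = 1%:M.
Proof. by apply: mx_ext => d; rewrite end_mxE mulmx1 endS1. Qed.

Lemma end_mxM g h : end_mx (g * h) = end_mx g *m end_mx h.
Proof. by apply: mx_ext => d; rewrite mulmxA !end_mxE endSM. Qed.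

Lemma end_mx_surj (B : 'M[S]_k) : Y *m B = B *m Y -> exists g, end_mx g = B.
Proof.
move=> hB; have /choice[cr hcr] := bmu.1.
have crK d : cr (cb d) = d by apply: bmu.2; rewrite hcr.
pose g (v : N0) : N0 := cb (cr v *m B).
have gcb d : g (cb d) = cb (d *m B) by rewrite /g crK.
have gS s (u v : NS) : g (s *: u + v : NS) = (s *: (g u : NS) + g v : NS).
  have [d <-] := bmu.1 u; have [e <-] := bmu.1 v.
  by rewrite -(lincomb_lin mu) !gcb mulmxDl -scalemxAl (lincomb_lin mu).
have gD u v : g (u + v) = g u + g v.
  by have := gS 1 u v; rewrite !scale1r.
have gy i v : g (y ^+ i *: v) = y ^+ i *: g v.
  have [d <-] := bmu.1 v; rewrite -cbX !gcb -cbX -!mulmxA.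
  by rewrite (commX i hB).
have gZ a v : g (a *: v) = a *: g v.
  rewrite [a in LHS](coE a) [a in RHS](coE a) !scaler_suml.
  rewrite (big_morph g gD (id1 := 0)); last by apply: (addrI (g 0)); rewrite -gD !addr0.
  apply: eq_bigr => i _; rewrite -!scalerA -gy.
  exact: (linZ (gS : lin (g : NS -> NS)) (co i a) (y ^+ i *: v)).
have lg : lin g by move=> a u v; rewrite gD gZ.
exists (lin_pack lg : end_ring N0); apply: mx_ext => d; rewrite end_mxE.
exact: gcb.
Qed.

End Syzygy.

(** * Maximal Cohen-Macaulay modules over the hypersurface *)

Section PrimeChains.
Variable A : comNzRingType.

Lemma pchain_prime_chain l (P : A -> Prop) : is_prime P -> pchain l P -> prime_chain A l.
Proof.
move=> pP ch.
have [F [F0 Fp Fs]] : exists F : nat -> A -> Prop, [/\ F 0%N = P,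
    forall i, (i <= l)%N -> is_prime (F i)
  & forall i, (i < l)%N -> (forall a, F i a -> F i.+1 a) /\ ~ (forall a, F i.+1 a -> F i a)].
  elim: l P pP ch => [|l IH] P pP; first by exists (fun=> P).
  case=> Q [pQ sPQ nQP /(IH Q pQ)[F [F0 Fp Fs]]].
  exists (fun i => if i is j.+1 then F j else P); split=> // [[|i] //|[|i] //]; last exact: Fs.
    exact: Fp.
  by rewrite F0.
exists (fun i a => `[< F i a >]); split=> [i il|i il].
  have [iF F1 FM] := Fp i il; split; first split.
  - by apply/asboolP; exact: ideal0 iF.
  - by apply/negP => /asboolP.
  - by move=> a u v /asboolP hu /asboolP hv; apply/asboolP; exact: iF.2.
  by move=> u v /asboolP /FM[] h; apply/orP; [left|right]; apply/asboolP.
have [h1 h2] := Fs i il; split=> [a /asboolP h|h]; first exact/asboolP/h1.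
by apply: h2 => a h'; apply/asboolP/h/asboolP.
Qed.

Lemma prime_chain_pchain l : prime_chain A l -> exists2 P : A -> Prop, is_prime P & pchain l P.
Proof.
move=> [F [Fp Fs]].
have pF i : (i <= l)%N -> is_prime (fun a => a \in F i).
  move=> /Fp[[F0 F1 FM] Fpr]; split; [by split=> // a u v; exact: FM|exact/negP|].
  by move=> a b /Fpr/orP.
suff h j i : (i + j = l)%N -> pchain j (fun a => a \in F i).
  by exists (fun a => a \in F 0%N); [exact: pF|exact: h].
elim: j i => [//|j IH] i e.
have [|s1 s2] := Fs i; first by rewrite -e; lia.
exists (fun a => a \in F i.+1); split=> //.
- by apply: pF; rewrite -e; lia.
- by apply: IH; rewrite -e addSnnS.
Qed.

Lemma pchainW l l' (P : A -> Prop) : (l' <= l)%N -> pchain l P -> pchain l' P.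
Proof.
elim: l' l P => // l' IH [//|l] P ll [Q [pQ s n ch]].
by exists Q; split=> //; exact: IH ch.
Qed.

End PrimeChains.

(** * Transfer between a ring and its principal quotient *)

Section QuotientTransfer.
Variables (A : comNzRingType) (a : A) (ha : ~ unit_elt a).
Local Notation Q := (principal_quot ha).
Local Notation pi := (quot_pi ha).

Lemma pchain_pullback l (P : Q -> Prop) :
  (is_prime P -> is_prime (fun x => P (pi x))) /\ (pchain l P -> pchain l (fun x => P (pi x))).
Proof.
have hp (P' : Q -> Prop) : is_prime P' -> is_prime (fun x => P' (pi x)).
  move=> [iP P1 PM]; split.
  - split=> [|c u v hu hv]; first by rewrite rmorph0; exact: ideal0.
    by rewrite rmorphD rmorphM; exact: iP.2.
  - by rewrite rmorph1.
  by move=> x y; rewrite rmorphM => /PM.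
split; first exact: hp.
elim: l P => // l IH P [P' [pP' s n /IH ch]].
exists (fun x => P' (pi x)); split=> //; first exact: hp.
- by move=> x; exact: s.
by move=> h; apply: n => x; have [u <-] := quot_pi_surj x; exact: h.
Qed.

Lemma noeth_quot : noeth A^o -> noeth Q^o.
Proof.
move=> nA W sW; have [|s hs] := nA (fun x => W (pi x)).
  split=> [|c u v hu hv]; first by rewrite rmorph0; case: sW.
  by rewrite rmorphD rmorphM; exact: sW.2.
exists [seq (pi x : Q^o) | x <- s] => v; have [u <-] := quot_pi_surj v.
split=> [/hs|].
  elim: (s) (u) => [|g t IH] x /=; first by move=> ->; rewrite rmorph0.
  by case=> c _ /IH h; exists (pi c) => //; rewrite -[_ *: _]rmorphM -rmorphB.
apply: span_sub => // g /mapP[x xs ->]; exact/hs/mem_span.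
Qed.

Lemma regseq_quot (W : A^o -> Prop) (W' : Q^o -> Prop) xs : (forall x, W x <-> W' (pi x)) ->
  regseq W xs -> regseq W' [seq pi x | x <- xs].
Proof.
elim: xs W W' => //= x xs IH W W' hW [hx hxs]; split.
  move=> v; have [u <-] := quot_pi_surj v => h; apply/hW/hx/hW.
  by rewrite [pi _]rmorphM.
apply: IH hxs => v; split=> [[u h _]|[u h _]].
  by exists (pi u) => //; move/hW: h; rewrite rmorphB rmorphM.
have [w ew] := quot_pi_surj u; exists w => //; apply/hW.
by rewrite rmorphB rmorphM; rewrite -ew in h.
Qed.

Lemma regseq_restrict (M : lmodType Q) (W : M -> Prop) xs :
  regseq W [seq pi x | x <- xs] ->
  regseq (W : restrict_scalars (pi : {rmorphism A -> Q}) M -> Prop) xs.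
Proof.
by elim: xs W => //= x xs IH W [hx hxs]; split; [exact: hx | exact: IH].
Qed.

Lemma fin_gen_restrict (M : lmodType Q) : fin_gen M ->
  fin_gen (restrict_scalars (pi : {rmorphism A -> Q}) M).
Proof.
move=> [r [g hg]]; exists r, g => x; have [c ->] := hg x.
have /choice[b hb] : forall i, exists b, pi b = c i by move=> i; exact: quot_pi_surj.
by exists b; apply: eq_bigr => i _; rewrite -hb.
Qed.

End QuotientTransfer.

Lemma not_addxs (A : comNzRingType) (m : A -> Prop) (V : lmodType A) xs :
  is_prime m -> (forall a, ~ m a -> unit_elt a) -> noeth V -> (forall x, x \in xs -> m x) ->
  ~ zero_module V -> exists v : V, ~ addxs zeroP xs v.
Proof.
move=> pm um nV mxs nz; apply: contrapT => h; apply: nz => v.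
have [s hs] := nV _ (submodT V).
apply: (nakayama pm um nV (submodT V) (submod_zero V)) I => {}v _.
exists 0 => //; exists s; split=> //; rewrite subr0.
have hv : addxs zeroP xs v by apply: contrapT => nv; apply: h; exists v.
have sI := span_in_submod s (prime_ideal_of pm).
apply: (addxs_min sI _ _ hv) => [u ->|x u xx]; first exact: submod0.
by apply: span_in_scale; [exact: prime_ideal_of|exact: mxs|exact/hs].
Qed.

Section FactorMCM.
Variables (S : comNzRingType) (f : S) (hf : ~ unit_elt f).
Local Notation R := (principal_quot hf).
Local Notation pi := (quot_pi hf).
Hypothesis fS : forall a : S, f * a = 0 -> a = 0.

Section OneFactor.
Variables (l : nat) (P Q : 'M[S]_l).
Hypotheses (PQ : P *m Q = (- f)%:M) (QP : Q *m P = (- f)%:M).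

Lemma factor_next_mem (x : 'rV[R]_l) : factor_bar (hf := hf) P x \in ker_pred (lin_pack (factor_bar_lin (hf := hf) Q)).
Proof.
apply/eqP; rewrite /= /factor_bar -mulmxA -map_mxM PQ.
have -> : map_mx pi (- f)%:M = 0 :> 'M[R]_l; last by rewrite mulmx0.
apply/matrixP => i j; rewrite !mxE; apply/quot_pi_eq0; exists (- (i == j)%:R).
by case: (i == j); rewrite ?mulr1n ?mulN1r ?mulr0n ?oppr0 ?mul0r.
Qed.

(** Its kernel is [factor_mod hf P]; together with the same map for [Q] and [P] it gives the
    2-periodic sequences of a matrix factorization. *)
Definition factor_next (x : 'rV[R]_l) : factor_mod hf Q := exist _ (factor_bar (hf := hf) P x) (factor_next_mem x).

Lemma factor_next_lin : lin factor_next.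
Proof. by move=> a u v; apply: val_inj; exact: (factor_bar_lin (hf := hf) P). Qed.

Lemma factor_next_surj : surj factor_next.
Proof.
move=> x; have [u hu] := pi_row_surj (val x).
have /eqP := valP x; rewrite /= /factor_bar -hu -pi_row_mul => /pi_row_eq0.
move=> /(mulQ_sub_f fS PQ QP)[w e]; exists (pi_row hf w); apply: val_inj.
by rewrite /= /factor_bar -pi_row_mul -e.
Qed.

Lemma factor_ses : ses (fun x : factor_mod hf P => val x) factor_next zeroP zeroP zeroP.
Proof.
split; try exact: submod_zero.
  by move=> x; split=> [h|->] //; exact: val_inj.
move=> v; split=> [h|[x /eqP]].
  have hv : v \in ker_pred (lin_pack (factor_bar_lin (hf := hf) P)) by apply/eqP; exact: (congr1 val h).
  by exists (exist _ v hv); rewrite subrr.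
by rewrite subr_eq0 => /eqP->; apply: val_inj; exact/eqP/(valP x).
Qed.

End OneFactor.

Variables (m : S -> Prop) (mR : {pred R}) (d : nat) (xs : seq S).
Hypotheses (nS : noeth S^o) (lR : local_with mR) (kR : krull_dim R d).
Hypotheses (sxs : size xs = d) (mxs : forall x, x \in xs -> pi x \in mR)
  (hxs : regseq (addx (fun a : S^o => a = 0) f) xs).

Lemma hypersurface_regseq_quot : regseq (fun a : R^o => a = 0) [seq pi x | x <- xs].
Proof.
apply: regseq_quot hxs => x; split=> [[u /eqP]|/quot_pi_eq0[b e]].
  by rewrite subr_eq0 => /eqP-> _; apply/quot_pi_eq0; exists u; exact: mulrC.
by exists b => //; rewrite e /GRing.scale /= mulrC subrr.
Qed.

(** The depth is at least [d] because [xs] is regular on R^l and the periodic sequences transmit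
    this; it is at most [d] because a regular sequence produces a chain of primes of its length. *)
Lemma factor_mod_MCM l (P Q : 'M[S]_l) : P *m Q = (- f)%:M -> Q *m P = (- f)%:M ->
  MCM (factor_mod hf P).
Proof.
move=> PQ QP; have nR := noeth_quot (ha := hf) nS.
have [pmR umR] := local_maximal nR lR.
have umR' a : ~ (a \in mR) -> unit_elt a by move/negP; exact: umR.
have nE : noeth (factor_mod hf P).
  apply: (noeth_inj (j := fun x : factor_mod hf P => val x)) => //; first exact: val_inj.
  exact: noeth_fg (rV_fin_gen _ _).
split; first by have [s hs] := nE _ (submodT _); apply: (fg_span (s := s)) => v; exact/hs.
have [z|nz] := EM (zero_module (factor_mod hf P)); [by left|right].
exists mR, d; split=> //; split=> [|s x].
  have sz : size [seq pi x | x <- xs] = d by rewrite size_map.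
  exists (fun i : 'I_d => [seq pi x | x <- xs]`_i); apply/regular_sequenceE.
  have -> : [seq [seq pi x | x <- xs]`_i | i : 'I_d <- enum 'I_d] = [seq pi x | x <- xs].
    apply: (@eq_from_nth _ 0); first by rewrite size_map size_enum_ord.
    move=> i; rewrite size_map size_enum_ord => id.
    by rewrite (nth_map (Ordinal id)) ?size_enum_ord // nth_enum_ord.
  have mx' y : y \in [seq pi x | x <- xs] -> y \in mR by move=> /mapP[x /mxs h ->].
  split=> //; last exact: not_addxs pmR umR' nE mx' nz.
  have bF : basis (delta_mx 0 : 'I_l -> 'rV[R]_l).
    have e c : lincomb (delta_mx 0 : 'I_l -> 'rV[R]_l) c = c by rewrite [RHS]row_sum_delta.
    by split=> [x|u v]; [exists x; exact: e | rewrite !e].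
  have rF := regseq_free_module bF hypersurface_regseq_quot.
  apply: (periodic_regseq _ (factor_next_lin PQ) (factor_next_surj PQ QP) _
    (factor_next_lin QP) (factor_next_surj QP PQ) (factor_ses PQ) (factor_ses QP) rF) => //.
move=> /regular_sequenceE[_ h1 h2].
have [P' [pP' _ ch]] := regseq_pchain nR (submod_zero _) h1 h2.
rewrite size_map size_enum_ord in ch.
by case: kR => _; apply; exact: pchain_prime_chain ch.
Qed.

End FactorMCM.

(** * Both sides of the endomorphism ring *)

Section Transpose.
Variables (S : comNzRingType) (f : S) (N k : nat) (Y : 'M[S]_k).

Lemma trmxX l (Z : 'M[S]_l) i : (Z ^+ i)^T = Z^T ^+ i.
Proof.
elim: i => [|i IH]; first by rewrite !expr0 trmx1.
by rewrite exprS trmx_mul IH exprSr.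
Qed.

Lemma cover_mx_tr : cover_mx f N Y -> cover_mx f N Y^T.
Proof. by rewrite /cover_mx => h; rewrite -trmxX h tr_scalar_mx. Qed.

Lemma trace_identity_tr c : trace_identity N Y c -> trace_identity N Y^T c^T.
Proof.
rewrite /trace_identity => h; rewrite -[in RHS]h raddf_sum [RHS](reindex_inj rev_ord_inj).
apply: eq_bigr => i _; rewrite /= !trmx_mul !trmxX mulmxA subSS.
by rewrite subKn // -ltnS.
Qed.

(** The hypothesis is applied to Q^T and P^T: transposition exchanges the maps into T(P) with the
    maps out of it, and so the second and third sum conditions. *)
Lemma factor_summand_tr : (forall l (P Q : 'M[S]_l), P *m Q = (- f)%:M ->
    Q *m P = (- f)%:M -> factor_summand N Y P Q) ->
  forall l (P Q : 'M[S]_l), P *m Q = (- f)%:M -> Q *m P = (- f)%:M ->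
    factor_summand N Y^T P Q.
Proof.
move=> h l P Q PQ QP.
have [||J [a [a' [b [b' [h1 [s1 s2 s3 s4]]]]]]] := h l Q^T P^T.
- by rewrite -trmx_mul PQ tr_scalar_mx.
- by rewrite -trmx_mul QP tr_scalar_mx.
have trsum (F : J -> 'M[S]_l) : (\sum_j F j)^T = \sum_j (F j)^T by rewrite raddf_sum.
exists J, (fun j => (b j)^T), (fun j => (b' j)^T), (fun j => (a j)^T), (fun j => (a' j)^T).
split=> [j|]; [split|split=> [|i iN|i iN|i iN]].
- by have [_ _ _ e] := h1 j; rewrite -[LHS]trmxK trmx_mul trmxK e trmx_mul.
- by have [_ _ e _] := h1 j; rewrite -[LHS]trmxK trmx_mul trmxK e trmx_mul trmxX.
- by have [_ e _ _] := h1 j; rewrite -[LHS]trmxK trmx_mul trmxK e trmx_mul trmxX.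
- by have [e _ _ _] := h1 j; rewrite -[LHS]trmxK trmx_mul trmxK e trmx_mul.
- by rewrite -[RHS]trmx1 -s1 trsum; apply: eq_bigr => j _; rewrite trmx_mul.
- apply: etrans _ (etrans (congr1 trmx (s3 i iN)) (trmx0 _ _ _)); rewrite trsum.
  by apply: eq_bigr => j _; rewrite !trmx_mul trmxX mulmxA.
- apply: etrans _ (etrans (congr1 trmx (s2 i iN)) (trmx0 _ _ _)); rewrite trsum.
  by apply: eq_bigr => j _; rewrite !trmx_mul trmxX mulmxA.
rewrite -[RHS]tr_scalar_mx -(s4 i iN) trsum; apply: eq_bigr => j _.
by rewrite !trmx_mul trmxX mulmxA.
Qed.

End Transpose.

Lemma has_res_zero (L : pzRingType) (X : lmodType L) : zero_module X -> has_res X.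
Proof.
move=> zX; have l0 : lin (fun _ : X => 0 : X) by move=> a u v; rewrite scaler0 addr0.
have pX : projective X.
  by move=> U V g h _; exists \0 => x; rewrite (zX x) !linear0.
apply: (has_res_periodic (ep := fun _ : X => 0 : X) l0 _ l0 l0 pX pX) => x.
- by exists 0; rewrite (zX x).
- by split=> _; [exists 0; rewrite (zX x)|].
- by split=> _; [exists 0; rewrite (zX x)|].
by split=> _; [exists 0; rewrite (zX x)|].
Qed.

Lemma basis_transport (A : comNzRingType) (U V : lmodType A) l (mu : 'I_l -> U) (g : U -> V) :
  lin g -> injective g -> surj g -> basis mu -> basis (fun i => g (mu i)).
Proof.
move=> lg ig sg [smu imu].
have e c : lincomb (fun i => g (mu i)) c = g (lincomb mu c).
  by rewrite /lincomb (lin_sum lg); apply: eq_bigr => i _; rewrite (linZ lg).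
split=> [v|c d].
  by have [u <-] := sg v; have [c <-] := smu u; exists c.
by rewrite !e => /ig/imu.
Qed.

Section SyzygyEndomorphisms.
Variables (S : comNzRingType) (f : S) (hf : ~ unit_elt f) (N : nat) (hn : (0 < N.+1)%N).
Local Notation A := (branched_cover hf hn).
Local Notation R := (principal_quot hf).
Local Notation FS r := (restrict_scalars (iota hf hn : {rmorphism S -> A}) 'rV[A]_r).

Lemma cover_rV_basis r : exists l (nu : 'I_l -> FS r), basis nu.
Proof.
have [nu bnu] := mx_basis S r N.+1.
pose g (B : 'M[S]_(r, N.+1)) : FS r := \row_i \sum_j iota hf hn (B i j) * yv hf hn ^+ j.
have lg : lin g.
  move=> a u v; apply/rowP => i; rewrite !mxE mulr_sumr -big_split; apply: eq_bigr => j _.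
  by rewrite !mxE rmorphD rmorphM mulrDl mulrA.
have gE B i : coefs (g B 0 i) = row i B.
  by apply: coefs_unique; rewrite mxE; apply: eq_bigr => j _; rewrite mxE.
exists _, (fun i => g (nu i)); apply: (basis_transport lg) bnu.
  by move=> B C e; apply/row_matrixP => i; rewrite -!gE e.
move=> z; exists (\matrix_(i, j) coefs (z 0 i) 0 j); apply/rowP => i; rewrite mxE.
by rewrite -[RHS]coefsK; apply: eq_bigr => j _; rewrite mxE.
Qed.

Variables (k : nat) (K : lmodType A).
Variable mu : 'I_k -> restrict_scalars (iota hf hn : {rmorphism S -> A}) K.
Hypothesis bmu : basis mu.
Variable Y : 'M[S]_k.
Hypothesis hYm : forall d, lincomb mu (d *m Y) = ymul (lincomb mu d).

Definition end_rmorph : {rmorphism end_ring K -> 'M[S]_k} :=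
  HB.pack (end_mx bmu)
    (GRing.isZmodMorphism.Build (end_ring K) 'M[S]_k (end_mx bmu) (end_mxB bmu))
    (GRing.isMonoidMorphism.Build (end_ring K) 'M[S]_k (end_mx bmu)
      (conj (end_mx1 bmu) (end_mxM bmu))).

(** Right modules are left modules over the opposite ring, which transposition identifies with the
    centraliser of Y^T. *)
Definition end_mx_tr (g : (end_ring K)^c) : 'M[S]_k := (end_mx bmu g)^T.

Fact end_mx_tr_zmod : zmod_morphism end_mx_tr.
Proof. by move=> g h; rewrite /end_mx_tr end_mxB raddfB. Qed.
Fact end_mx_tr_monoid : monoid_morphism end_mx_tr.
Proof.
split=> [|g h]; rewrite /end_mx_tr; first by rewrite end_mx1 trmx1.
by rewrite end_mxM trmx_mul.
Qed.

Definition end_rmorph_tr : {rmorphism (end_ring K)^c -> 'M[S]_k} :=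
  HB.pack end_mx_tr
    (GRing.isZmodMorphism.Build (end_ring K)^c 'M[S]_k end_mx_tr end_mx_tr_zmod)
    (GRing.isMonoidMorphism.Build (end_ring K)^c 'M[S]_k end_mx_tr end_mx_tr_monoid).

Hypotheses (fS : forall a : S, f * a = 0 -> a = 0) (nS : noeth S^o).
Hypothesis hS : forall l (P Q : 'M[S]_l), P *m Q = (- f)%:M -> Q *m P = (- f)%:M ->
  factor_summand N Y P Q.
Hypothesis hc : exists c, trace_identity N Y c.
Variable gs : seq S.
Hypotheses (rgs : regseq (fun a : S^o => a = 0) gs)
  (free_gs : forall V : lmodType S, fin_gen V -> regseq (fun v : V => v = 0) gs ->
    exists l (nu : 'I_l -> V), basis nu).

Lemma end_has_res (X : lmodType (end_ring K)) : fin_gen X -> has_res X.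
Proof.
have [c hc'] := hc.
have hY := syz_cover bmu hYm.
have /choice[tinv htinv] : forall B : 'M[S]_k, exists g, Y *m B = B *m Y -> end_mx bmu g = B.
  move=> B; have [h|h] := EM (Y *m B = B *m Y); last by exists 0.
  by have [g hg] := end_mx_surj bmu hYm h; exists g.
apply: (centraliser_has_res fS hY hc' (th := end_rmorph) (tinv := tinv) _ _ htinv nS hS rgs free_gs).
  exact: (end_mx_comm bmu hYm).
exact: end_mx_inj.
Qed.

Lemma end_has_res_tr (X : lmodType (end_ring K)^c) : fin_gen X -> has_res X.
Proof.
have [c hc'] := hc.
have hY := syz_cover bmu hYm.
have /choice[tinv htinv] : forall B : 'M[S]_k, exists g : (end_ring K)^c,
    Y^T *m B = B *m Y^T -> end_mx_tr g = B.
  move=> B; have [h|h] := EM (Y^T *m B = B *m Y^T); last by exists 0.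
  have h' : Y *m B^T = B^T *m Y by rewrite -[LHS]trmxK trmx_mul trmxK -h trmx_mul trmxK.
  have [g hg] := end_mx_surj bmu hYm h'; exists g => _.
  by rewrite /end_mx_tr hg trmxK.
apply: (centraliser_has_res fS (cover_mx_tr hY) (trace_identity_tr hc') (th := end_rmorph_tr)
  (tinv := tinv) _ _ htinv nS (factor_summand_tr hS) rgs free_gs).
  by move=> a; rewrite /= /end_mx_tr -!trmx_mul (end_mx_comm bmu hYm).
by move=> g h /trmx_inj/end_mx_inj.
Qed.

End SyzygyEndomorphisms.

Lemma basis_fin_gen (A : comNzRingType) (V : lmodType A) l (nu : 'I_l -> V) :
  basis nu -> fin_gen V.
Proof. by move=> [snu _]; exists l, nu => v; have [c <-] := snu v; exists (c 0). Qed.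

Lemma trivial_ring_has_res (L : pzRingType) (X : lmodType L) : (1 : L) = 0 -> has_res X.
Proof. by move=> e; apply: has_res_zero => x; rewrite -[x]scale1r e scale0r. Qed.

Lemma max_quot (S : comNzRingType) (f : S) (hf : ~ unit_elt f) (m : {pred S})
  (mR : {pred principal_quot hf}) : noeth S^o -> local_with m -> local_with mR ->
  forall x, quot_pi hf x \in mR <-> x \in m.
Proof.
move=> nS lm lR x.
have [pm um] := local_maximal nS lm; have [pmR umR] := local_maximal (noeth_quot nS) lR.
have im := prime_ideal_of pm; have imR := prime_ideal_of pmR.
have mf : f \in m by apply: contrapT => /negP/um.
split=> h; apply: contrapT => /negP nh.
  have [u hu] := um _ nh; apply: (prime1 pmR).
  by rewrite -(rmorph1 (quot_pi hf)) -hu rmorphM; exact: idealMl imR h.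
have [v hv] := umR _ nh; have [u eu] := quot_pi_surj v.
move: hv; rewrite -eu -rmorphM -(rmorph1 (quot_pi hf)) => /quot_piE[b e].
apply: (prime1 pm); rewrite -[1](subKr (u * x)); apply: (idealB im).
  exact: idealMl im h.
by rewrite e; exact: idealMl im mf.
Qed.

Theorem theorem3p7 (S : comNzRingType) (d : nat) (hd : (1 <= d)%N)
    (hS : regular_local S d.+1) (f : S) (f0 : f <> 0) (hf : ~ unit_elt f)
    (hR : finite_CM_type (principal_quot hf))
    (M : lmodType (principal_quot hf)) (hM : representation_generator M)
    (n : nat) (hn : (1 <= n)%N) (r : nat)
    (p : {linear 'rV[branched_cover hf hn]_r ->
                 restrict_scalars (cover_proj hf hn) M})
    (hp : minimal_free_cover p) :
  let Lambda : pzRingType := end_ring (lin_ker p) in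
  (forall X : lmodType Lambda, fin_gen X ->
     exists P : proj_resolution X, eventually_2periodic P) /\
  (forall X : lmodType Lambda^c, fin_gen X ->
     exists P : proj_resolution X, eventually_2periodic P).
Proof.
case: n hn p hp => [//|N] hn p [sp hmin].
(* A zero [M] carries no depth information; its minimal cover has rank 0, so the endomorphism ring
   is zero. *)
have [zM|nzM] := EM (zero_module M).
  have r0 : r = 0%N.
    apply/eqP; rewrite -leqn0; apply: (hmin 0%N \0) => x.
    by exists 0; rewrite /= [RHS](zM x).
  have e1 : (1 : end_ring (lin_ker p)) = 0.
    apply: fun_of_end_inj => v; apply: val_inj; apply/rowP => i.
    by exfalso; case: i => i; rewrite r0.
  by move=> Lambda; split=> X _; apply: trivial_ring_has_res.
have [nS0 [[chS _] [m [lm [g hg]]]]] := hS; have nS := noetherian_noeth nS0.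
have [pm um'] := local_maximal nS lm; have im := prime_ideal_of pm.
have um a : ~ (a \in m) -> unit_elt a by move/negP; exact: um'.
pose gl := [seq g i | i <- enum 'I_d.+1].
have sgl : size gl = d.+1 by rewrite size_map size_enum_ord.
have hgl a : a \in m <-> addxs (fun a : S^o => a = 0) gl a.
  have := in_seq_mulE (V := S^o) g a (leqnn d.+1); rewrite -/gl take_oversize ?sgl // => <-.
  rewrite hg; split=> -[c ->]; exists c.
    by apply: eq_big => [i|i _]; [rewrite ltn_ord|rewrite mulrC].
  by apply: eq_big => [i|i _]; [rewrite ltn_ord|rewrite mulrC].
have [gs [y egl]] : exists gs y, gl = rcons gs y.
  by move: sgl; case/lastP: (gl) => // gs y _; exists gs, y.
have sgs : size gs = d by move: sgl; rewrite egl size_rcons => -[].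
have hdim := prime_chain_pchain chS.
have [pr0 rgl] := regular_gens nS pm um hdim sgl hgl.
have fS (a : S) : f * a = 0 -> a = 0 by have [_ _ h] := pr0 => /h[].
have mf : f \in m by apply: contrapT => /um.
have hgl' := hgl; rewrite egl in hgl'.
have [xs [sxs mxs hxs]] := hypersurface_regseq nS pm um sgs hgl' hdim mf f0.
have [[fM [//|[mR [d' [lR kR [[x hx] _]]]]]] hadd] := hM.
have nR := noeth_quot (ha := hf) nS; have [pmR umR'] := local_maximal nR lR.
have umR a : ~ (a \in mR) -> unit_elt a by move/negP; exact: umR'.
have mq := max_quot nS lm lR.
have mxs' z : z \in xs -> quot_pi hf z \in mR by move=> /mxs /mq.
(* A chain of primes of R pulls back to S and extends below by the zero ideal, which does not
   contain [f]; conversely [xs] gives [d] regular elements on R and hence a chain. *)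
have ed : d' = d.
  apply/eqP; rewrite eqn_leq; apply/andP; split.
    have [P pP chP] := prime_chain_pchain kR.1.
    have [/(_ pP) pP' /(_ chP) ch] := pchain_pullback (ha := hf) d' P.
    rewrite leqNgt; apply/negP => lt.
    apply: (height_le nS pm um (gs := gl) (submod_zero _) _ _ pr0) => //.
    - by move=> z; apply: gens_mem hgl _.
    - by move=> a /hgl.
    rewrite sgl; apply: (pchainW (l := d'.+1)) => //.
    exists (fun z => P (quot_pi hf z)); split=> //.
      by move=> a ->; rewrite rmorph0; apply: ideal0 (prime_ideal_of pP).
    move=> h; apply: f0; apply: h.
    have -> : quot_pi hf f = 0 by apply/quot_pi_eq0; exists 1; rewrite mul1r.
    exact: ideal0 (prime_ideal_of pP).
  have [|P [pP _ ch]] := regseq_pchain nR (submod_zero _) (hypersurface_regseq_quot hf hxs).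
    apply: (not_addxs pmR umR nR) => [z /mapP[x0 /mxs' h ->] //|z0].
    by have /eqP := z0 1; rewrite oner_eq0.
  by apply: kR.2; move: ch; rewrite size_map sxs; exact: pchain_prime_chain.
subst d'.
have [mx rx _] := (regular_sequenceE _ _ _).1 hx.
(* The M-regular sequence in R is lifted to S, so that M has [d] regular elements as an S-module
   too. *)
have [sec hsec] := choice (quot_pi_surj (ha := hf)).
pose ys := [seq sec z | z <- [seq x i | i <- enum 'I_d]].
have eys : [seq quot_pi hf z | z <- ys] = [seq x i | i <- enum 'I_d].
  by rewrite -map_comp map_id_in // => z _; exact: hsec.
have rys := regseq_restrict (M := M) (W := zeroP) (xs := ys).
rewrite eys in rys; have {}rys := rys rx.
have sys : size ys = d by rewrite 2!size_map size_enum_ord.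
have mys z : z \in ys -> z \in m.
  by move=> /mapP[w /mx hw ->]; apply/mq; rewrite hsec.
pose iS : {rmorphism S -> branched_cover hf hn} := iota hf hn.
pose NS := restrict_scalars iS (lin_ker p).
pose FS := restrict_scalars iS 'rV[branched_cover hf hn]_r.
pose MS := restrict_scalars (quot_pi hf : {rmorphism S -> principal_quot hf}) M.
pose nv (v : lin_ker p) : 'rV[branched_cover hf hn]_r := val v.
have lnv : lin nv by [].
have lnvS : lin (nv : NS -> FS) by move=> a u v; exact: (lnv (iS a) u v).
have lpS : lin (p : FS -> MS).
  move=> a u v; apply: etrans (pM_semilin p (iS a) u v) _.
  by rewrite cover_proj_iota.
have nvP v : p (nv v) = 0 by exact/eqP/(valP v).
have tnm v : p v = 0 -> v \in ker_pred p by move/eqP.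
pose tn v : lin_ker p := if pselect (p v = 0) is left h then exist _ v (tnm v h) else 0.
have tnK v : p v = 0 -> nv (tn v) = v by rewrite /tn; case: pselect.
have [lF [nu bnu]] := cover_rV_basis hf hn r.
have nK : noeth NS := noeth_inj lnvS val_inj (noeth_fg nS (basis_fin_gen bnu)).
have fK : fin_gen NS by have [s hs] := nK _ (submodT _); apply: (fg_span (s := s)) => v; exact/hs.
(* A^r is free over S, so the syzygy over A is also a first syzygy over S, of a module whose depth
   is one less than the dimension of S. *)
have [|k [mu bmu]] := syzygy_free nS pm um sgs hgl' hdim lnvS lpS sp val_inj _ bnu fK
  (fin_gen_restrict fM) sys mys rys.
  move=> v; split=> [h|[w <-]]; last exact: nvP.
  by exists (tn v); exact: tnK.
have [Y hY] := lin_matrix bmu mu (ymul_lin (N0 := lin_ker p)).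
have hadd' l (P Q : 'M[S]_l) : P *m Q = (- f)%:M -> Q *m P = (- f)%:M ->
    in_add M (factor_mod hf P).
  by move=> PQ QP; apply/hadd; exact: (factor_mod_MCM fS nS lR kR sxs mxs' hxs PQ QP).
have hfs := syz_factor_summand fS nS pm um mf sp hadd' lnv val_inj nvP tnK bmu hY.
have htr := syz_trace lnv val_inj tnK bmu hY.
have hfree (V : lmodType S) (fV : fin_gen V) := regseq_free nS pm um fV hgl.
by move=> Lambda; split=> X fX;
  [exact: (end_has_res bmu hY fS nS hfs htr rgl hfree fX)|exact: (end_has_res_tr bmu hY fS nS hfs htr rgl hfree fX)].
Qed.
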